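(* Let $n\in\mathbb{N}$. Then $\mathcal{R}_n$ consists of all operators in $\mathcal{B}(\mathcal{F}_n)$ that act invariantly on the subspaces $\mathcal{D}_{d,\min\{n,n+d\}}$ for all integers $d\ge -n+1$, i.e. of all $S\in\mathcal{B}(\mathcal{F}_n)$ with $S(\mathcal{D}_{d,\min\{n,n+d\}})\subseteq \mathcal{D}_{d,\min\{n,n+d\}}$ for every integer $d\ge -n+1$. Furthermore, $$\mathcal{R}_n\cong\bigoplus_{d=-n+1}^\infty \mathcal{B}(\mathcal{D}_{d,\min\{n,n+d\}})\cong\bigoplus_{d=-n+1}^\infty \mathcal{M}_{\min\{n,n+d\}},$$ where $\cong$ means that the algebras are isometrically isomorphic.
   Context: $\mathbb{N}=\{1,2,\ldots\}$, $\mathbb{N}_0=\{0,1,2,\ldots\}$, $\mathbb{T}=\{z\in\mathbb{C}: |z|=1\}$. $\mu$ is the Lebesgue measure on $\mathbb{C}$ and $\gamma$ is the Gaussian measure $d\gamma(z)=\frac1\pi e^{-|z|^2}d\mu(z)$ on $\mathbb{C}$. $\mathcal{F}_n$ is the (closed) subspace of $L^2(\mathbb{C},\gamma)$ consisting of all $n$-analytic functions (smooth $f$ with $\partial^n f/\partial\overline{z}^n=0$) belonging to $L^2(\mathbb{C},\gamma)$. $\mathcal{B}(H)$ denotes the algebra of bounded linear operators on $H$, with the operator norm. For $\tau\in\mathbb{T}$, $R_{n,\tau}$ is the rotation operator on $\mathcal{F}_n$, $(R_{n,\tau}f)(z)=f(\tau^{-1}z)$; $\mathcal{R}_n$ (the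 algebra of radial operators in $\mathcal{F}_n$) is the von Neumann algebra of all $S\in\mathcal{B}(\mathcal{F}_n)$ that commute with $R_{n,\tau}$ for every $\tau\in\mathbb{T}$. For $p,q\in\mathbb{N}_0$ put $m_{p,q}(z)=z^p\overline{z}^q$. For $d\in\mathbb{Z}$ and $m\in\mathbb{N}_0$, the truncated diagonal subspace is $\mathcal{D}_{d,m}=\operatorname{span}\{m_{p,q}: p,q\in\mathbb{N}_0,\ \min\{p,q\}<m,\ p-q=d\}$. $\mathcal{M}_k$ is the algebra of complex $k\times k$ matrices with the operator (spectral) norm. The direct sum $\bigoplus_j \mathcal{A}_j$ of von Neumann algebras is the bounded direct sum: all families $(A_j)_j$ with $A_j\in\mathcal{A}_j$ and $\sup_j\|A_j\|<\infty$, with componentwise operations and the supremum norm. *)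

(* Defs.v *)
From HB Require Import structures.
From mathcomp Require Import all_boot all_order all_algebra.
From mathcomp Require Import complex.
From mathcomp Require Import all_classical all_reals all_analysis.
From mathcomp Require Import ring.
From mathcomp Require Import measurable_realfun.

Set Implicit Arguments.
Unset Strict Implicit.
Unset Printing Implicit Defensive.
Import Order.TTheory GRing.Theory Num.Theory.
Import numFieldNormedType.Exports.
Import ComplexField.Normc.

Local Open Scope classical_set_scope.
Local Open Scope ring_scope.

Section Gaussian.
Context {R : realType}.

Local Notation plane := (measurableTypeR R * measurableTypeR R)%type.
Local Notation leb2 := (@lebesgue_measure R \x @lebesgue_measure R)%E.

Definition toC (p : R * R) : R[i] := (p.1 +i* p.2)%C.
Definition ofC (z : R[i]) : R * R := (complex.Re z, complex.Im z).

Definition gauss_pdf (p : plane) : R := pi^-1 * expR (- normc (toC p) ^+ 2).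

Definition gauss (A : set plane) : \bar R :=
  (\int[leb2]_(p in A) (gauss_pdf p)%:E)%E.

Lemma gauss_pdf_ge0 p : 0 <= gauss_pdf p.
Proof. by rewrite mulr_ge0 ?expR_ge0// invr_ge0 pi_ge0. Qed.

Lemma measurable_gauss_pdf : measurable_fun setT gauss_pdf.
Proof.
apply: measurable_funM => //; apply: measurableT_comp => //.
apply: measurableT_comp => //.
have -> : (fun p : plane => normc (toC p) ^+ 2) =
          (fun p : plane => p.1 ^+ 2 + p.2 ^+ 2).
  by apply/funext => p; rewrite /normc /= sqr_sqrtr// addr_ge0 ?sqr_ge0.
by apply: measurable_funD; apply: measurable_funX.
Qed.

Let gauss0 : gauss set0 = 0%E.
Proof. by rewrite /gauss integral_set0. Qed.

Let gauss_ge0 A : (0 <= gauss A)%E.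
Proof. by apply: integral_ge0 => p _; rewrite lee_fin gauss_pdf_ge0. Qed.

Let gauss_sigma_additive : semi_sigma_additive gauss.
Proof.
move=> F mF tF mUF; rewrite /gauss ge0_integral_bigcup//.
- apply: is_cvg_ereal_nneg_natsum_cond => n _ _.
  exact: gauss_ge0.
- apply: measurable_funTS; apply/measurable_EFinP.
  exact: measurable_gauss_pdf.
- by move=> p _; rewrite lee_fin gauss_pdf_ge0.
Qed.

HB.instance Definition _ := isMeasure.Build _ _ _
  gauss gauss0 gauss_ge0 gauss_sigma_additive.

End Gaussian.

Section Functions.
Context {R : realType}.
Local Notation C := R[i].
Local Notation plane := (measurableTypeR R * measurableTypeR R)%type.
Implicit Types f g : C -> C.

Definition rePart f : R * R -> R := fun p => complex.Re (f (toC p)).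
Definition imPart f : R * R -> R := fun p => complex.Im (f (toC p)).
Definition absPart f : R * R -> R := fun p => normc (f (toC p)).

Definition L2norm f : R :=
  fine ('N[gauss]_2%:E[EFin \o (absPart f : plane -> R)])%E.

Definition L2 : set (C -> C) :=
  [set f | [/\ measurable_fun setT (rePart f : plane -> R),
               measurable_fun setT (imPart f : plane -> R) &
               finite_norm gauss 2%:E (absPart f : plane -> R)]].

(* [false] is the direction of the real axis, [true] of the imaginary axis. *)
Definition dir (b : bool) : R * R := if b then (0, 1) else (1, 0).

Definition pderiv (b : bool) f : C -> C := fun z =>
  ('D_(dir b) (rePart f) (ofC z) +i* 'D_(dir b) (imPart f) (ofC z))%C.

(* Smoothness in the real sense: every iterated partial derivative is
   (Frechet) differentiable, hence also continuous. *)
Definition smooth f : Prop :=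
  forall (s : seq bool) (p : R * R),
    differentiable (rePart (foldr pderiv f s)) p /\
    differentiable (imPart (foldr pderiv f s)) p.

Definition dbar f : C -> C := fun z =>
  2^-1 * (pderiv false f z + 'i%C * pderiv true f z).

Definition nanalytic (n : nat) f : Prop :=
  smooth f /\ forall z, iter n dbar f z = 0.

(* A class of L^2(C, gauss) contains at most one smooth function, so elements of
   the n-th space are represented by honest functions, with no quotient. *)
Definition Fset (n : nat) : set (C -> C) := [set f | L2 f /\ nanalytic n f].

Definition span (X : set (C -> C)) : set (C -> C) :=
  [set f | exists (k : nat) (c : 'I_k -> C) (g : 'I_k -> C -> C),
     (forall i, X (g i)) /\ f = \sum_(i < k) c i *: g i].

Definition monom (p q : nat) : C -> C := fun z => z ^+ p * (z^*)%C ^+ q.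

Definition Dset (d : int) (m : nat) : set (C -> C) :=
  span [set f | exists p q : nat,
    [/\ (minn p q < m)%N, p%:Z - q%:Z = d & f = monom p q]].

Lemma rePart_lin (a : C) f g :
  rePart (a *: f + g) =
  complex.Re a *: rePart f - complex.Im a *: imPart f + rePart g.
Proof.
apply/funext => p; rewrite /rePart /imPart !fctE.
by case: a (f _) (g _) => [a b] [x y] [u v].
Qed.

Lemma imPart_lin (a : C) f g :
  imPart (a *: f + g) =
  complex.Re a *: imPart f + complex.Im a *: rePart f + imPart g.
Proof.
apply/funext => p; rewrite /rePart /imPart !fctE.
by case: a (f _) (g _) => [a b] [x y] [u v].
Qed.

Lemma measurable_absPart f :
  measurable_fun setT (rePart f : plane -> R) ->
  measurable_fun setT (imPart f : plane -> R) ->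
  measurable_fun setT (absPart f : plane -> R).
Proof.
move=> mr mi.
have -> : absPart f =
    (fun p : plane => Num.sqrt (rePart f p ^+ 2 + imPart f p ^+ 2)).
  by apply/funext => p; rewrite /absPart /rePart /imPart; case: (f _).
have -> : (fun p : plane => Num.sqrt (rePart f p ^+ 2 + imPart f p ^+ 2)) =
   (fun p : plane => (rePart f p ^+ 2 + imPart f p ^+ 2) `^ 2^-1).
  by apply/funext => p; rewrite powR12_sqrt ?addr_ge0 ?sqr_ge0.
apply: (measurableT_comp (measurable_powR 2^-1)).
by apply: measurable_funD; apply: measurable_funX.
Qed.

Lemma L2_submod_closed : submod_closed [in L2].
Proof.
split=> [|a f g /set_mem[mf1 mf2 nf] /set_mem[mg1 mg2 ng]].
  apply/mem_set; split.
  - exact: measurable_cst.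
  - exact: measurable_cst.
  - have -> : absPart (0 : C -> C) = cst 0.
      by apply/funext => p; rewrite /absPart/= !expr0n addr0 sqrtr0.
    by rewrite /finite_norm Lnorm0.
have mre : measurable_fun setT (rePart (a *: f + g) : plane -> R).
  rewrite rePart_lin; apply: measurable_funD => //.
  by apply: measurable_funB => //; apply: measurable_funM.
have mim : measurable_fun setT (imPart (a *: f + g) : plane -> R).
  rewrite imPart_lin; apply: measurable_funD => //.
  by apply: measurable_funD => //; apply: measurable_funM.
apply/mem_set; split => //.
have Lf : (absPart f : plane -> R) \in Lfun gauss 2%:E.
  by rewrite inE; apply/andP; split; apply/mem_set => //; exact: measurable_absPart.
have Lg : (absPart g : plane -> R) \in Lfun gauss 2%:E.
  by rewrite inE; apply/andP; split; apply/mem_set => //; exact: measurable_absPart.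
have Lh : (normc a *: (absPart f : plane -> R) + absPart g) \in Lfun gauss 2%:E.
  have [_ +] := @Lfun_submod_closed _ plane R gauss 2%:E (lee1n 2).
  by move=> /(_ (normc a) _ _ Lf Lg).
move: Lh; rewrite inE => /andP[mh /set_mem]; rewrite /= /finite_norm.
apply: le_lt_trans; rewrite unlock /Lnorm.
have aux (h : plane -> R) : measurable_fun setT h ->
    measurable_fun setT (fun p : plane => `|(h p)%:E| `^ 2)%E.
  move=> mk; apply: (measurableT_comp (measurable_poweR 2)).
  by apply: measurableT_comp => //; apply/measurable_EFinP.
apply: gt0_ler_poweR; rewrite ?invr_ge0// ?in_itv/= ?leey ?andbT;
  try by apply: integral_ge0 => p _; rewrite lee_fin powR_ge0.
apply: ge0_le_integral => //=.
- exact: (aux _ (measurable_absPart mre mim)).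
- exact: (aux _ (set_mem mh)).
- move=> p _; rewrite lee_fin; apply: ge0_ler_powR; rewrite ?nnegrE//.
  have ge0 (z : C) : 0 <= normc z by case: z => x y; exact: sqrtr_ge0.
  rewrite !ger0_norm ?addr_ge0 ?mulr_ge0//; try exact: ge0.
  by rewrite (le_trans (le_normcD _ _))// lerD2r /GRing.scale/= normcM.
Qed.

Lemma deriv_lin_comb (a b : R) (u v w : R * R -> R) p e :
  differentiable u p -> differentiable v p -> differentiable w p ->
  'D_e (a *: u + b *: v + w) p = a * 'D_e u p + b * 'D_e v p + 'D_e w p.
Proof.
move=> du dv dw.
have /= du' : derivable u p e by exact: diff_derivable.
have /= dv' : derivable v p e by exact: diff_derivable.
have /= dw' : derivable w p e by exact: diff_derivable.
have dau : derivable (a *: u) p e by exact: derivableZ.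
have dbv : derivable (b *: v) p e by exact: derivableZ.
have dab : derivable (a *: u + b *: v) p e by exact: derivableD.
by rewrite (deriveD dab dw') (deriveD dau dbv) (deriveZ a du') (deriveZ b dv').
Qed.

Lemma differentiable_lin_comb (a b : R) (u v w : R * R -> R) p :
  differentiable u p -> differentiable v p -> differentiable w p ->
  differentiable (a *: u + b *: v + w) p.
Proof.
move=> du dv dw.
have dau : differentiable (a *: u) p by exact: differentiableZ.
have dbv : differentiable (b *: v) p by exact: differentiableZ.
exact: differentiableD (differentiableD dau dbv) dw.
Qed.

Lemma smooth_pderivs (a : C) f g s : smooth f -> smooth g ->
  foldr pderiv (a *: f + g) s = a *: foldr pderiv f s + foldr pderiv g s.
Proof.
move=> sf sg; elim: s => //= b s ->.
apply/funext => z; rewrite {1}/pderiv rePart_lin imPart_lin.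
have [[df1 df2] [dg1 dg2]] := (sf s (ofC z), sg s (ofC z)).
rewrite -scaleNr !deriv_lin_comb// !fctE /pderiv.
by case: a => a1 a2; apply/eqP; rewrite eq_complex /= mulNr !eqxx.
Qed.

Lemma smooth0 : smooth 0.
Proof.
have e0 s : foldr pderiv 0 s = 0.
  elim: s => //= b s ->; apply/funext => z; rewrite /pderiv.
  have -> : rePart (0 : C -> C) = cst 0 by [].
  have -> : imPart (0 : C -> C) = cst 0 by [].
  by rewrite !derive_cst.
by move=> s p; rewrite e0; split; exact: differentiable_cst.
Qed.

Lemma smooth_lin (a : C) f g : smooth f -> smooth g -> smooth (a *: f + g).
Proof.
move=> sf sg s p.
have [[df1 df2] [dg1 dg2]] := (sf s p, sg s p).
rewrite smooth_pderivs// rePart_lin imPart_lin -scaleNr.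
by split; exact: differentiable_lin_comb.
Qed.

Lemma smooth_pderiv b f : smooth f -> smooth (pderiv b f).
Proof. by move=> sf s; rewrite -foldr_rcons; exact: sf. Qed.

Lemma dbarE f :
  dbar f = 2^-1 *: pderiv false f + ((2^-1 * 'i%C) *: pderiv true f + 0).
Proof.
apply/funext => z; rewrite /dbar.
set u := pderiv false f z; set v := pderiv true f z.
transitivity (2^-1 * u + (2^-1 * 'i%C * v + 0)); last by [].
by ring.
Qed.

Lemma smooth_dbar f : smooth f -> smooth (dbar f).
Proof.
move=> sf; rewrite dbarE; apply: smooth_lin; first exact: smooth_pderiv.
by apply: smooth_lin; [exact: smooth_pderiv|exact: smooth0].
Qed.

Lemma smooth_iter_dbar f n : smooth f -> smooth (iter n dbar f).
Proof. by move=> sf; elim: n => //= n; exact: smooth_dbar. Qed.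

Lemma iter_dbar_lin (a : C) f g n : smooth f -> smooth g ->
  iter n dbar (a *: f + g) = a *: iter n dbar f + iter n dbar g.
Proof.
move=> sf sg; elim: n => //= n ->; apply/funext => z; rewrite /dbar.
have sfn := smooth_iter_dbar n sf; have sgn := smooth_iter_dbar n sg.
have E b := smooth_pderivs a [:: b] sfn sgn.
have Ez b : pderiv b (a *: iter n dbar f + iter n dbar g) z =
    a * pderiv b (iter n dbar f) z + pderiv b (iter n dbar g) z.
  exact: (congr1 (@^~ z) (E b)).
rewrite !Ez; set u0 := pderiv false _ z; set v0 := pderiv false _ z.
set u1 := pderiv true _ z; set v1 := pderiv true _ z.
transitivity (a * (2^-1 * (u0 + 'i%C * u1)) + 2^-1 * (v0 + 'i%C * v1)); last by [].
by ring.
Qed.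

Lemma iter_dbar0 n z : iter n dbar (0 : C -> C) z = 0.
Proof.
have := iter_dbar_lin (-1) n smooth0 smooth0.
by rewrite scaler0 addr0 scaleN1r addNr => ->.
Qed.

Lemma Fset_submod_closed n : submod_closed [in Fset n].
Proof.
have [/set_mem L0 LD] := L2_submod_closed.
split=> [|a f g /set_mem[Lf [sf df]] /set_mem[Lg [sg dg]]]; apply/mem_set.
  by split=> //; split=> [|z]; [exact: smooth0|rewrite iter_dbar0].
split; first by apply/set_mem/LD; exact/mem_set.
split; first exact: smooth_lin.
by move=> z; rewrite iter_dbar_lin// !fctE df dg scaler0 addr0.
Qed.

Lemma span_submod_closed X : submod_closed [in span X].
Proof.
split=> [|a f g /set_mem[k [c [u [Xu ->]]]] /set_mem[l [e [v [Xv ->]]]]].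
  apply/mem_set; exists 0%N, (fun _ => 0), (fun _ => 0); split; last by rewrite big_ord0.
  by case.
apply/mem_set; exists (k + l)%N.
exists (fun i => match fintype.split i with inl j => a * c j | inr j => e j end).
exists (fun i => match fintype.split i with inl j => u j | inr j => v j end).
split=> [i|]; first by case: fintype.split.
rewrite big_split_ord/= scaler_sumr; congr (_ + _); apply: eq_bigr => i _.
  by rewrite (unsplitK (inl i)) scalerA.
by rewrite (unsplitK (inr i)).
Qed.

End Functions.

Section Subspaces.
Variable R : realType.
Local Notation C := R[i].

Record subspace := Subspace {
  subspace_set :> set (C -> C);
  subspace_closed : submod_closed [in subspace_set] }.

Definition Fspace (n : nat) : subspace := Subspace (Fset_submod_closed n).

Definition Dspace (d : int) (m : nat) : subspace :=
  Subspace (span_submod_closed _ : submod_closed [in Dset d m]).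

Definition subspace_pred (H : subspace) : {pred C -> C} := [in subspace_set H].

HB.instance Definition _ (H : subspace) :=
  GRing.isSubmodClosed.Build C (C -> C) (subspace_pred H) (@subspace_closed H).

(* The elements of H as a module over R[i], with pointwise operations. *)
Record vec (H : subspace) :=
  Vec { vec_fun :> C -> C; _ : vec_fun \in subspace_pred H }.

HB.instance Definition _ (H : subspace) := [isSub for @vec_fun H].
HB.instance Definition _ (H : subspace) := [Choice of vec H by <:].
HB.instance Definition _ (H : subspace) :=
  [SubChoice_isSubLmodule of vec H by <:].

End Subspaces.

Section Algebras.
Context {R : realType}.
Local Notation C := R[i].

(* The data of a normed algebra, given as the subset [alg_set] of an ambient
   type; only the values of the operations and of the norm on [alg_set]
   matter. *)
Record normed_alg := NormedAlg {
  alg_ambient : Type;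
  alg_set : set alg_ambient;
  alg_add : alg_ambient -> alg_ambient -> alg_ambient;
  alg_scale : C -> alg_ambient -> alg_ambient;
  alg_mul : alg_ambient -> alg_ambient -> alg_ambient;
  alg_norm : alg_ambient -> R }.

Arguments alg_set : clear implicits.

Definition isometrically_isomorphic (A B : normed_alg) : Prop :=
  exists phi : alg_ambient A -> alg_ambient B,
    [/\ set_bij (alg_set A) (alg_set B) phi,
        forall x y, alg_set A x -> alg_set A y ->
          phi (alg_add x y) = alg_add (phi x) (phi y),
        forall c x, alg_set A x -> phi (alg_scale c x) = alg_scale c (phi x),
        forall x y, alg_set A x -> alg_set A y ->
          phi (alg_mul x y) = alg_mul (phi x) (phi y) &
        forall x, alg_set A x -> alg_norm (phi x) = alg_norm x].

Definition opnorm (V : Type) (nrm : V -> R) (S : V -> V) : R :=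
  sup [set nrm (S v) | v in [set v | nrm v <= 1]].

Definition bounded_op (H : subspace R) : set (vec H -> vec H) :=
  [set S : vec H -> vec H |
     linear S /\ exists M : R, forall f : vec H, L2norm (S f) <= M * L2norm f].

Definition op_alg (H : subspace R) (A : set (vec H -> vec H)) : normed_alg :=
  NormedAlg A (fun S T => S + T) (fun c S => c *: S) (fun S T => S \o T)
    (opnorm (fun f : vec H => L2norm f)).

Definition bounded_alg (H : subspace R) : normed_alg :=
  op_alg (@bounded_op H).

Definition cvnorm (k : nat) (v : 'cV[C]_k) : R :=
  Num.sqrt (\sum_(i < k) normc (v i 0) ^+ 2).

Definition mx_alg (k : nat) : normed_alg :=
  NormedAlg [set: 'M[C]_k] (fun A B => A + B) (fun c A => c *: A)
    (fun A B => A *m B) (fun A => opnorm (@cvnorm k) (mulmx A)).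

Definition dsum_alg (I : Type) (A : I -> normed_alg) : normed_alg :=
  @NormedAlg (forall i, alg_ambient (A i))
    [set x | (forall i, alg_set (A i) (x i)) /\
             has_ubound (range (fun i => alg_norm (x i)))]
    (fun x y i => alg_add (x i) (y i))
    (fun c x i => alg_scale c (x i))
    (fun x y i => alg_mul (x i) (y i))
    (fun x => sup (range (fun i => alg_norm (x i)))).

Definition rot (tau : C) (f : C -> C) : C -> C := fun z => f (tau^-1 * z).

(* The hypothesis on f and g says that g is the image of f under the rotation
   operator, so the condition is that S commutes with all rotations. *)
Definition radial (n : nat) : set (vec (Fspace R n) -> vec (Fspace R n)) :=
  [set S | bounded_op S /\
    forall tau : C, normc tau = 1 -> forall f g : vec (Fspace R n),
      (g : C -> C) = rot tau f -> (S g : C -> C) = rot tau (S f)].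

Definition acts_invariantly (H : subspace R) (D : set (C -> C)) (S : vec H -> vec H) :=
  forall f : vec H, D f -> D (S f).

Definition dindex (n : nat) : Type := {d : int | 1 - n%:Z <= d}.

(* The minimum of n and n + d is positive whenever d >= 1 - n, so that taking
   the absolute value is harmless. *)
Definition ddim (n : nat) (d : int) : nat := absz (Num.min n%:Z (n%:Z + d)).

End Algebras.

(* Main.v *)
From Pilot Require Import Defs.
From HB Require Import structures.
From mathcomp Require Import all_boot all_order all_algebra.
From mathcomp Require Import complex.
From mathcomp Require Import all_classical all_reals all_analysis.
From mathcomp Require Import ring lra zify.
From mathcomp Require Import measurable_realfun.

Set Implicit Arguments.
Unset Strict Implicit.
Unset Printing Implicit Defensive.
Import Order.TTheory GRing.Theory Num.Theory.
Import numFieldNormedType.Exports.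
Import ComplexField.Normc.

Local Open Scope classical_set_scope.
Local Open Scope ring_scope.

(** Put [n = m + 1] and index the diagonal subspaces by [k = d + m], so that [k]
    runs through the natural numbers.

    An [n]-analytic function is a polynomial of degree at most [m] in the conjugate
    variable whose coefficients are entire functions ([nanalytic_polyentire]).
    Sorting its double power series by the difference of the two exponents writes it
    as a sum of components, the [k]-th one in the diagonal subspace [comp m k]; a
    rotation multiplies that component by a scalar depending on [k] only.  The
    Gaussian measure is invariant under rotations, hence components of different
    degrees are orthogonal and the square of the norm of a function is the sum of the
    squares of the norms of its components ([bessel], [sqnorm_expands_le]).  These
    facts are obtained from averages over the finite groups of roots of unity, where
    Parseval's identity is algebra, and from Fatou's lemma.

    Conversely, components with summable squared norms come from an element of the
    space ([Fset_synth]).  The point is that the norm of a component controls its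
    coefficients, with a factor [A ^ k] to spare for every [A] ([diag_coef_bound]):
    the function cannot be large on all of a box far from the origin, and the values
    at one good point in each of [n] separated boxes determine the coefficients.  The
    resulting power series have infinite radius of convergence, so their sum is
    again [n]-analytic.

    If [S] commutes with rotations, then it maps a function that is homogeneous of
    some degree to one that is homogeneous of the same degree, i.e., to its own
    component of that degree; so [S] preserves the diagonal subspaces
    ([radial_preserves_comps]).  If a bounded [S] preserves them, then it commutes
    with the projections to the components, by linearity on finite sums and by
    continuity ([parts_commute]), and since rotations are scalar on each component,
    it commutes with them ([preserves_comps_radial]).

    Such an operator is the same as the family of its restrictions to the diagonal
    subspaces, every family with bounded norms occurs ([assemble]), and by
    orthogonality the norm is the supremum of the norms of the restrictions; this
    is the first isomorphism ([radial_alg_iso]).  The second one is an orthonormal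
    basis of each diagonal subspace, from the Cholesky factorization of its Gram
    matrix ([diag_orthonormal]). *)

(** * Complex modulus and Wirtinger derivatives *)

Section ComplexModulus.
Context {R : realType}.
Local Notation C := R[i].
Implicit Types z w : C.

Lemma normc_ge0 z : 0 <= normc z.
Proof. by case: z => x y; exact: sqrtr_ge0. Qed.

Lemma normc_sq z : normc z ^+ 2 = complex.Re z ^+ 2 + complex.Im z ^+ 2.
Proof. by case: z => x y; rewrite /= sqr_sqrtr// addr_ge0 ?sqr_ge0. Qed.

Lemma normcD z w : normc (z + w) <= normc z + normc w.
Proof. exact: le_normcD. Qed.

Lemma normc_opp z : normc (- z) = normc z.
Proof. exact: normcN. Qed.

Lemma normcB z w : normc (z - w) <= normc z + normc w.
Proof. by rewrite -(normc_opp w); exact: normcD. Qed.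

Lemma normcX z k : normc (z ^+ k) = normc z ^+ k.
Proof.
by elim: k => [|k IH]; rewrite ?expr0 ?normc1// !exprS normcM IH.
Qed.

Lemma normc_conj z : normc (z^*)%C = normc z.
Proof. by case: z => x y; rewrite /= sqrrN. Qed.

Lemma normc_real (x : R) : normc (x%:C)%C = `|x|.
Proof. by rewrite /= expr0n addr0 sqrtr_sqr. Qed.

Lemma normc_nat k : normc (k%:R : C) = k%:R.
Proof. by rewrite -(rmorph_nat (real_complex R)) normc_real ger0_norm. Qed.

Lemma normc_sum I (r : seq I) (P : pred I) (F : I -> C) :
  normc (\sum_(i <- r | P i) F i) <= \sum_(i <- r | P i) normc (F i).
Proof.
elim/big_rec2: _ => [|i x y _ xy]; first by rewrite normc0.
by apply: le_trans (normcD _ _) _; rewrite lerD2l.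
Qed.

Lemma normc_eq0 z : (normc z == 0) = (z == 0).
Proof. by apply/eqP/eqP => [/eq0_normc//|->]; rewrite normc0. Qed.

Lemma ler_norm_Re z : `|complex.Re z| <= normc z.
Proof.
by rewrite -ler_sqr ?nnegrE ?normc_ge0// normc_sq real_normK ?num_real// lerDl sqr_ge0.
Qed.

Lemma ler_norm_Im z : `|complex.Im z| <= normc z.
Proof.
by rewrite -ler_sqr ?nnegrE ?normc_ge0// normc_sq real_normK ?num_real// lerDr sqr_ge0.
Qed.

Lemma normc_le_ReIm z : normc z <= `|complex.Re z| + `|complex.Im z|.
Proof.
rewrite -ler_sqr ?nnegrE ?normc_ge0 ?addr_ge0// normc_sq sqrrD.
rewrite !real_normK ?num_real// addrAC lerDl mulrn_wge0// mulr_ge0//.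
Qed.

Lemma ofCK z : toC (ofC z) = z.
Proof. by case: z. Qed.

Lemma ReD z w : complex.Re (z + w) = complex.Re z + complex.Re w.
Proof. by case: z; case: w. Qed.

Lemma ImD z w : complex.Im (z + w) = complex.Im z + complex.Im w.
Proof. by case: z; case: w. Qed.

Lemma ReB z w : complex.Re (z - w) = complex.Re z - complex.Re w.
Proof. by case: z; case: w. Qed.

Lemma ImB z w : complex.Im (z - w) = complex.Im z - complex.Im w.
Proof. by case: z; case: w. Qed.

Lemma toCD (p q : R * R) : toC (p + q) = toC p + toC q.
Proof. by []. Qed.

Lemma complex_eq z w :
  complex.Re z = complex.Re w -> complex.Im z = complex.Im w -> z = w.
Proof. by case: z w => [a b] [c d] /= -> ->. Qed.

Lemma normc_toC (h : R * R) : normc (toC h) <= 2 * `|h|.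
Proof.
apply: le_trans (normc_le_ReIm _) _ => /=; rewrite mulr_natl mulr2n.
by rewrite {2 3}/Num.norm/= !prod_normE lerD// le_max lexx ?orbT.
Qed.

End ComplexModulus.

Section Wirtinger.
Context {R : realType}.
Local Notation C := R[i].
Implicit Types (f g u v : C -> C) (z w h : C).

(** The norm here is the sup norm of the product; its ball of radius 1/2 lies in the
    unit disc, where [wirt] below provides the estimate. *)
Lemma differentiable_quad (u : R * R -> R) (p : R * R) (a b K : R) :
  (forall h : R * R, `|h| <= 2^-1 ->
     `|u (h + p) - u p - (a * h.1 + b * h.2)| <= K * `|h| ^+ 2) ->
  differentiable u p /\ forall e, 'D_e u p = a * e.1 + b * e.2.
Proof.
move=> Ku.
pose L : {linear (R * R)%type -> R} :=
  (a \*: (fst : R * R -> R) \+ b \*: (snd : R * R -> R)).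
have cL : continuous L.
  move=> q; apply: (@cvgD _ _ _ _ _ (a \*: (fst : R * R -> R))
     (b \*: (snd : R * R -> R))).
    by apply: cvgZr; exact: cvg_fst.
  by apply: cvgZr; exact: cvg_snd.
have uL : (u \o shift p : R * R -> R^o) =
    (cst (u p) + L : R * R -> R^o) +o_ (0 : R * R) id.
  apply/eqaddoP => e e0; near=> h.
  rewrite [X in `|X|](_ : _ = u (h + p) - u p - (a * h.1 + b * h.2)); last first.
    by rewrite !fctE/= opprD addrA.
  apply: (@le_trans _ _ (K * `|h| ^+ 2)).
    apply: Ku; near: h; apply: (@nbhs0_le R (R * R)%type 2^-1); rewrite invr_gt0//.
  apply: (@le_trans _ _ ((`|K| + 1) * `|h| ^+ 2)).
    by rewrite ler_wpM2r ?sqr_ge0// (le_trans (ler_norm _))// lerDl.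
  rewrite expr2 mulrA ler_wpM2r// -ler_pdivlMl ?ltr_wpDl//.
  near: h; apply: (@nbhs0_le R (R * R)%type); rewrite mulr_gt0// invr_gt0 ltr_wpDl//.
have dL := diff_unique cL uL.
have du : differentiable u p.
  by apply/diff_locallyP; rewrite dL.
by split=> // e; rewrite deriveE// dL.
Unshelve. all: by end_near. Qed.

(** The differential [u dz + v dz^*] with a quadratic error in place of a little-o:
    products and power series then need only estimates on the modulus. *)
Definition wirt f u v := forall z, exists K, forall h, normc h <= 1 ->
  normc (f (z + h) - f z - (u z * h + v z * (h^*)%C)) <= K * normc h ^+ 2.

Lemma wirt_pderiv f u v : wirt f u v ->
  [/\ forall p, differentiable (rePart f) p, forall p, differentiable (imPart f) p,
      pderiv false f = u + v & pderiv true f = (fun z => 'i%C * (u z - v z))].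
Proof.
move=> W.
have main p : exists u1 u2 v1 v2 : R, [/\ u (toC p) = (u1 +i* u2)%C,
   v (toC p) = (v1 +i* v2)%C,
   differentiable (rePart f) p /\
      forall e, 'D_e (rePart f) p = (u1 + v1) * e.1 + (v2 - u2) * e.2 &
   differentiable (imPart f) p /\
      forall e, 'D_e (imPart f) p = (u2 + v2) * e.1 + (u1 - v1) * e.2].
  have [K HK] := W (toC p).
  case Eu : (u (toC p)) => [u1 u2]; case Ev : (v (toC p)) => [v1 v2].
  have Kh (h : R * R) : `|h| <= 2^-1 ->
     normc (f (toC (h + p)) - f (toC p) - (u (toC p) * toC h + v (toC p) * ((toC h)^*)%C))
       <= `|K| * 4 * `|h| ^+ 2.
    move=> h1; rewrite (addrC h) toCD.
    have hn : normc (toC h) <= 2 * `|h| := normc_toC h.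
    apply: le_trans (HK _ _) _; first by lra.
    apply: (@le_trans _ _ (`|K| * normc (toC h) ^+ 2)).
      by rewrite ler_wpM2r ?sqr_ge0// ler_norm.
    rewrite -mulrA ler_wpM2l// (_ : 4 * `|h| ^+ 2 = (2 * `|h|) ^+ 2); last by ring.
    by rewrite lerXn2r// nnegrE ?normc_ge0// mulr_ge0.
  exists u1, u2, v1, v2; split => //.
  - apply: (@differentiable_quad _ _ _ _ (`|K| * 4)) => h h1.
    apply: le_trans (Kh h h1); apply: le_trans (ler_norm_Re _).
    by rewrite !(ReB, ReD) Eu Ev /rePart /= le_eqVlt; apply/orP; left; apply/eqP; congr `|_|; ring.
  - apply: (@differentiable_quad _ _ _ _ (`|K| * 4)) => h h1.
    apply: le_trans (Kh h h1); apply: le_trans (ler_norm_Im _).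
    by rewrite !(ImB, ImD) Eu Ev /imPart /= le_eqVlt; apply/orP; left; apply/eqP; congr `|_|; ring.
split.
- by move=> p; have [? [? [? [? [_ _ []]]]]] := main p.
- by move=> p; have [? [? [? [? [_ _ _ []]]]]] := main p.
- apply/funext => z; rewrite /pderiv fctE.
  have [u1 [u2 [v1 [v2 []]]]] := main (ofC z).
  rewrite ofCK => -> -> [_ ->] [_ ->] /=.
  by apply: complex_eq => /=; ring.
- apply/funext => z; rewrite /pderiv.
  have [u1 [u2 [v1 [v2 []]]]] := main (ofC z).
  rewrite ofCK => -> -> [_ ->] [_ ->] /=.
  by apply: complex_eq => /=; ring.
Qed.

Lemma wirt_dbar f u v : wirt f u v -> dbar f = v.
Proof.
case/wirt_pderiv => _ _ e1 e2; apply/funext => z; rewrite /dbar e1 e2 fctE.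
by rewrite mulrA -expr2 sqr_i; field.
Qed.

Lemma wirt_cst c : wirt (cst c) (cst 0) (cst 0).
Proof.
move=> z; exists 0 => h _; rewrite /= subrr !mul0r addr0 subrr normc0.
exact: lexx.
Qed.

Lemma wirt_conj : wirt (fun z => (z^*)%C) (cst 0) (cst 1).
Proof.
move=> z; exists 0 => h _; rewrite /= [X in normc X](_ : _ = 0) ?normc0 ?mul0r//.
by case: z h => a b [c d]; apply: complex_eq => /=; ring.
Qed.

Lemma wirt_lin (c : C) f g u v u' v' : wirt f u v -> wirt g u' v' ->
  wirt (c *: f + g) (c *: u + u') (c *: v + v').
Proof.
move=> Wf Wg z; have [K HK] := Wf z; have [K' HK'] := Wg z.
exists (normc c * K + K') => h h1.
rewrite [X in normc X](_ : _ =
  c * (f (z + h) - f z - (u z * h + v z * (h^*)%C)) +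
  (g (z + h) - g z - (u' z * h + v' z * (h^*)%C))); last first.
  by rewrite !fctE /GRing.scale/=; ring.
apply: le_trans (normcD _ _) _; rewrite mulrDl lerD ?HK'//.
by rewrite normcM -mulrA ler_wpM2l ?normc_ge0// HK.
Qed.

(** All the bounds on one disc that the product rule consumes. *)
Lemma wirt_local f u v : wirt f u v -> forall z, exists2 K, 0 <= K &
  forall h, normc h <= 1 ->
  [/\ normc (f (z + h) - f z - (u z * h + v z * (h^*)%C)) <= K * normc h ^+ 2,
      normc (f (z + h) - f z) <= K * normc h, normc (f (z + h)) <= K &
      normc (u z * h + v z * (h^*)%C) <= K * normc h].
Proof.
move=> W z; have [K HK] := W z.
pose L := normc (u z) + normc (v z).
exists (`|K| + L + normc (f z)).
  by rewrite !addr_ge0 ?normc_ge0.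
move=> h h1.
have n0 := normc_ge0 h; have u0 := normc_ge0 (u z); have v0 := normc_ge0 (v z).
have f0 := normc_ge0 (f z).
have E1 : normc (f (z + h) - f z - (u z * h + v z * (h^*)%C)) <= `|K| * normc h ^+ 2.
  by apply: le_trans (HK h h1) _; rewrite ler_wpM2r ?sqr_ge0// ler_norm.
have E2 : normc (u z * h + v z * (h^*)%C) <= L * normc h.
  by apply: le_trans (normcD _ _) _; rewrite !normcM normc_conj mulrDl.
have hh : normc h ^+ 2 <= normc h by rewrite expr2 ler_piMr.
have E3 : normc (f (z + h) - f z) <= (`|K| + L) * normc h.
  rewrite -[X in normc X](subrK (u z * h + v z * (h^*)%C)).
  apply: le_trans (normcD _ _) _; rewrite mulrDl lerD//.
  by apply: le_trans E1 _; rewrite ler_wpM2l.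
have E4 : normc (f (z + h)) <= `|K| + L + normc (f z).
  rewrite -[X in normc X](subrK (f z)).
  apply: le_trans (normcD _ _) _; rewrite lerD2r; apply: le_trans E3 _.
  by rewrite ler_piMr// addr_ge0// addr_ge0.
split => //.
- apply: le_trans E1 _; rewrite ler_wpM2r ?sqr_ge0//.
  by rewrite -addrA lerDl !addr_ge0.
- by apply: le_trans E3 _; rewrite ler_wpM2r// lerDl.
- by apply: le_trans E2 _; rewrite ler_wpM2r// addrAC lerDr addr_ge0.
Qed.

Lemma wirt_mul f g u v u' v' : wirt f u v -> wirt g u' v' ->
  wirt (f \* g) (f \* u' + u \* g) (f \* v' + v \* g).
Proof.
move=> Wf Wg z.
have [K K0 HK] := wirt_local Wf z; have [K' K'0 HK'] := wirt_local Wg z.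
exists (3 * (K * K')) => h h1.
have [a1 a2 a3 a4] := HK h h1; have [b1 b2 b3 b4] := HK' h h1.
have fz : normc (f z) <= K.
  by have := HK 0; rewrite addr0 normc0 => /(_ ler01)[].
rewrite [X in normc X](_ : _ =
  f z * (g (z + h) - g z - (u' z * h + v' z * (h^*)%C)) +
  (f (z + h) - f z - (u z * h + v z * (h^*)%C)) * g (z + h) +
  (u z * h + v z * (h^*)%C) * (g (z + h) - g z)); last first.
  transitivity (f (z + h) * g (z + h) - f z * g z -
    ((f z * u' z + u z * g z) * h + (f z * v' z + v z * g z) * (h^*)%C)); last by ring.
  by [].
have n0 := normc_ge0 h.
apply: le_trans (normcD _ _) _.
apply: le_trans (lerD (normcD _ _) (lexx _)) _; rewrite !normcM.
rewrite [leRHS](_ : _ = K * (K' * normc h ^+ 2) + (K * normc h ^+ 2) * K' +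
  (K * normc h) * (K' * normc h)); last by ring.
by rewrite !lerD// ler_pM// normc_ge0.
Qed.

(** All iterated partial derivatives stay in [X], as they are combinations of the
    two Wirtinger derivatives. *)
Lemma smooth_of_wirt_closed (X : set (C -> C)) : submod_closed [in X] ->
  (forall f, X f -> exists u v, [/\ X u, X v & wirt f u v]) ->
  forall f, X f -> smooth f.
Proof.
move=> [X0 XD] XW f Xf s p.
have Xs : X (foldr pderiv f s).
  elim: s => //= b s /XW[u [v [Xu Xv /wirt_pderiv[_ _ e1 e2]]]]; apply/set_mem.
  case: b; [rewrite e2|rewrite e1].
    rewrite (_ : (fun z => _) = 'i%C *: (u : C -> C) + (- 'i%C *: (v : C -> C) + 0)).
      by apply/XD; [exact/mem_set|apply/XD => //; exact/mem_set].
    apply/funext => z; rewrite !fctE.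
    transitivity ('i%C * u z + (- 'i%C * v z + 0)); last by [].
    ring.
  by rewrite -[u]scale1r; apply/XD; exact/mem_set.
have [u [v [_ _ /wirt_pderiv[d1 d2 _ _]]]] := XW _ Xs.
by split.
Qed.

End Wirtinger.

(** * Power series of infinite radius of convergence *)

Section GeometricSeries.
Context {R : realType}.
Local Notation C := R[i].
Implicit Types (f : C -> C) (g : nat -> C -> C) (a b : nat -> C) (z w h : C).

Lemma ler_of_geometric (x A B : R) : (forall N, x <= A + B / 2 ^+ N) -> x <= A.
Proof.
move=> H; have c : (fun N => A + B / 2 ^+ N) @ \oo --> A + 0.
  apply: cvgD; first exact: cvg_cst.
  rewrite -[0](mulr0 B); apply: cvgM; first exact: cvg_cst.
  have := @cvg_expr R 2^-1; rewrite ger0_norm ?invr_ge0//.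
  by under [in X in _ -> X]eq_fun do rewrite -exprVn; apply; lra.
rewrite -[A]addr0 -(cvg_lim _ c)//; apply: limr_ge; first by apply/cvg_ex; exists (A + 0).
exact: nearW.
Qed.

Lemma sum_geometric_le (M : R) m n : 0 <= M ->
  \sum_(m <= j < m + n) M / 2 ^+ j <= 2 * M / 2 ^+ m.
Proof.
move=> M0; suff -> : \sum_(m <= j < m + n) M / 2 ^+ j = 2 * M / 2 ^+ m - 2 * M / 2 ^+ (m + n).
  by rewrite gerBl divr_ge0 ?mulr_ge0 ?exprn_ge0.
elim: n => [|n IH]; first by rewrite addn0 big_geq// subrr.
rewrite addnS big_nat_recr ?leq_addr//= IH exprS; field.
by rewrite !expf_neq0.
Qed.

Lemma sum_geometric_le0 (M : R) n : 0 <= M ->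
  \sum_(j < n) M / 2 ^+ j <= 2 * M.
Proof.
move=> M0; rewrite -(big_mkord xpredT (fun j => M / 2 ^+ j)).
by have := sum_geometric_le 0 n M0; rewrite add0n expr0 divr1.
Qed.

Lemma real_series_geometric (u : nat -> R) (M : R) :
  (forall j, `|u j| <= M / 2 ^+ j) ->
  exists l, forall N, `|l - \sum_(j < N) u j| <= 2 * M / 2 ^+ N.
Proof.
move=> uM; have M0 : 0 <= M.
  by apply: le_trans (normr_ge0 (u 0%N)) _; have := uM 0%N; rewrite expr0 divr1.
have cu : cvgn (series u).
  apply: normed_cvg.
  apply: (@series_le_cvg _ _ (geometric M 2^-1)) => //.
  - by move=> n; rewrite /=.
  - by move=> n; rewrite /geometric/= mulr_ge0// exprn_ge0 ?invr_ge0.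
  - by move=> n; rewrite /geometric/= exprVn.
  - by apply: is_cvg_geometric_series; rewrite ger0_norm ?invr_ge0//; lra.
exists (limn (series u)) => N; rewrite distrC.
have bnd m : (N <= m)%N -> `|\sum_(j < N) u j - series u m| <= 2 * M / 2 ^+ N.
  move=> Nm; rewrite /series/= -(big_mkord xpredT u) distrC.
  rewrite (big_cat_nat (leq0n N) Nm)/= addrAC subrr add0r.
  apply: le_trans (ler_norm_sum _ _ _) _.
  rewrite -(subnKC Nm); apply: le_trans (sum_geometric_le N (m - N) M0).
  by apply: ler_sum => j _; exact: uM.
have cc : (fun m => `|\sum_(j < N) u j - series u m|) @ \oo -->
    `|\sum_(j < N) u j - limn (series u)|.
  by apply: cvg_norm; apply: cvgB; [exact: cvg_cst|].
rewrite -(cvg_lim _ cc)//; apply: limr_le; first by apply/cvg_ex; eexists; exact: cc.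
by near=> m; apply: bnd; near: m; exact: nbhs_infty_ge.
Unshelve. all: by end_near. Qed.

(** Locally uniform convergence at a geometric rate.  The rate is no
    restriction for power series of infinite radius, and it turns all passages
    to the limit below into elementary estimates. *)
Definition geom_sum g f := forall rho : R, exists M, forall z, normc z <= rho ->
  forall N, normc (f z - \sum_(j < N) g j z) <= M / 2 ^+ N.

Lemma geom_sum_term g f : geom_sum g f -> forall rho : R, exists2 M, 0 <= M &
  forall z, normc z <= rho -> forall j, normc (g j z) <= M / 2 ^+ j.
Proof.
move=> G rho; have [M HM] := G rho; exists (2 * `|M|) => [|z zr j].
  by rewrite mulr_ge0.
have HM' N : normc (f z - \sum_(j < N) g j z) <= `|M| / 2 ^+ N.
  by apply: le_trans (HM _ zr N) _; rewrite ler_wpM2r ?invr_ge0 ?exprn_ge0// ler_norm.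
rewrite [X in normc X](_ : _ = (f z - \sum_(i < j) g i z) -
   (f z - \sum_(i < j.+1) g i z)); last by rewrite big_ord_recr/=; ring.
apply: le_trans (normcB _ _) _; apply: le_trans (lerD (HM' _) (HM' _)) _.
rewrite [leRHS](_ : _ = `|M| / 2 ^+ j + `|M| / 2 ^+ j); last by ring.
rewrite lerD2l ler_wpM2l// lef_pV2 ?posrE ?exprn_gt0//.
by rewrite exprS ler_peMl ?exprn_ge0//; lra.
Qed.

Lemma geom_sum_ex g :
  (forall rho : R, exists M, forall z, normc z <= rho -> forall j,
     normc (g j z) <= M / 2 ^+ j) -> exists f, geom_sum g f.
Proof.
move=> H.
have ptw z : exists l : C, forall M, (forall j, normc (g j z) <= M / 2 ^+ j) ->
   forall N, normc (l - \sum_(j < N) g j z) <= 4 * M / 2 ^+ N.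
  have [M0 /(_ z (lexx _)) HM0] := H (normc z).
  have [l1 Hl1] := @real_series_geometric (fun j => complex.Re (g j z)) M0
    (fun j => le_trans (ler_norm_Re _) (HM0 j)).
  have [l2 Hl2] := @real_series_geometric (fun j => complex.Im (g j z)) M0
    (fun j => le_trans (ler_norm_Im _) (HM0 j)).
  exists (l1 +i* l2)%C => M HM N.
  (* the limits do not depend on the constant used to obtain them *)
  have [k1 Hk1] := @real_series_geometric (fun j => complex.Re (g j z)) M
    (fun j => le_trans (ler_norm_Re _) (HM j)).
  have [k2 Hk2] := @real_series_geometric (fun j => complex.Im (g j z)) M
    (fun j => le_trans (ler_norm_Im _) (HM j)).
  have uniq (l k A B : R) (u : nat -> R) :
     (forall N, `|l - \sum_(j < N) u j| <= A / 2 ^+ N) ->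
     (forall N, `|k - \sum_(j < N) u j| <= B / 2 ^+ N) -> l = k.
    move=> h1 h2; apply/eqP; rewrite -subr_eq0 -normr_le0.
    apply: (@ler_of_geometric _ 0 (A + B)) => n; rewrite add0r mulrDl.
    apply: le_trans (lerD (h1 n) (h2 n)).
    rewrite (distrC k); apply: le_trans (ler_normD _ _).
    by rewrite addrA subrK.
  have {Hl1}e1 := uniq _ _ _ _ (fun j => complex.Re (g j z)) Hl1 Hk1.
  have {Hl2}e2 := uniq _ _ _ _ (fun j => complex.Im (g j z)) Hl2 Hk2.
  subst l1 l2.
  have eR : complex.Re (\sum_(j < N) g j z) = \sum_(j < N) complex.Re (g j z).
    by rewrite (big_morph _ (@ReD R) (erefl : complex.Re (0 : C) = 0)).
  have eI : complex.Im (\sum_(j < N) g j z) = \sum_(j < N) complex.Im (g j z).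
    by rewrite (big_morph _ (@ImD R) (erefl : complex.Im (0 : C) = 0)).
  apply: le_trans (normc_le_ReIm _) _; rewrite ReB ImB eR eI /=.
  apply: le_trans (lerD (Hk1 N) (Hk2 N)) _.
  by rewrite -mulrDl -mulrDl le_eqVlt; apply/orP; left; apply/eqP; ring.
have [f Hf] := choice ptw; exists f => rho.
by have [M HM] := H rho; exists (4 * M) => z zr N; apply: Hf => j; exact: HM.
Qed.

Lemma geom_sum_uniq g f f' : geom_sum g f -> geom_sum g f' -> f = f'.
Proof.
move=> G G'; apply/funext => z; apply/eqP; rewrite -subr_eq0 -normc_eq0.
have [M /(_ z (lexx _)) HM] := G (normc z).
have [M' /(_ z (lexx _)) HM'] := G' (normc z).
rewrite eq_le normc_ge0 andbT; apply: (@ler_of_geometric _ 0 (M + M')) => N.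
rewrite add0r mulrDl; apply: le_trans (lerD (HM N) (HM' N)).
apply: le_trans (normcB _ _); rewrite le_eqVlt; apply/orP; left; apply/eqP.
by congr normc; ring.
Qed.

Lemma geom_sum_lin (c : C) g g' f f' : geom_sum g f -> geom_sum g' f' ->
  geom_sum (fun j => c *: g j + g' j) (c *: f + f').
Proof.
move=> G G' rho; have [M HM] := G rho; have [M' HM'] := G' rho.
exists (normc c * M + M') => z zr N.
rewrite [X in normc X](_ : _ = c * (f z - \sum_(j < N) g j z) +
   (f' z - \sum_(j < N) g' j z)); last first.
  rewrite big_split/= -scaler_sumr /GRing.scale !fctE/= /GRing.scale/=.
  by ring.
rewrite mulrDl -mulrA; apply: le_trans (normcD _ _) _.
by rewrite lerD ?HM'// normcM ler_wpM2l ?normc_ge0// HM.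
Qed.

Definition entire a f := geom_sum (fun j z => a j * z ^+ j) f.

Lemma entire_coef a f : entire a f -> forall rho : R, 0 <= rho -> exists2 M, 0 <= M &
  forall j, normc (a j) * rho ^+ j <= M / 2 ^+ j.
Proof.
move=> E rho r0; have [M M0 HM] := geom_sum_term E rho; exists M => // j.
have := HM (rho%:C)%C; rewrite normc_real ger0_norm// => /(_ (lexx _) j).
by rewrite normcM normcX normc_real ger0_norm.
Qed.

Lemma entire_ex a :
  (forall rho : R, 1 <= rho -> exists M, forall j, normc (a j) * rho ^+ j <= M) ->
  exists f, entire a f.
Proof.
move=> H; apply: geom_sum_ex => rho.
have [|M HM] := H (2 * (`|rho| + 1)).
  by have := normr_ge0 rho; lra.
exists M => z zr j; rewrite ler_pdivlMr ?exprn_gt0//.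
apply: le_trans (HM j); rewrite normcM normcX -mulrA ler_wpM2l ?normc_ge0//.
rewrite [leRHS]exprMn mulrC ler_wpM2l ?exprn_ge0// lerXn2r ?nnegrE ?normc_ge0//.
by rewrite (le_trans zr)// (le_trans (ler_norm _))// lerDl.
Qed.

Lemma power_remainder z h j (rho : R) : normc z + 1 <= rho -> normc h <= 1 ->
  normc ((z + h) ^+ j - z ^+ j - j%:R * z ^+ j.-1 * h) <= (2 * rho) ^+ j * normc h ^+ 2.
Proof.
move=> zr h1; have z0 := normc_ge0 z; have h0 := normc_ge0 h.
have r1 : 1 <= rho by lra.
have r0 : 0 <= rho by lra.
elim: j => [|j IH].
  by rewrite !expr0 !mul0r !subrr normc0 mulr_ge0// sqr_ge0.
rewrite [X in normc X](_ : _ = (z + h) * ((z + h) ^+ j - z ^+ j - j%:R * z ^+ j.-1 * h) +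
   j%:R * z ^+ j.-1 * h ^+ 2); last first.
  case: j {IH} => [|j] /=; first by rewrite !expr0 !expr1; ring.
  by rewrite !exprS -(natr1 j.+1); ring.
have e1 : normc ((z + h) * ((z + h) ^+ j - z ^+ j - j%:R * z ^+ j.-1 * h)) <=
   rho * ((2 * rho) ^+ j * normc h ^+ 2).
  rewrite normcM ler_pM ?normc_ge0//.
  by apply: le_trans (normcD _ _) _; lra.
have e2 : normc (j%:R * z ^+ j.-1 * h ^+ 2) <= rho * ((2 * rho) ^+ j * normc h ^+ 2).
  rewrite !normcM !normcX normc_nat [leRHS]mulrA ler_wpM2r ?sqr_ge0//.
  rewrite exprMn mulrCA ler_pM ?exprn_ge0//.
    by rewrite -natrX ler_nat ltnW// ltn_expl.
  apply: (@le_trans _ _ (rho ^+ j.-1)).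
    by rewrite lerXn2r ?nnegrE ?normc_ge0//; lra.
  by rewrite -exprS ler_weXn2l// (leq_trans (leq_pred _)).
apply: le_trans (normcD _ _) _; apply: le_trans (lerD e1 e2) _.
by rewrite (exprS _ j) le_eqVlt; apply/orP; left; apply/eqP; ring.
Qed.

(** Termwise differentiation: the quadratic remainders of the powers sum up, because
    the coefficients decay faster than those of a geometric series of any ratio. *)
Lemma entire_deriv a f : entire a f ->
  exists f', entire (fun j => j.+1%:R * a j.+1) f' /\ wirt f f' (cst 0).
Proof.
move=> E.
have [f' E'] : exists f', entire (fun j => j.+1%:R * a j.+1) f'.
  apply: entire_ex => rho r1; have r0 : 0 <= rho by lra.
  have [M M0 HM] := entire_coef E r0; exists M => j.
  have := HM j.+1; rewrite ler_pdivlMr ?exprn_gt0// => {}HM.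
  rewrite normcM normc_nat; apply: le_trans HM.
  rewrite -mulrA mulrC ler_pM ?mulr_ge0 ?normc_ge0 ?exprn_ge0//.
    by rewrite ler_wpM2l ?normc_ge0// ler_weXn2l.
  by rewrite -natrX ler_nat ltnW// ltn_expl.
exists f'; split => // z; set rho := normc z + 1.
have r1 : 1 <= rho by rewrite /rho lerDr normc_ge0.
have [|M M0 HM] := @entire_coef _ _ E (2 * rho); first by lra.
have [M1 HM1] := E rho; have [M2 HM2] := E' rho.
exists (2 * M) => h h1; rewrite mul0r addr0.
have h0 := normc_ge0 h; have z0 := normc_ge0 z.
pose B := M1 + M1 + M2 * normc h.
apply: (@ler_of_geometric _ _ (2 * B)) => N.
pose S k w := \sum_(j < k) a j * w ^+ j.
pose S' k w := \sum_(j < k) j.+1%:R * a j.+1 * w ^+ j.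
rewrite [X in normc X](_ : _ =
  (\sum_(j < N.+1) a j * ((z + h) ^+ j - z ^+ j - j%:R * z ^+ j.-1 * h)) +
  ((f (z + h) - S N.+1 (z + h)) - (f z - S N.+1 z) - (f' z - S' N z) * h)); last first.
  have -> : \sum_(j < N.+1) a j * ((z + h) ^+ j - z ^+ j - j%:R * z ^+ j.-1 * h) =
     S N.+1 (z + h) - S N.+1 z - S' N z * h.
    rewrite {}/S {}/S' mulr_suml -sumrB.
    rewrite [X in _ = _ - X](_ : _ = \sum_(j < N.+1) a j * (j%:R * z ^+ j.-1 * h)).
      by rewrite -sumrB; apply: eq_bigr => j _; ring.
    rewrite big_ord_recl /= mul0r mul0r mulr0 add0r; apply: eq_bigr => j _.
    by rewrite /bump /= add1n; ring.
  by ring.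
apply: le_trans (normcD _ _) _; apply: lerD.
  apply: le_trans (normc_sum _ _ _) _.
  apply: (@le_trans _ _ (\sum_(j < N.+1) (M / 2 ^+ j) * normc h ^+ 2)).
    apply: ler_sum => j _; rewrite normcM.
    apply: le_trans (_ : normc (a j) * ((2 * rho) ^+ j * normc h ^+ 2) <= _).
      by rewrite ler_wpM2l ?normc_ge0// power_remainder.
    by rewrite mulrA ler_wpM2r ?sqr_ge0.
  by rewrite -mulr_suml ler_wpM2r ?sqr_ge0// sum_geometric_le0.
have zr : normc z <= rho by rewrite /rho lerDl.
have zhr : normc (z + h) <= rho by apply: le_trans (normcD _ _) _; rewrite lerD2l.
have p2 k : 0 <= (2 ^+ k)^-1 :> R by rewrite invr_ge0 exprn_ge0.
apply: (@le_trans _ _ (M1 / 2 ^+ N.+1 + M1 / 2 ^+ N.+1 + M2 / 2 ^+ N * normc h)).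
  apply: le_trans (normcB _ _) _; apply: lerD.
    apply: le_trans (normcB _ _) _; apply: lerD; first exact: HM1.
    exact: HM1.
  by rewrite normcM ler_wpM2r//; exact: HM2.
have M10 : 0 <= M1.
  by have := le_trans (normc_ge0 _) (HM1 z zr 0%N); rewrite expr0 divr1.
have M20 : 0 <= M2.
  by have := le_trans (normc_ge0 _) (HM2 z zr 0%N); rewrite expr0 divr1.
rewrite exprS invfM /B.
have := p2 N; set q := (_ ^-1) => q0.
have t1 : 0 <= M1 * q by exact: mulr_ge0.
have t2 : 0 <= M2 * q * normc h by rewrite !mulr_ge0.
rewrite [leLHS](_ : _ = M1 * q + M2 * q * normc h); last by field.
rewrite [leRHS](_ : _ = 4 * (M1 * q) + 2 * (M2 * q * normc h)); last by ring.
by lra.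
Qed.

Lemma entire_lin (c : C) a b f f' : entire a f -> entire b f' ->
  entire (fun j => c * a j + b j) (c *: f + f').
Proof.
move=> E E'; have := geom_sum_lin c E E'; congr geom_sum.
apply/funext => j; apply/funext => z.
transitivity (c * (a j * z ^+ j) + b j * z ^+ j); [by []|by ring].
Qed.

End GeometricSeries.

(** * Integrals over the circle *)

Section CircleIntegral.
Context {R : realType}.
Local Notation C := R[i].
Local Notation mu := (@lebesgue_measure R).
Implicit Types (F G : R -> C) (f g : C -> C).

(** Continuity of the real and imaginary parts, the form in which the real integrals
    below consume it. *)
Definition ccont F := continuous (fun x => complex.Re (F x)) /\
  continuous (fun x => complex.Im (F x)).

Lemma ccont_cst c : ccont (fun _ => c).
Proof. by split; exact: cst_continuous. Qed.

Lemma ccontD F G : ccont F -> ccont G -> ccont (fun x => F x + G x).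
Proof.
move=> [f1 f2] [g1 g2]; split => x.
  by under eq_fun do rewrite ReD; apply: cvgD; [exact: f1|exact: g1].
by under eq_fun do rewrite ImD; apply: cvgD; [exact: f2|exact: g2].
Qed.

Lemma Re_mul (z w : C) : complex.Re (z * w) =
  complex.Re z * complex.Re w - complex.Im z * complex.Im w.
Proof. by case: z w => [a b] [c d]. Qed.

Lemma Im_mul (z w : C) : complex.Im (z * w) =
  complex.Re z * complex.Im w + complex.Im z * complex.Re w.
Proof. by case: z w => [a b] [c d]. Qed.

Lemma ccontM F G : ccont F -> ccont G -> ccont (fun x => F x * G x).
Proof.
move=> [f1 f2] [g1 g2]; split => x.
  under eq_fun do rewrite Re_mul; apply: cvgB; apply: cvgM;
    [exact: f1|exact: g1|exact: f2|exact: g2].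
under eq_fun do rewrite Im_mul; apply: cvgD; apply: cvgM;
  [exact: f1|exact: g2|exact: f2|exact: g1].
Qed.

Lemma ccontX F k : ccont F -> ccont (fun x => F x ^+ k).
Proof.
move=> cF; elim: k => [|k IH]; first exact: ccont_cst.
by under eq_fun do rewrite exprS; exact: ccontM.
Qed.

Lemma ccont_sum k (F : nat -> R -> C) : (forall j, ccont (F j)) ->
  ccont (fun x => \sum_(j < k) F j x).
Proof.
move=> cF; elim: k => [|k IH].
  by under eq_fun do rewrite big_ord0; exact: ccont_cst.
by under eq_fun do rewrite big_ord_recr/=; exact: ccontD.
Qed.

Definition fcont f := continuous (rePart f) /\ continuous (imPart f).

Lemma ccont_comp f F : fcont f -> ccont F -> ccont (fun x => f (F x)).
Proof.
move=> [f1 f2] [F1 F2].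
have cF : continuous (fun x => ofC (F x)).
  by move=> x; exact: (cvg_pair (F1 x) (F2 x)).
have e1 : (fun x => complex.Re (f (F x))) = rePart f \o (fun x => ofC (F x)).
  by apply/funext => x; rewrite /rePart /= ofCK.
have e2 : (fun x => complex.Im (f (F x))) = imPart f \o (fun x => ofC (F x)).
  by apply/funext => x; rewrite /imPart /= ofCK.
split => x.
  by rewrite e1; exact: (continuous_comp (cF x) (f1 _)).
by rewrite e2; exact: (continuous_comp (cF x) (f2 _)).
Qed.

Definition expi (x : R) : C := (cos x +i* sin x)%C.

Lemma ccont_expi : ccont expi.
Proof. by split; [exact: continuous_cos|exact: continuous_sin]. Qed.

Lemma normc_expi x : normc (expi x) = 1.
Proof. by rewrite /= cos2Dsin2 sqrtr1. Qed.

Lemma expiD x y : expi (x + y) = expi x * expi y.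
Proof. by apply: complex_eq => /=; rewrite ?cosD ?sinD//; ring. Qed.

Lemma expiX x k : expi x ^+ k = expi (k%:R * x).
Proof.
elim: k => [|k IH]; first by rewrite expr0 mul0r /expi cos0 sin0.
by rewrite exprS IH -expiD -(natr1 k); congr expi; ring.
Qed.

Lemma expi2pi : expi (2 * pi) = 1.
Proof. by rewrite /expi mulr_natl cos2pi sin2pi. Qed.

Definition circ : set R := `[0, 2 * pi]%classic.

Definition cint F : C :=
  ((\int[mu]_(x in circ) complex.Re (F x)) +i* (\int[mu]_(x in circ) complex.Im (F x)))%C.

Lemma integrable_circ (u : R -> R) : continuous u -> mu.-integrable circ (EFin \o u).
Proof.
move=> cu; apply: continuous_compact_integrable; first exact: segment_compact.
exact: continuous_subspaceT.
Qed.

Lemma measurable_circ : measurable circ.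
Proof. exact: measurable_itv. Qed.

Lemma cintD F G : ccont F -> ccont G ->
  cint (fun x => F x + G x) = cint F + cint G.
Proof.
move=> [f1 f2] [g1 g2]; have mc := measurable_circ.
apply: complex_eq; rewrite /= ?ReD ?ImD /=.
  rewrite -RintegralD//; try exact: integrable_circ.
  by apply: eq_Rintegral => x _; rewrite ReD.
rewrite -RintegralD//; try exact: integrable_circ.
by apply: eq_Rintegral => x _; rewrite ImD.
Qed.

Lemma cintZ c F : ccont F -> cint (fun x => c * F x) = c * cint F.
Proof.
move=> [f1 f2]; have mc := measurable_circ.
have i1 a : mu.-integrable circ (EFin \o (fun x => a * complex.Re (F x))).
  by apply: integrable_circ => x; apply: cvgM; [exact: cvg_cst|exact: f1].
have i2 a : mu.-integrable circ (EFin \o (fun x => a * complex.Im (F x))).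
  by apply: integrable_circ => x; apply: cvgM; [exact: cvg_cst|exact: f2].
apply: complex_eq; rewrite ?Re_mul ?Im_mul /=.
  rewrite -!RintegralZl//; try exact: integrable_circ.
  by rewrite -RintegralB//; apply: eq_Rintegral => x _; rewrite Re_mul.
rewrite -!RintegralZl//; try exact: integrable_circ.
by rewrite -RintegralD//; apply: eq_Rintegral => x _; rewrite Im_mul.
Qed.

Lemma Rintegral_circ_cst (a : R) : \int[mu]_(x in circ) a = a * (2 * pi).
Proof.
have mc := measurable_circ; rewrite Rintegral_cst//.
have E : lebesgue_measure circ = (2 * pi)%:E :> \bar R.
  by rewrite /circ lebesgue_measure_itv/= lte_fin mulr_gt0 ?pi_gt0//= oppr0 adde0.
by congr (_ * _); exact: (congr1 fine E).
Qed.

Lemma cint_cst c : cint (fun _ => c) = c * (2 * pi)%:C%C.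
Proof.
apply: complex_eq; rewrite ?Re_mul ?Im_mul /= Rintegral_circ_cst; ring.
Qed.

Lemma cint_sum k (F : nat -> R -> C) : (forall j, ccont (F j)) ->
  cint (fun x => \sum_(j < k) F j x) = \sum_(j < k) cint (F j).
Proof.
move=> cF; elim: k => [|k IH].
  rewrite big_ord0; under eq_fun do rewrite big_ord0.
  by rewrite cint_cst mul0r.
rewrite big_ord_recr/= -IH -cintD//; last exact: ccont_sum.
by congr cint; apply/funext => x; rewrite big_ord_recr.
Qed.

(** The factor 2 beyond the length of the circle comes from estimating the real and
    imaginary parts separately. *)
Lemma cint_bound F K : ccont F -> (forall x, circ x -> normc (F x) <= K) ->
  normc (cint F) <= 4 * pi * K.
Proof.
move=> [f1 f2] FK; have mc := measurable_circ.
have aux u : continuous u -> (forall x, circ x -> `|u x| <= K) ->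
    `|\int[mu]_(x in circ) u x| <= 2 * pi * K.
  move=> cu uK; apply: le_trans (le_normr_Rintegral _ (integrable_circ cu)) _ => //.
  rewrite mulrC -Rintegral_circ_cst; apply: le_Rintegral => //.
  - by apply: integrable_circ => x; apply: cvg_norm; exact: cu.
  - by apply: integrable_circ; exact: cst_continuous.
apply: le_trans (normc_le_ReIm _) _; rewrite /cint /=.
have -> : 4 * pi * K = 2 * pi * K + 2 * pi * K by ring.
apply: lerD; apply: aux => // x cx.
  by apply: le_trans (ler_norm_Re _) (FK x cx).
by apply: le_trans (ler_norm_Im _) (FK x cx).
Qed.

Lemma Rintegral_circ_deriv (u v : R -> R) : continuous v ->
  (forall x : R, is_derive x 1 u (v x)) -> \int[mu]_(x in circ) v x = u (2 * pi) - u 0.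
Proof.
move=> cv du.
have p0 : 0 < 2 * pi :> R by rewrite mulr_gt0 ?pi_gt0.
have cu : continuous u.
  by move=> x; apply: differentiable_continuous; apply/derivable1_diffP.
rewrite /Rintegral (@continuous_FTC2 _ v u)//=.
- exact: continuous_subspaceT.
- split => //.
  + by apply: cvg_at_right_filter; exact: cu.
  + by apply: cvg_at_left_filter; exact: cu.
- by move=> x _; rewrite derive1E; have [_ ->] := du x.
Qed.

Lemma cint_deriv (U V : R -> C) : ccont V ->
  (forall x : R, is_derive x 1 (fun x => complex.Re (U x)) (complex.Re (V x))) ->
  (forall x : R, is_derive x 1 (fun x => complex.Im (U x)) (complex.Im (V x))) ->
  cint V = U (2 * pi) - U 0.
Proof.
move=> [v1 v2] d1 d2; apply: complex_eq; rewrite ?ReB ?ImB /=.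
  by rewrite (Rintegral_circ_deriv v1 d1).
by rewrite (Rintegral_circ_deriv v2 d2).
Qed.

Lemma cint_expi_conj j : cint (fun x => ((expi x)^*)%C ^+ j) =
  (if j == 0%N then (2 * pi)%:C%C else 0).
Proof.
case: j => [|j] /=; first by rewrite (_ : (fun _ => _) = fun=> 1) ?cint_cst ?mul1r.
have e x : ((expi x)^*)%C ^+ j.+1 = (cos (j.+1%:R * x) -i* sin (j.+1%:R * x))%C.
  by rewrite -rmorphXn expiX.
under eq_fun do rewrite e.
have k0 : j.+1%:R != 0 :> R by rewrite pnatr_eq0.
have cl : continuous (fun x : R => j.+1%:R * x).
  by move=> x; apply: cvgM; [exact: cvg_cst|exact: cvg_id].
have dl x : is_derive (x : R) 1 (fun x => j.+1%:R * x) (j.+1%:R : R).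
  rewrite -[X in is_derive _ _ _ X]mulr1.
  exact: (is_deriveZ j.+1%:R (is_derive_id x 1)).
have ds x : is_derive (x : R) 1 (fun x => sin (j.+1%:R * x)) (j.+1%:R * cos (j.+1%:R * x)).
  have d1 := is_derive_sin (j.+1%:R * x).
  by rewrite mulrC; exact: is_derive1_comp d1 (dl x).
have dc x : is_derive (x : R) 1 (fun x => cos (j.+1%:R * x)) (- (j.+1%:R * sin (j.+1%:R * x))).
  have d1 := is_derive_cos (j.+1%:R * x).
  by rewrite mulrC -mulNr; exact: is_derive1_comp d1 (dl x).
pose V x : C := (cos (j.+1%:R * x) -i* sin (j.+1%:R * x))%C.
pose U x : C := (j.+1%:R^-1 * sin (j.+1%:R * x) +i* (j.+1%:R^-1 * cos (j.+1%:R * x)))%C.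
have cV : ccont V.
  split => x /=.
    by apply: (continuous_comp (cl x)); exact: continuous_cos.
  by apply: cvgN; apply: (continuous_comp (cl x)); exact: continuous_sin.
have dU1 (x : R) : is_derive x 1 (fun x => complex.Re (U x)) (complex.Re (V x)).
  rewrite (_ : complex.Re (V x) = j.+1%:R^-1 * (j.+1%:R * cos (j.+1%:R * x))) /=; last first.
    by rewrite mulKf.
  exact: is_deriveZ.
have dU2 (x : R) : is_derive x 1 (fun x => complex.Im (U x)) (complex.Im (V x)).
  rewrite (_ : complex.Im (V x) = j.+1%:R^-1 * (- (j.+1%:R * sin (j.+1%:R * x)))) /=; last first.
    by rewrite mulrN mulKf.
  exact: is_deriveZ.
rewrite (cint_deriv cV dU1 dU2).
have e2 : expi (j.+1%:R * (2 * pi)) = 1 by rewrite -expiX expi2pi expr1n.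
have e3 : cos (j.+1%:R * (2 * pi)) = 1 :> R by case: e2.
have e4 : sin (j.+1%:R * (2 * pi)) = 0 :> R by case: e2.
by rewrite /U e3 e4 !mulr0 cos0 sin0 !mulr0 subrr.
Qed.

End CircleIntegral.

(** * Cauchy's formula with a geometric remainder *)

Section CauchyEstimate.
Context {R : realType}.
Local Notation C := R[i].
Local Notation mu := (@lebesgue_measure R).
Implicit Types (f g : C -> C) (z w : C).

Lemma is_derive_curve (u : R * R -> R) (c1 c2 : R -> R) (x d1 d2 : R) :
  differentiable u (c1 x, c2 x) -> is_derive x 1 c1 d1 -> is_derive x 1 c2 d2 ->
  is_derive x 1 (fun t => u (c1 t, c2 t))
    ('D_(1, 0) u (c1 x, c2 x) * d1 + 'D_(0, 1) u (c1 x, c2 x) * d2).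
Proof.
move=> du [dc1 e1] [dc2 e2].
have fc1 := (derivable1_diffP c1 x).1 dc1.
have fc2 := (derivable1_diffP c2 x).1 dc2.
have fc := differentiable_pair fc1 fc2.
have fu : differentiable (u \o (fun t => (c1 t, c2 t))) x by exact: differentiable_comp.
split; first exact: diff_derivable.
rewrite (deriveE _ fu) diff_comp//= diff_pair//=.
rewrite -(deriveE (1 : R) fc1) -(deriveE (1 : R) fc2) e1 e2.
rewrite (_ : (d1, d2) = d1 *: ((1 : R), (0 : R)) + d2 *: ((0 : R), (1 : R))); last first.
  by congr pair; rewrite /= /GRing.scale/= ?mulr1 ?mulr0 ?addr0 ?add0r.
by rewrite linearD !linearZ /= -!deriveE// /GRing.scale/= mulrC (mulrC d2).
Qed.

(** Holomorphy in the form used below: real differentiability together with the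
    Cauchy-Riemann equations, [f'] being the complex derivative. *)
Definition holo f f' := [/\ forall p, differentiable (rePart f) p,
   forall p, differentiable (imPart f) p, pderiv false f = f' &
   pderiv true f = (fun z => 'i%C * f' z)].

Lemma holo_curve f f' (F : R -> C) (x : R) (d : C) : holo f f' ->
  is_derive x 1 (fun t => complex.Re (F t)) (complex.Re d) ->
  is_derive x 1 (fun t => complex.Im (F t)) (complex.Im d) ->
  is_derive x 1 (fun t => complex.Re (f (F t))) (complex.Re (f' (F x) * d)) /\
  is_derive x 1 (fun t => complex.Im (f (F t))) (complex.Im (f' (F x) * d)).
Proof.
move=> [df1 df2 e1 e2] dF1 dF2; rewrite Re_mul Im_mul.
have E b z : pderiv b f z =
   ('D_(dir b) (rePart f) (ofC z) +i* 'D_(dir b) (imPart f) (ofC z))%C by [].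
have := E true (F x); have := E false (F x); rewrite e1 e2 /dir /ofC.
case Ef : (f' (F x)) => [a b] /= [-> ->] [].
rewrite !mul0r !mul1r !add0r => E1 E2.
have eF (t : R) : (complex.Re (F t) +i* complex.Im (F t))%C = F t by case: (F t).
split.
  have := is_derive_curve (df1 (complex.Re (F x), complex.Im (F x))) dF1 dF2.
  rewrite -E1 mulNr; congr is_derive.
  by apply/funext => t; rewrite /rePart /toC /= eF.
have := is_derive_curve (df2 (complex.Re (F x), complex.Im (F x))) dF1 dF2.
rewrite -E2 [X in is_derive _ _ _ X -> _]addrC; congr is_derive.
by apply/funext => t; rewrite /imPart /toC /= eF.
Qed.

Lemma fcont_bounded f (A : R) : fcont f ->
  exists2 B, 0 <= B & forall z, normc z <= A -> normc (f z) <= B.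
Proof.
move=> [f1 f2].
have aux (u : R * R -> R) : continuous u -> exists2 B, 0 <= B &
   forall p, normc (toC p) <= A -> `|u p| <= B.
  move=> cu.
  have cK : compact (`[- A, A] `*` `[- A, A])%classic.
    by apply: compact_setX; exact: segment_compact.
  have cI : compact (u @` (`[- A, A] `*` `[- A, A])%classic).
    by apply: continuous_compact => //; exact: continuous_subspaceT.
  have [M [_ HM]] := compact_bounded (cI : compact (_ : set R^o)).
  exists (`|M| + 1) => [|p pA]; first exact: addr_ge0.
  apply: (HM (`|M| + 1)); first by rewrite ltr_pwDr// ler_norm.
  exists p => //; split; rewrite /= in_itv /= -ler_norml.
    by apply: le_trans (ler_norm_Re (toC p)) pA.
  by apply: le_trans (ler_norm_Im (toC p)) pA.
have [B1 B10 H1] := aux _ f1; have [B2 B20 H2] := aux _ f2.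
exists (B1 + B2); first exact: addr_ge0.
move=> z zA; apply: le_trans (normc_le_ReIm _) _.
have := H1 (ofC z); have := H2 (ofC z); rewrite /rePart /imPart ofCK => h2 h1.
by apply: lerD; [exact: h1|exact: h2].
Qed.

Lemma Re_realM (t : R) z : complex.Re (t%:C%C * z) = t * complex.Re z.
Proof. by rewrite Re_mul /= mul0r subr0. Qed.

Lemma Im_realM (t : R) z : complex.Im (t%:C%C * z) = t * complex.Im z.
Proof. by rewrite Im_mul /= mul0r addr0. Qed.

Lemma is_derive_affine (a b t : R) : is_derive t 1 (fun t => a + t * b) b.
Proof.
have h : is_derive t 1 (cst a + ( *%R^~ b : R -> R)) (0 + b).
  apply: is_deriveD.
  have := is_deriveZ b (is_derive_id t (1 : R)).
  rewrite /GRing.scale/= mulr1; congr is_derive.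
  by apply/funext => x; rewrite mulrC.
by rewrite add0r in h.
Qed.

Lemma is_derive_mul_cst (U : R -> C) (c d : C) (t : R) :
  is_derive t 1 (fun t => complex.Re (U t)) (complex.Re d) ->
  is_derive t 1 (fun t => complex.Im (U t)) (complex.Im d) ->
  is_derive t 1 (fun t => complex.Re (U t * c)) (complex.Re (d * c)) /\
  is_derive t 1 (fun t => complex.Im (U t * c)) (complex.Im (d * c)).
Proof.
move=> d1 d2.
have Z (a : R) (u : R -> R) (e : R) : is_derive t 1 u e ->
    is_derive t 1 (fun t => u t * a) (e * a).
  move=> du; have := is_deriveZ a du; rewrite /GRing.scale /= mulrC; congr is_derive.
  by apply/funext => x; rewrite mulrC.
split.
  rewrite (_ : (fun t => _) = (fun t => complex.Re (U t) * complex.Re c) -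
    (fun t => complex.Im (U t) * complex.Im c)); last first.
    by apply/funext => x; rewrite Re_mul.
  by rewrite Re_mul; apply: is_deriveB; exact: Z.
rewrite (_ : (fun t => _) = (fun t => complex.Re (U t) * complex.Im c) +
  (fun t => complex.Im (U t) * complex.Re c)); last first.
  by apply/funext => x; rewrite Im_mul.
by rewrite Im_mul; apply: is_deriveD; exact: Z.
Qed.

Lemma is_derive_circ_integral (h dh : R -> R -> R) (K : R) :
  (forall t x : R, is_derive t 1 (h^~ x) (dh t x)) ->
  (forall t, continuous (h t)) ->
  (forall t x, t \in `]-1, 2[ -> circ x -> `|dh t x| <= K) ->
  forall t : R, t \in `]-1, 2[ ->
  is_derive t 1 (fun t => \int[mu]_(x in circ) h t x) (\int[mu]_(x in circ) dh t x).
Proof.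
move=> d c b t tI.
have p1 s x : partial1of2 h s x = dh s x.
  by rewrite partial1of2E; have [_ ->] := d s x.
have ic s : mu.-integrable circ (EFin \o h s) by exact: integrable_circ.
have iK : mu.-integrable circ (EFin \o cst K).
  by apply: integrable_circ; exact: cst_continuous.
have K0 : 0 <= K.
  apply: le_trans (normr_ge0 _) (b t 0 tI _).
  by rewrite /circ /= in_itv /= lexx mulr_ge0 ?pi_ge0.
have b' s x : s \in `]-1, 2[ -> circ x -> `|partial1of2 h s x| <= K.
  by rewrite p1; exact: b.
have der s x : s \in `]-1, 2[ -> circ x -> derivable (h^~ x) s 1.
  by move=> _ _; have [] := d s x.
split.
  apply: (@derivable_under_integral _ _ _ mu h circ measurable_circ t (-1) 2 tI
    (fun s _ => ic s) der (cst K) (fun _ => K0) iK b').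
rewrite -derive1E (@differentiation_under_integral _ _ _ mu h circ measurable_circ t (-1) 2 tI
    (fun s _ => ic s) der (cst K) (fun _ => K0) iK b').
by apply: eq_Rintegral => x _; rewrite p1.
Qed.

Lemma ccont_conj_expi : ccont (fun x : R => ((expi x)^*)%C).
Proof.
split => x /=; first exact: continuous_cos.
by apply: cvgN; exact: continuous_sin.
Qed.

Lemma MVT_bound (u du : R -> R) (K : R) :
  (forall t : R, t \in `]-1, 2[ -> is_derive t 1 u (du t)) ->
  (forall t : R, t \in `]0, 1[ -> `|du t| <= K) -> `|u 1 - u 0| <= K.
Proof.
move=> d b.
have sub (t : R) : t \in `[0, 1] -> t \in `]-1, 2[.
  by rewrite !in_itv/= => /andP[t0 t1]; apply/andP; split; lra.
have cu : {within `[0, 1], continuous u}.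
  by apply: derivable_within_continuous => t /sub/d[].
have du01 (t : R) : t \in `]0, 1[ -> is_derive t 1 u (du t).
  by move=> /subset_itv_oo_cc /sub /d.
have [t t01 ->] := MVT ltr01 du01 cu.
by rewrite subr0 mulr1 b.
Qed.

(** Cauchy's integral for the [j]-th Taylor coefficient at the origin. *)
Definition taylor_coef f (r : R) (j : nat) : C := ((2 * pi)%:C%C)^-1 *
  (cint (fun x => f (r%:C%C * expi x) * ((expi x)^*)%C ^+ j) * (r%:C%C ^- j)).

(** The circle is contracted to the point [w] along segments, [gamma t x] being the
    point at time [t] on the segment from [w] to the point of argument [x].  The
    Cauchy kernel is replaced by the partial sum [K] of its geometric series: then
    nothing is singular, and the integral of [f (gamma t x) * K x] is constant in [t]
    up to an error of order [2 ^ - J].  At [t = 0] it gives [f w], and at [t = 1] the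
    Taylor polynomial of degree less than [J]. *)
Section CauchyFormula.
Variables (f f' : C -> C) (r : R).
Hypotheses (holof : holo f f') (cf : fcont f) (cf' : fcont f') (r0 : 0 < r).
Variable w : C.
Hypothesis wr : normc w <= r / 2.
Variable J : nat.

Let d x : C := r%:C%C * expi x - w.
Let gamma (t x : R) : C := w + t%:C%C * d x.
Let q x : C := w / r%:C%C * ((expi x)^*)%C.
Let K x : C := \sum_(j < J) q x ^+ j.

Let cq : ccont q.
Proof. by apply: ccontM; [exact: ccont_cst|exact: ccont_conj_expi]. Qed.

Let cK : ccont K.
Proof. by apply: (@ccont_sum _ _ (fun j x => q x ^+ j)) => j; exact: ccontX. Qed.

Let cre : ccont (fun x => r%:C%C * expi x).
Proof. by apply: ccontM; [exact: ccont_cst|exact: ccont_expi]. Qed.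

Let cgamma t : ccont (gamma t).
Proof.
apply: ccontD; first exact: ccont_cst.
apply: ccontM; first exact: ccont_cst.
by apply: ccontD => //; exact: ccont_cst.
Qed.

Let rC0 : r%:C%C != 0 :> C.
Proof. by rewrite -normc_eq0 normc_real gtr0_norm// gt_eqF. Qed.

Let normq x : normc (q x) <= 2^-1.
Proof.
rewrite !normcM normcV normc_real normc_conj normc_expi mulr1 (gtr0_norm r0).
by rewrite ler_pdivrMr// mulrC.
Qed.

Let dK x : d x * K x = r%:C%C * expi x * (1 - q x ^+ J).
Proof.
have -> : d x = r%:C%C * expi x * (1 - q x).
  have ee : expi x * ((expi x)^*)%C = 1.
    by apply: complex_eq => /=; rewrite ?mulrN ?opprK -?expr2 ?cos2Dsin2//; ring.
  rewrite /q /d mulrBr mulr1; congr (_ - _).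
  by rewrite mulrACA (mulrC r%:C%C) divfK// ee mulr1.
rewrite -mulrA; congr (_ * _).
by rewrite -[1 in RHS](expr1n _ J) subrXX; congr (_ * _); apply: eq_bigr => j _; rewrite expr1n mul1r.
Qed.

Let F t x := f (gamma t x) * K x.
Let G t x := f' (gamma t x) * d x * K x.

Let cF t : ccont (F t).
Proof. by apply: ccontM => //; exact: ccont_comp. Qed.

Let dF (t x : R) :
  is_derive t 1 (fun t => complex.Re (F t x)) (complex.Re (G t x)) /\
  is_derive t 1 (fun t => complex.Im (F t x)) (complex.Im (G t x)).
Proof.
have a1 : is_derive t 1 (fun t => complex.Re (gamma t x)) (complex.Re (d x)).
  have := is_derive_affine (complex.Re w) (complex.Re (d x)) t; congr is_derive.
  by apply/funext => s; rewrite /gamma [RHS]ReD Re_realM.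
have a2 : is_derive t 1 (fun t => complex.Im (gamma t x)) (complex.Im (d x)).
  have := is_derive_affine (complex.Im w) (complex.Im (d x)) t; congr is_derive.
  by apply/funext => s; rewrite /gamma [RHS]ImD Im_realM.
have [b1 b2] := holo_curve holof a1 a2.
exact: is_derive_mul_cst.
Qed.

Let normd x : normc (d x) <= 2 * r.
Proof.
apply: le_trans (normcB _ _) _; rewrite normcM normc_real normc_expi mulr1 gtr0_norm//.
have := wr; have := r0; lra.
Qed.

Let normgamma t x : t \in `]-1, 2[ -> normc (gamma t x) <= 5 * r.
Proof.
rewrite in_itv /= => /andP[t1 t2]; apply: le_trans (normcD _ _) _.
have -> : 5 * r = r + 2 * (2 * r) by ring.
apply: lerD; first (by have := wr; have := r0; lra).
rewrite normcM normc_real ler_pM ?normc_ge0// ler_norml; apply/andP; split; lra.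
Qed.

Let normK x : normc (K x) <= 2.
Proof.
apply: le_trans (normc_sum _ _ _) _.
apply: (@le_trans _ _ (\sum_(j < J) 1 / 2 ^+ j)).
  apply: ler_sum => j _; rewrite normcX div1r -exprVn lerXn2r ?nnegrE ?normc_ge0//.
by have := @sum_geometric_le0 R 1 J ler01; rewrite mulr1.
Qed.

(* The derivative in [t] of the integral of [F t] is an integral of [G t]; up to
   the factor [1 - q ^+ J] the latter is the derivative of a periodic function. *)
Let cintG B t : 0 <= B -> (forall z, normc z <= 5 * r -> normc (f' z) <= B) ->
  t \in `]0, 1[ -> normc (cint (G t)) <= 4 * pi * (B * r / 2 ^+ J).
Proof.
move=> B0 HB t01.
have tI : t \in `]-1, 2[.
  by move: t01; rewrite !in_itv/= => /andP[t0 t1]; apply/andP; split; lra.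
have t0 : t != 0 by move: t01; rewrite in_itv/= => /andP[t0 _]; rewrite gt_eqF.
have tC0 : t%:C%C != 0 :> C.
  by apply: contra t0 => /eqP [->].
have cfg : ccont (fun x => f' (gamma t x)) by exact: ccont_comp.
pose P x := f' (gamma t x) * (r%:C%C * expi x).
have cP : ccont P by exact: ccontM.
have cPq : ccont (fun x => P x * q x ^+ J) by apply: ccontM => //; exact: ccontX.
have -> : cint (G t) = cint P - cint (fun x => P x * q x ^+ J).
  have -> : - cint (fun x => P x * q x ^+ J) = cint (fun x => -1 * (P x * q x ^+ J)).
    by rewrite cintZ// mulN1r.
  rewrite -cintD//; last by apply: ccontM => //; exact: ccont_cst.
  congr cint; apply/funext => x; rewrite /G -mulrA dK /P; ring.
have -> : cint P = 0.
  have e1 : cint (fun x => t%:C%C * 'i%C * P x) = f (gamma t (2 * pi)) - f (gamma t 0).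
    have der (x : R) : is_derive x 1 (fun x => complex.Re (f (gamma t x))) (complex.Re (t%:C%C * 'i%C * P x)) /\
       is_derive x 1 (fun x => complex.Im (f (gamma t x))) (complex.Im (t%:C%C * 'i%C * P x)).
      have -> : t%:C%C * 'i%C * P x = f' (gamma t x) * ('i%C * expi x * (t * r)%:C%C).
        by rewrite /P rmorphM; ring.
      have d1 : is_derive x 1 (fun x => complex.Re (expi x)) (complex.Re ('i%C * expi x)).
        have /= := is_derive_cos x; congr is_derive; ring.
      have d2 : is_derive x 1 (fun x => complex.Im (expi x)) (complex.Im ('i%C * expi x)).
        have /= := is_derive_sin x; congr is_derive; ring.
      have [g1 g2] := is_derive_mul_cst (t * r)%:C%C d1 d2.
      have eg y : gamma t y = expi y * (t * r)%:C%C + (w - t%:C%C * w).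
        by rewrite /gamma /d rmorphM; ring.
      apply: holo_curve => //.
        have := is_deriveD g1 (is_derive_cst (complex.Re (w - t%:C%C * w)) x 1).
        rewrite addr0; congr is_derive.
        by apply/funext => y; rewrite eg [RHS]ReD.
      have := is_deriveD g2 (is_derive_cst (complex.Im (w - t%:C%C * w)) x 1).
      rewrite addr0; congr is_derive.
      by apply/funext => y; rewrite eg [RHS]ImD.
    apply: (@cint_deriv _ (fun x => f (gamma t x))).
    - by apply: ccontM => //; exact: ccont_cst.
    - by move=> x; have [] := der x.
    - by move=> x; have [] := der x.
  move: e1; rewrite cintZ// /gamma /d expi2pi.
  rewrite (_ : expi 0 = 1); last by rewrite /expi cos0 sin0.
  rewrite subrr => /eqP; rewrite !mulf_eq0 (negPf tC0) /= => /orP[/eqP[] /eqP|/eqP//].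
  by rewrite oner_eq0.
rewrite sub0r normc_opp; apply: cint_bound => // x _.
rewrite /P !normcM normc_real normc_expi mulr1 gtr0_norm// normcX.
apply: ler_pM; rewrite ?mulr_ge0 ?exprn_ge0 ?normc_ge0 ?(ltW r0)//.
  by rewrite ler_wpM2r ?(ltW r0)// HB// normgamma.
by rewrite -exprVn lerXn2r ?nnegrE ?normc_ge0.
Qed.

Lemma cauchy_segment B : 0 <= B -> (forall z, normc z <= 5 * r -> normc (f' z) <= B) ->
  normc (cint (F 1) - cint (F 0)) <= 8 * pi * (B * r / 2 ^+ J).
Proof.
move=> B0 HB.
have bG t x : t \in `]-1, 2[ -> normc (G t x) <= B * (2 * r) * 2.
  move=> tI; rewrite /G !normcM ler_pM ?mulr_ge0 ?normc_ge0//.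
  by apply: ler_pM; rewrite ?normc_ge0 ?normd// HB// normgamma.
have D1 := is_derive_circ_integral (fun t x => (dF t x).1) (fun t => (cF t).1)
   (fun t x tI _ => le_trans (ler_norm_Re _) (bG t x tI)).
have D2 := is_derive_circ_integral (fun t x => (dF t x).2) (fun t => (cF t).2)
   (fun t x tI _ => le_trans (ler_norm_Im _) (bG t x tI)).
have M1 := MVT_bound D1 (fun t t01 => le_trans (ler_norm_Re (cint (G t))) (cintG B0 HB t01)).
have M2 := MVT_bound D2 (fun t t01 => le_trans (ler_norm_Im (cint (G t))) (cintG B0 HB t01)).
apply: le_trans (normc_le_ReIm _) _; rewrite ReB ImB.
apply: le_trans (lerD M1 M2) _.
by rewrite le_eqVlt; apply/orP; left; apply/eqP; ring.
Qed.

Lemma cint_segment_start : (0 < J)%N -> cint (F 0) = f w * (2 * pi)%:C%C.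
Proof.
move=> J0; rewrite (_ : F 0 = (fun x => f w * K x)); last first.
  by apply/funext => x; rewrite /F /gamma mul0r addr0.
rewrite cintZ//; congr (_ * _).
have e (j : nat) : (fun x => q x ^+ j) = (fun x => (w / r%:C%C) ^+ j * ((expi x)^*)%C ^+ j).
  by apply/funext => x; rewrite exprMn.
rewrite (cint_sum J (F := fun j x => q x ^+ j)); last by move=> j; exact: ccontX.
have cj k : ccont (fun x : R => ((expi x)^*)%C ^+ k) by apply: ccontX; exact: ccont_conj_expi.
case: J J0 => // J' _; rewrite big_ord_recl /= e cintZ//.
rewrite cint_expi_conj /= expr0 mul1r big1 ?addr0// => j _.
by rewrite e cintZ// cint_expi_conj /= mulr0.
Qed.

Lemma cint_segment_end :
  cint (F 1) = (\sum_(j < J) taylor_coef f r j * w ^+ j) * (2 * pi)%:C%C.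
Proof.
have pC0 : (2 * pi)%:C%C != 0 :> C.
  by rewrite -normc_eq0 normc_real gtr0_norm ?gt_eqF// mulr_gt0 ?pi_gt0.
have cj k : ccont (fun x : R => ((expi x)^*)%C ^+ k) by apply: ccontX; exact: ccont_conj_expi.
have cfr : ccont (fun x => f (r%:C%C * expi x)) by exact: ccont_comp.
rewrite (_ : F 1 = (fun x => \sum_(j < J) (w / r%:C%C) ^+ j * (f (r%:C%C * expi x) * ((expi x)^*)%C ^+ j))); last first.
  apply/funext => x; rewrite /F /gamma mul1r /d addrC subrK /K mulr_sumr.
  by apply: eq_bigr => j _; rewrite exprMn mulrCA.
have cc k : ccont (fun x => f (r%:C%C * expi x) * ((expi x)^*)%C ^+ k) by exact: ccontM.
rewrite (cint_sum J (F := fun j x => (w / r%:C%C) ^+ j * (f (r%:C%C * expi x) * ((expi x)^*)%C ^+ j))); last first.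
  by move=> j; apply: ccontM => //; exact: ccont_cst.
rewrite mulr_suml; apply: eq_bigr => j _; rewrite cintZ// /taylor_coef.
rewrite exprMn exprVn; set c := cint _; move: pC0; move: (2 * pi)%:C%C => p pC0.
by field; rewrite pC0 expf_neq0.
Qed.

End CauchyFormula.

Lemma cauchy_disc f f' (r : R) : holo f f' -> fcont f -> fcont f' -> 0 < r ->
  exists M, forall w, normc w <= r / 2 -> forall N,
    normc (f w - \sum_(j < N) taylor_coef f r j * w ^+ j) <= M / 2 ^+ N.
Proof.
move=> hf cf cf' r0.
have [B B0 HB] := fcont_bounded (5 * r) cf'.
have [A A0 HA] := fcont_bounded (5 * r) cf.
have p0 : 0 < 2 * pi :> R by rewrite mulr_gt0 ?pi_gt0.
have pC0 : (2 * pi)%:C%C != 0 :> C by rewrite -normc_eq0 normc_real gtr0_norm ?gt_eqF.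
exists (4 * (B * r) + A) => w wr [|N].
  rewrite big_ord0 subr0 expr0 divr1; apply: le_trans (HA w _) _; first by lra.
  by rewrite lerDr !mulr_ge0// ltW.
have := cauchy_segment hf cf cf' r0 wr N.+1 B0 HB.
rewrite (cint_segment_start f r w (ltn0Sn N)) (cint_segment_end cf r0 w N.+1) -mulrBl.
rewrite normcM normc_real gtr0_norm// -normc_opp opprB => H.
rewrite -(ler_pM2r p0); apply: le_trans H _.
have q0 : 0 <= (2 ^+ N.+1)^-1 :> R by rewrite invr_ge0 exprn_ge0.
rewrite -subr_ge0 [X in 0 <= X](_ : _ = A / 2 ^+ N.+1 * (2 * pi)); last by ring.
by rewrite mulr_ge0 ?(ltW p0)// mulr_ge0.
Qed.

End CauchyEstimate.

(** * Fourier analysis on roots of unity *)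

Section FiniteFourier.
Context {R : realType}.
Local Notation C := R[i].

Lemma conjM (z w : C) : ((z * w)^*)%C = (z^*)%C * (w^*)%C.
Proof. exact: rmorphM. Qed.

Lemma conjX (z : C) k : ((z ^+ k)^*)%C = (z^*)%C ^+ k.
Proof. exact: rmorphXn. Qed.

Lemma conj_sum I (r : seq I) (P : pred I) (F : I -> C) :
  ((\sum_(i <- r | P i) F i)^*)%C = \sum_(i <- r | P i) ((F i)^*)%C.
Proof. exact: rmorph_sum. Qed.

Lemma realC_sum I (r : seq I) (P : pred I) (F : I -> R) :
  (\sum_(i <- r | P i) F i)%:C%C = \sum_(i <- r | P i) (F i)%:C%C.
Proof. exact: rmorph_sum. Qed.

Lemma realCM (x y : R) : (x * y)%:C%C = x%:C%C * y%:C%C.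
Proof. exact: rmorphM. Qed.

Lemma expi_neq1 (y : R) : 0 < y < 2 * pi -> expi y != 1.
Proof.
move=> /andP[y0 y2]; apply/eqP => /(congr1 (@complex.Re R)) /= e.
have s0 : 0 < sin (y / 2) by apply: sin_gt0_pi; lra.
have : cos (y / 2 + y / 2) = 1 by rewrite -splitr.
rewrite cosD; have := cos2Dsin2 (y / 2); rewrite !expr2 => e1 e2.
have : 0 < sin (y / 2) * sin (y / 2) by rewrite mulr_gt0.
lra.
Qed.

Definition root1 (N : nat) : C := expi (2 * pi / N%:R).

Lemma root1_norm N l : normc (root1 N ^+ l) = 1.
Proof. by rewrite normcX normc_expi expr1n. Qed.

Lemma root1_expN N : (0 < N)%N -> root1 N ^+ N = 1.
Proof.
move=> N0; rewrite /root1 expiX mulrC divfK ?expi2pi//.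
by rewrite pnatr_eq0 -lt0n.
Qed.

Lemma conj_unit (z : C) : normc z = 1 -> z * (z^*)%C = 1.
Proof.
move=> z1; have := normc_sq z; rewrite z1 expr1n; case: z {z1} => a b /= e.
by apply: complex_eq => /=; [rewrite mulrN opprK -!expr2 -e|ring].
Qed.

Lemma root1_sum N a b : (a < N)%N -> (b < N)%N ->
  \sum_(l < N) (root1 N ^+ l) ^+ a * (((root1 N ^+ l)^*)%C) ^+ b =
  if a == b then N%:R else 0.
Proof.
wlog ab : a b / (b <= a)%N.
  move=> W aN bN; case: (leqP b a) => [ab|/ltnW ab]; first exact: W.
  rewrite eq_sym -[RHS]conjcK.
  have -> : ((if b == a then N%:R else 0 : C)^*)%C = if b == a then N%:R else 0.
    by case: ifP => _; rewrite ?rmorph_nat ?rmorph0.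
  rewrite -(W b a)// conj_sum; apply: eq_bigr => l _.
  by rewrite conjM !conjX conjcK mulrC.
move=> aN bN; have N0 : (0 < N)%N by exact: leq_ltn_trans aN.
set w := root1 N; pose zeta := w ^+ (a - b).
have e l : (w ^+ l) ^+ a * (((w ^+ l)^*)%C) ^+ b = zeta ^+ l.
  rewrite -[in LHS](subnK ab) exprD -mulrA -exprMn conj_unit ?root1_norm//.
  by rewrite expr1n mulr1 /zeta -!exprM mulnC.
under eq_bigr do rewrite e.
case: eqP => [E|/eqP ne].
  rewrite /zeta E subnn; under eq_bigr do rewrite expr0 expr1n.
  by rewrite sumr_const card_ord.
have z1 : zeta != 1.
  have k0 : (0 < a - b)%N by rewrite subn_gt0 ltn_neqAle eq_sym ne.
  have N0' : 0 < N%:R :> R by rewrite ltr0n.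
  rewrite /zeta /w /root1 expiX; apply: expi_neq1; apply/andP; split.
    by rewrite mulr_gt0 ?ltr0n// divr_gt0// mulr_gt0 ?pi_gt0.
  rewrite mulrCA gtr_pMr ?mulr_gt0 ?pi_gt0// ltr_pdivrMr// mul1r ltr_nat.
  by rewrite (leq_ltn_trans _ aN)// leq_subr.
apply/eqP; have : (zeta - 1) * (\sum_(l < N) zeta ^+ l) = 0.
  by rewrite -subrX1 /zeta exprAC root1_expN// expr1n subrr.
by move/eqP; rewrite mulf_eq0 subr_eq0 (negPf z1).
Qed.

(** The discrete Fourier transform over the [N]-th roots of unity; these finite
    averages stand for Fourier coefficients, and need no integration theory. *)
Definition dft N (F : nat -> C) (j : nat) : C :=
  N%:R^-1 * \sum_(l < N) ((root1 N ^+ l)^*)%C ^+ j * F l.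

Lemma dft_trig N (F G : nat -> C) j : (j < N)%N ->
  (forall l, F l = \sum_(i < N) (root1 N ^+ l) ^+ i * G i) -> dft N F j = G j.
Proof.
move=> jN HF; rewrite /dft.
have N0 : N%:R != 0 :> C by rewrite pnatr_eq0 -lt0n (leq_ltn_trans _ jN).
under eq_bigr do rewrite HF mulr_sumr.
rewrite exchange_big /=.
rewrite (eq_bigr (fun i : 'I_N => (if (i : nat) == j then N%:R else 0) * G i)); last first.
  move=> i _; rewrite -(root1_sum (ltn_ord i) jN) mulr_suml.
  by apply: eq_bigr => l _; rewrite mulrCA mulrA.
rewrite (bigD1 (Ordinal jN))//= eqxx big1 ?addr0 ?mulKf// => i.
by rewrite -val_eqE /= => /negPf ->; rewrite mul0r.
Qed.

Lemma dft_bound N (F : nat -> C) (e : R) j : (0 < N)%N ->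
  (forall l, normc (F l) <= e) -> normc (dft N F j) <= e.
Proof.
move=> N0 HF; rewrite normcM normcV normc_nat ler_pdivrMl ?ltr0n//.
apply: le_trans (normc_sum _ _ _) _.
apply: (@le_trans _ _ (\sum_(l < N) e)).
  by apply: ler_sum => l _; rewrite normcM normcX normc_conj root1_norm expr1n mul1r.
by rewrite sumr_const card_ord mulr_natl.
Qed.

Lemma dftB N (F G : nat -> C) j : dft N (fun l => F l - G l) j = dft N F j - dft N G j.
Proof.
by rewrite /dft -mulrBr -sumrB; congr (_ * _); apply: eq_bigr => l _; rewrite mulrBr.
Qed.

(** A trigonometric polynomial is recovered exactly from its values at the roots of
    unity, so an approximation of the values is one of the coefficients. *)
Lemma dft_close N (F G : nat -> C) (e : R) j : (j < N)%N ->
  (forall l, normc (F l - \sum_(i < N) (root1 N ^+ l) ^+ i * G i) <= e) ->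
  normc (dft N F j - G j) <= e.
Proof.
move=> jN HF.
rewrite -(@dft_trig N (fun l => \sum_(i < N) (root1 N ^+ l) ^+ i * G i) G j)//.
by rewrite -dftB; apply: dft_bound => //; rewrite (leq_ltn_trans _ jN).
Qed.

Lemma normc_sqC (z : C) : (normc z ^+ 2)%:C%C = z * (z^*)%C.
Proof.
by rewrite normc_sq; case: z => a b; apply: complex_eq => /=; ring.
Qed.

Lemma dft_parseval N (F : nat -> C) : (0 < N)%N ->
  \sum_(j < N) normc (dft N F j) ^+ 2 = N%:R^-1 * \sum_(l < N) normc (F l) ^+ 2.
Proof.
move=> N0; have N0' : N%:R != 0 :> C by rewrite pnatr_eq0 -lt0n.
apply: (@complexI R); rewrite realCM !realC_sum.
have -> : (N%:R^-1)%:C%C = N%:R^-1 :> C by rewrite fmorphV rmorph_nat.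
have cN : ((N%:R^-1 : C)^*)%C = N%:R^-1 by rewrite fmorphV rmorph_nat.
under eq_bigr do rewrite normc_sqC /dft conjM cN conj_sum mulrACA big_distrlr/=.
under [in RHS]eq_bigr do rewrite normc_sqC.
rewrite -mulr_sumr -mulrA; congr (_ * _); apply: (mulfI N0'); rewrite mulrA divff// mul1r.
rewrite exchange_big /= mulr_sumr; apply: eq_bigr => l _.
rewrite exchange_big /=.
rewrite (eq_bigr (fun m : 'I_N => F l * ((F m)^*)%C * (if (m : nat) == l then N%:R else 0))); last first.
  move=> m _; rewrite -(root1_sum (ltn_ord m) (ltn_ord l)) mulr_sumr.
  apply: eq_bigr => j _; rewrite conjM !conjX conjcK.
  rewrite -!exprM (mulnC j m) (mulnC j l); ring.
rewrite (bigD1 l)//= eqxx big1 ?addr0 1?mulrC// => m ml.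
by rewrite -val_eqE /= in ml; rewrite (negPf ml) mulr0.
Qed.

End FiniteFourier.

(** * Polyanalytic functions as polynomials in the conjugate variable *)

Section Structure.
Context {R : realType}.
Local Notation C := R[i].
Implicit Types (f g : C -> C).

Lemma normc_dist_le (x a b : C) : normc (a - b) <= normc (x - a) + normc (x - b).
Proof.
by rewrite -(normc_opp (x - a)) opprB -[a - b](subrKA x) normcD.
Qed.

(** Both sides are limits of the same averages of [f] over the unit circle, on which
    [cauchy_disc] applies when the radius is at least 2. *)
Lemma taylor_coef_indep f f' (r s : R) j : holo f f' -> fcont f -> fcont f' ->
  2 <= r -> 2 <= s -> taylor_coef f r j = taylor_coef f s j.
Proof.
move=> hf cf cf' r2 s2.
have key (t : R) : 2 <= t -> exists M, forall N, (j < N)%N ->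
    normc (dft N (fun l => f (root1 N ^+ l)) j - taylor_coef f t j) <= M / 2 ^+ N.
  move=> t2; have [|M HM] := cauchy_disc hf cf cf' (_ : 0 < t); first by lra.
  exists M => N jN; apply: dft_close => // l.
  have := HM (root1 N ^+ l); rewrite root1_norm => /(_ _ N).
  rewrite (eq_bigr (fun i : 'I_N => (root1 N ^+ l) ^+ i * taylor_coef f t i)).
    by apply; lra.
  by move=> i _; rewrite mulrC.
have [M HM] := key _ r2; have [M' HM'] := key _ s2.
apply/eqP; rewrite -subr_eq0 -normc_eq0 eq_le normc_ge0 andbT.
apply: (@ler_of_geometric _ _ 0 (M + M')) => N; rewrite add0r.
have N1 : (j < N + j.+1)%N by rewrite ltn_addl.
have M0 : 0 <= M + M'.
  have := lerD (le_trans (normc_ge0 _) (HM _ N1)) (le_trans (normc_ge0 _) (HM' _ N1)).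
  by rewrite addr0 -mulrDl pmulr_lge0// invr_gt0 exprn_gt0.
apply: (@le_trans _ _ ((M + M') / 2 ^+ (N + j.+1))).
  rewrite mulrDl; apply: (le_trans _ (lerD (HM _ N1) (HM' _ N1))).
  exact: normc_dist_le.
rewrite ler_wpM2l// lef_pV2 ?posrE ?exprn_gt0//.
by rewrite ler_weXn2l ?leq_addr//; lra.
Qed.

Lemma smooth_fcont f : smooth f -> fcont f.
Proof.
move=> sf; split=> p; apply: differentiable_continuous.
  by have [] := sf [::] p.
by have [] := sf [::] p.
Qed.

(** The Taylor polynomials approximate [f] on discs of any radius, with the same
    coefficients by [taylor_coef_indep]. *)
Lemma holo_entire f : smooth f -> (forall z, dbar f z = 0) -> exists a, entire a f.
Proof.
move=> sf df; pose f' := pderiv false f.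
have hf : holo f f'.
  split => //.
  - by move=> p; have [] := sf [::] p.
  - by move=> p; have [] := sf [::] p.
  - apply/funext => z; have := df z; rewrite /dbar -/(f' z) => /eqP.
    rewrite mulf_eq0 invr_eq0 pnatr_eq0 /= addrC addr_eq0 => /eqP e.
    by apply: (mulfI (_ : 'i%C != 0)); rewrite ?e ?mulrA -?expr2 ?sqr_i ?mulN1r// -normc_eq0 /= expr0n expr1n add0r sqrtr1 oner_eq0.
have cf := smooth_fcont sf; have cf' : fcont f' := smooth_fcont (smooth_pderiv false sf).
exists (taylor_coef f 2) => rho.
have [|M HM] := cauchy_disc hf cf cf' (_ : 0 < 2 * (`|rho| + 1)).
  by have := normr_ge0 rho; lra.
exists M => z zr N.
rewrite (eq_bigr (fun j : 'I_N => taylor_coef f (2 * (`|rho| + 1)) j * z ^+ j)).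
  apply: HM; rewrite mulrAC divff// mul1r.
  by rewrite (le_trans zr)// (le_trans (ler_norm _))// lerDl.
move=> j _; have t2 : 2 <= 2 * (`|rho| + 1) by have := normr_ge0 rho; lra.
by rewrite (taylor_coef_indep j hf cf cf' (lexx 2) t2).
Qed.

Lemma entire0 : entire (fun _ => 0) (0 : C -> C).
Proof.
move=> rho; exists 0 => z _ N; rewrite big1 => [|j _]; last by rewrite mul0r.
by rewrite subrr normc0 mul0r.
Qed.

(** The explicit form of [n]-analytic functions, see [nanalytic_polyentire]. *)
Definition polyentire n : set (C -> C) := [set f |
  exists (a : nat -> nat -> C) (h : nat -> C -> C),
    (forall q, entire (a q) (h q)) /\
    f = (fun z => \sum_(q < n) (z^*)%C ^+ q * h q z)].

Lemma polyentire_submod_closed n : submod_closed [in polyentire n].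
Proof.
split=> [|c f g /set_mem[a [h [E ->]]] /set_mem[b [k [E' ->]]]]; apply/mem_set.
  exists (fun _ _ => 0), (fun _ => 0); split; first by move=> q; exact: entire0.
  by apply/funext => z; rewrite big1// => q _; rewrite mulr0.
exists (fun q j => c * a q j + b q j), (fun q => c *: h q + k q); split.
  by move=> q; exact: entire_lin.
apply/funext => z.
transitivity (c * (\sum_(q < n) (z^*)%C ^+ q * h q z) + \sum_(q < n) (z^*)%C ^+ q * k q z) => //.
rewrite mulr_sumr -big_split; apply: eq_bigr => q _ /=.
transitivity ((z^*)%C ^+ q * (c * h q z + k q z)); [by ring|by []].
Qed.

Lemma wirt_conjX q : wirt (fun z : C => (z^*)%C ^+ q) (cst 0)
  (fun z => q%:R * (z^*)%C ^+ q.-1).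
Proof.
elim: q => [|q IH].
  have := wirt_cst (1 : C); congr wirt; apply/funext => z; by rewrite mul0r.
have := wirt_mul (@wirt_conj R) IH; congr wirt; apply/funext => z.
- by rewrite exprS.
- transitivity ((z^*)%C * 0 + 0 * (z^*)%C ^+ q); [by []|by rewrite mulr0 mul0r addr0].
- transitivity ((z^*)%C * (q%:R * (z^*)%C ^+ q.-1) + 1 * (z^*)%C ^+ q); first by [].
  rewrite -natr1; case: q {IH} => [|q] /=; first by rewrite expr0; ring.
  by rewrite !exprS; ring.
Qed.

Lemma wirt_sum n (f u v : nat -> C -> C) : (forall q, wirt (f q) (u q) (v q)) ->
  wirt (fun z => \sum_(q < n) f q z) (fun z => \sum_(q < n) u q z)
       (fun z => \sum_(q < n) v q z).
Proof.
move=> W; elim: n => [|n IH].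
  by have := wirt_cst (0 : C); congr wirt; apply/funext => z; rewrite big_ord0.
have := wirt_lin 1 IH (W n); rewrite !scale1r; congr wirt;
  by apply/funext => z; rewrite big_ord_recr.
Qed.

(** Differentiation in the conjugate variable lowers the degree in that variable, and
    the other derivative acts on the coefficients. *)
Lemma polyentire_wirt n f : polyentire n f ->
  exists u v, [/\ polyentire n u, polyentire n.-1 v & wirt f u v].
Proof.
move=> [a [h [E ->]]].
have /choice[h' Hh'] q : exists h', entire (fun j => j.+1%:R * a q j.+1) h' /\
   wirt (h q) h' (cst 0) by exact: entire_deriv.
exists (fun z => \sum_(q < n) (z^*)%C ^+ q * h' q z).
exists (fun z => \sum_(q < n.-1) (z^*)%C ^+ q * (q.+1%:R * h q.+1 z)); split.
- exists (fun q j => j.+1%:R * a q j.+1), h'; split => // q.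
  by have [] := Hh' q.
- exists (fun q j => q.+1%:R * a q.+1 j + 0), (fun q => q.+1%:R *: h q.+1 + 0); split.
    by move=> q; apply: entire_lin => //; exact: entire0.
  by apply/funext => z; apply: eq_bigr => q _; rewrite addr0.
- have W q : wirt (fun z => (z^*)%C ^+ q * h q z) (fun z => (z^*)%C ^+ q * h' q z)
     (fun z => q%:R * (z^*)%C ^+ q.-1 * h q z).
    have [_ Wh] := Hh' q; have := wirt_mul (wirt_conjX q) Wh; congr wirt; apply/funext => z.
      transitivity ((z^*)%C ^+ q * h' q z + 0 * h q z); [by []|by rewrite mul0r addr0].
    transitivity ((z^*)%C ^+ q * 0 + q%:R * (z^*)%C ^+ q.-1 * h q z); [by []|].
    by rewrite mulr0 add0r.
  have := wirt_sum n W; congr wirt; apply/funext => z.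
  case: n => [|n]; first by rewrite !big_ord0.
  rewrite big_ord_recl /= !mul0r add0r; apply: eq_bigr => q _.
  by rewrite /bump /= add1n; ring.
Qed.

Lemma polyentireW n f : polyentire n.-1 f -> polyentire n f.
Proof.
case: n => // n /= [a [h [E ->]]].
exists (fun q => if q == n then fun _ => 0 else a q), (fun q => if q == n then 0 else h q); split.
  by move=> q; case: ifP => _; [exact: entire0|exact: E].
apply/funext => z; rewrite big_ord_recr /= eqxx mulr0 addr0; apply: eq_bigr => q _.
by rewrite ltn_eqF.
Qed.

Lemma polyentire_smooth n f : polyentire n f -> smooth f.
Proof.
apply: smooth_of_wirt_closed; first exact: polyentire_submod_closed.
move=> g /polyentire_wirt[u [v [pu pv W]]]; exists u, v; split => //.
exact: polyentireW.
Qed.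

Lemma polyentire_nanalytic n f : polyentire n f -> nanalytic n f.
Proof.
move=> pf; split; first exact: polyentire_smooth pf.
elim: n f pf => [|n IH] f pf z.
  by case: pf => a [h [_ ->]] /=; rewrite big_ord0.
rewrite iterSr; apply: IH.
by have [u [v [_ pv /wirt_dbar ->]]] := polyentire_wirt pf.
Qed.

(** By induction [dbar f] has the required form; subtracting from [f] its evident
    antiderivative in the conjugate variable leaves an entire function. *)
Lemma nanalytic_polyentire n f : nanalytic n f -> polyentire n f.
Proof.
elim: n f => [|n IH] f [sf df].
  exists (fun _ _ => 0), (fun _ => 0); split; first by move=> q; exact: entire0.
  by apply/funext => z; rewrite big_ord0; exact: df.
have [a [h [E Eg]]] : polyentire n (dbar f).
  apply: IH; split; first exact: smooth_dbar.
  by move=> z; rewrite -iterSr.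
pose b q := if q is q'.+1 then fun j => q'.+1%:R^-1 * a q' j + 0 else fun _ : nat => 0 : C.
pose k q := if q is q'.+1 then q'.+1%:R^-1 *: h q' + 0 else 0 : C -> C.
have Eb q : entire (b q) (k q).
  case: q => [|q]; first exact: entire0.
  by apply: entire_lin; [exact: E|exact: entire0].
pose G z := \sum_(q < n.+1) (z^*)%C ^+ q * k q z.
have pG : polyentire n.+1 G by exists b, k.
have sG := polyentire_smooth pG.
have dG : dbar G = dbar f.
  have /choice[k' Hk'] q : exists k', entire (fun j => j.+1%:R * b q j.+1) k' /\
    wirt (k q) k' (cst 0) by exact: entire_deriv.
  have W q := wirt_mul (wirt_conjX q) (Hk' q).2.
  have := wirt_sum n.+1 W.
  rewrite (_ : (fun z => _) = G); last by apply/funext.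
  move=> /wirt_dbar ->; rewrite Eg; apply/funext => z.
  transitivity (\sum_(q < n.+1) ((z^*)%C ^+ q * 0 + q%:R * (z^*)%C ^+ q.-1 * k q z)) => //.
  rewrite big_ord_recl /= !mul0r mulr0 addr0 add0r; apply: eq_bigr => q _.
  transitivity ((z^*)%C ^+ (bump 0 q) * 0 + (bump 0 q)%:R * (z^*)%C ^+ (bump 0 q).-1 *
      (q.+1%:R^-1 * h q z + 0)) => //.
  rewrite /bump /= add1n /= mulr0 add0r addr0 mulrA; congr (_ * _).
  by rewrite mulrC mulrA mulVf ?pnatr_eq0// mul1r.
have [e Ee] : exists e, entire e (-1 *: G + f).
  apply: holo_entire; first exact: smooth_lin.
  move=> z; have := iter_dbar_lin (-1) 1 sG sf; rewrite /= dG => ->.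
  transitivity (-1 * dbar f z + dbar f z); [by []|by rewrite mulN1r addNr].
exists (fun q => if q == 0%N then e else b q), (fun q => if q == 0%N then -1 *: G + f else k q).
split; first by case => [|q] /=; [exact: Ee|exact: (Eb q.+1)].
apply/funext => z; rewrite big_ord_recl /= expr0 mul1r.
transitivity (-1 * G z + f z + (G z)); first by rewrite mulN1r addrAC addNr add0r.
congr (_ + _); rewrite /G big_ord_recl /= mulr0 add0r.
by apply: eq_bigr => q _.
Qed.

End Structure.

(** * Rotations and moments of the Gaussian measure *)

Section GaussianMeasure.
Context {R : realType}.
Local Notation C := R[i].
Local Notation plane := (measurableTypeR R * measurableTypeR R)%type.
Local Notation mu := (@lebesgue_measure R).
Local Notation leb2 := (@lebesgue_measure R \x @lebesgue_measure R)%E.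
Local Open Scope ereal_scope.

Import HBNNSimple.

Lemma integral_gauss_nnsfun (f : {nnsfun plane >-> R}) :
  \int[gauss]_p (f p)%:E = \int[leb2]_p ((f p)%:E * (gauss_pdf p)%:E).
Proof.
have mpdf : measurable_fun setT (fun p : plane => (gauss_pdf p)%:E).
  by apply/measurable_EFinP; exact: measurable_gauss_pdf.
have pdf0 (p : plane) : 0 <= (gauss_pdf p)%:E by rewrite lee_fin gauss_pdf_ge0.
under [LHS]eq_integral do rewrite fimfunE -fsumEFin//.
rewrite [LHS]ge0_integral_fsum//; last 2 first.
  - by move=> r; exact/measurable_EFinP/measurableT_comp.
  - by move=> n x _; rewrite EFinM nnfun_muleindic_ge0.
under [RHS]eq_integral.
  move=> x xD; rewrite fimfunE -fsumEFin// muleC ge0_mule_fsumr; last first.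
    by move=> r; rewrite EFinM nnfun_muleindic_ge0.
  over.
rewrite [RHS]ge0_integral_fsum//; last 2 first.
  - move=> r; apply: emeasurable_funM => //.
    by apply/measurable_EFinP; exact/measurableT_comp.
  - by move=> n x _; apply: mule_ge0 => //; rewrite EFinM nnfun_muleindic_ge0.
apply: eq_fsbigr => r rf.
have r0 : (0 <= r)%R by have := rf; rewrite inE /= => -[x _ <-].
rewrite integralZl_indic_nnsfun//= integral_indic//= setIT.
have mfr : measurable (f @^-1` [set r]) by [].
transitivity (\int[leb2]_x (r%:E * ((\1_(f @^-1` [set r]) x)%:E * (gauss_pdf x)%:E))); last first.
  by apply: eq_integral => x _; rewrite (EFinM r) [RHS]muleC muleA.
rewrite ge0_integralZl//; last 2 first.
  - by apply: emeasurable_funM => //; apply/measurable_EFinP; exact: measurable_indic.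
  - by move=> x _; rewrite mule_ge0// lee_fin.
congr (_ * _); rewrite /gauss [LHS]integral_mkcond; apply: eq_integral => x _.
rewrite patchE indicE; case: ifPn => xf.
  by rewrite mul1e.
by rewrite mul0e.
Qed.

(** The measure is defined through its values on sets, so densities enter integrals
    by way of simple functions and monotone convergence. *)
Lemma integral_gauss (f : plane -> \bar R) : measurable_fun setT f ->
  (forall p, 0 <= f p) ->
  \int[gauss]_p f p = \int[leb2]_p (f p * (gauss_pdf p)%:E).
Proof.
move=> mf f0; have mpdf : measurable_fun setT (fun p : plane => (gauss_pdf p)%:E).
  by apply/measurable_EFinP; exact: measurable_gauss_pdf.
have pdf0 (p : plane) : 0 <= (gauss_pdf p)%:E by rewrite lee_fin gauss_pdf_ge0.
pose f_ := nnsfun_approx measurableT mf.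
transitivity (lim (\int[@gauss R]_p (f_ n p)%:E @[n --> \oo])).
  rewrite -monotone_convergence//=.
  - apply: eq_integral => ? /[!inE] xD; apply/esym/cvg_lim => //=.
    exact: cvg_nnsfun_approx.
  - by move=> n; exact/measurable_EFinP/measurable_funTS.
  - by move=> n ? _; rewrite lee_fin.
  - by move=> ? _ ? ? mn; rewrite lee_fin; exact/lefP/nd_nnsfun_approx.
under eq_fun do rewrite integral_gauss_nnsfun.
rewrite -monotone_convergence//=.
- apply: eq_integral => x _; apply/cvg_lim => //=.
  by apply: cvgeMr => //; exact: cvg_nnsfun_approx.
- by move=> n; apply: emeasurable_funM => //; exact/measurable_EFinP/measurable_funTS.
- by move=> n x _; rewrite mule_ge0// lee_fin.
- move=> x _ a b ab; rewrite lee_wpmul2r// lee_fin; exact/lefP/nd_nnsfun_approx.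
Qed.

Lemma lebesgue_measure_translation (t : R) (A : set R) : measurable A ->
  pushforward mu ((fun x => x + t)%R : _ -> measurableTypeR R) A = mu A.
Proof.
move=> mA.
have mt : measurable_fun setT ((fun x => x + t)%R : measurableTypeR R -> measurableTypeR R).
  exact: measurable_funD.
apply/esym/(lebesgue_measure_unique (mu := pushforward mu _)) => //= _ [[a b]] _ <-.
rewrite /pushforward.
have -> : (fun x => x + t)%R @^-1` [set` `]a, b] ] = `](a - t)%R, (b - t)%R]%classic.
  by apply/seteqP; split => x; rewrite /= !in_itv/= ltrBlDr lerBrDr.
rewrite !lebesgue_measure_itv/= !lte_fin ltrD2r.
by case: ifP => // _; rewrite -!EFinD; congr EFin; ring.
Qed.

Lemma integral_translation (t : R) (f : R -> \bar R) :
  measurable_fun [set: R] f -> (forall x, 0 <= f x) ->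
  \int[mu]_x f (x + t)%R = \int[mu]_x f x.
Proof.
move=> mf f0.
have mt : measurable_fun setT ((fun x => x + t)%R : measurableTypeR R -> measurableTypeR R).
  exact: measurable_funD.
rewrite [LHS](_ : _ = \int[pushforward mu ((fun x => x + t)%R : _ -> measurableTypeR R)]_x f x); last first.
  by rewrite ge0_integral_pushforward// preimage_setT.
by apply: eq_measure_integral => //= A mA AS; exact: lebesgue_measure_translation.
Qed.

Lemma integral_shear1 (t : R) (f : plane -> \bar R) : measurable_fun setT f ->
  (forall p, 0 <= f p) ->
  \int[leb2]_p f (p.1 + t * p.2, p.2)%R = \int[leb2]_p f p.
Proof.
move=> mf f0.
have ms : measurable_fun setT ((fun p => (p.1 + t * p.2, p.2))%R : plane -> plane).
  by apply: measurable_fun_pair => //; apply: measurable_funD => //; apply: measurable_funM.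
rewrite (fubini_tonelli2 (fun p : plane => f (p.1 + t * p.2, p.2)%R))//; last first.
  exact: measurableT_comp.
rewrite fubini_tonelli2//; apply: eq_integral => y _.
rewrite /fubini_G /=.
rewrite (integral_translation (t * y) (f := fun x => f (x, y)))//.
by apply: measurableT_comp => //; exact: measurable_pair2.
Qed.

Lemma integral_shear2 (t : R) (f : plane -> \bar R) : measurable_fun setT f ->
  (forall p, 0 <= f p) ->
  \int[leb2]_p f (p.1, p.2 + t * p.1)%R = \int[leb2]_p f p.
Proof.
move=> mf f0.
have ms : measurable_fun setT ((fun p => (p.1, p.2 + t * p.1))%R : plane -> plane).
  by apply: measurable_fun_pair => //; apply: measurable_funD => //; apply: measurable_funM.
rewrite (fubini_tonelli1 (fun p : plane => f (p.1, p.2 + t * p.1)%R))//; last first.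
  exact: measurableT_comp.
rewrite fubini_tonelli1//; apply: eq_integral => x _.
rewrite /fubini_F /=.
rewrite (integral_translation (t * x) (f := fun y => f (x, y)))//.
by apply: measurableT_comp => //; exact: measurable_pair1.
Qed.

Definition rotp (w : C) (p : R * R) : R * R := ofC (w * toC p)%R.

Lemma measurable_rotp (w : C) : measurable_fun setT (rotp w : plane -> plane).
Proof.
have e : rotp w = (fun p : plane => ((complex.Re w * p.1 - complex.Im w * p.2)%R,
    (complex.Re w * p.2 + complex.Im w * p.1)%R)).
  by apply/funext => p; rewrite /rotp /ofC Re_mul Im_mul.
rewrite e; apply: measurable_fun_pair.
  by apply: measurable_funB => //; apply: measurable_funM.
by apply: measurable_funD => //; apply: measurable_funM.
Qed.

(** A rotation of the plane is a product of three shears, and shears preserve the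
    Lebesgue measure by translation invariance on the lines. *)
Lemma integral_rotp (w : C) (f : plane -> \bar R) : normc w = 1%R ->
  measurable_fun setT f -> (forall p, 0 <= f p) ->
  \int[leb2]_p f (rotp w p) = \int[leb2]_p f p.
Proof.
have key (v : C) (g : plane -> \bar R) : normc v = 1%R -> complex.Im v != 0%R ->
  measurable_fun setT g -> (forall p, 0 <= g p) ->
  \int[leb2]_p g (rotp v p) = \int[leb2]_p g p.
  move=> v1; have := normc_sq v; rewrite v1 expr1n.
  case: v {v1} => c s /= cs s0 mg g0; pose a := ((c - 1) / s)%R.
  pose S1 (p : plane) : plane := ((p.1 + a * p.2)%R, p.2).
  pose S2 (p : plane) : plane := (p.1, (p.2 + s * p.1)%R).
  have mS1 : measurable_fun setT S1.
    by apply: measurable_fun_pair => //; apply: measurable_funD => //; apply: measurable_funM.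
  have mS2 : measurable_fun setT S2.
    by apply: measurable_fun_pair => //; apply: measurable_funD => //; apply: measurable_funM.
  have e p : rotp (c +i* s)%C p = S1 (S2 (S1 p)).
    case: p => x y; rewrite /rotp /ofC /S1 /S2 /=; congr pair; last first.
      by rewrite /a; field.
    have c2 : (s ^+ 2 = 1 - c ^+ 2)%R by rewrite cs; ring.
    apply: (mulfI s0); rewrite mulrBr !mulrDr /a.
    transitivity (s * c * x - s ^+ 2 * y)%R; first by ring.
    by rewrite c2; field.
  under eq_integral do rewrite e.
  rewrite (integral_shear1 a (f := g \o S1 \o S2)); last 2 first.
  - by apply: measurableT_comp => //; exact: measurableT_comp.
  - by move=> p; exact: g0.
  rewrite (integral_shear2 s (f := g \o S1)); last 2 first.
  - exact: measurableT_comp.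
  - by move=> p; exact: g0.
  by rewrite (integral_shear1 a (f := g)).
move=> w1 mf f0; have [w0|w0] := eqVneq (complex.Im w) 0%R; last exact: key.
(* real [w]: rotate by a quarter turn and by the remaining angle *)
have e p : f (rotp w p) = f (rotp (w * - 'i%C)%R (rotp 'i%C p)).
  by rewrite /rotp ofCK mulrA; congr (f (ofC (_ * _)%R)); rewrite -mulrA mulNr -expr2 sqr_i opprK mulr1.
under eq_integral do rewrite e.
rewrite (key 'i%C (f \o rotp (w * - 'i%C)%R)).
- rewrite key//.
    by rewrite normcM normc_opp w1 mul1r /= expr0n expr1n add0r sqrtr1.
  move: w0 w1; case: (w) => a b /= ->; rewrite expr0n addr0 sqrtr_sqr => a1.
  by rewrite mul0r addr0 mulrN1 oppr_eq0 -normr_eq0 a1 oner_neq0.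
- by rewrite /= expr0n expr1n add0r sqrtr1.
- by rewrite /= oner_eq0.
- by apply: measurableT_comp => //; exact: measurable_rotp.
- by move=> p; exact: f0.
Qed.

Lemma integral_gauss_rotp (w : C) (f : plane -> \bar R) : normc w = 1%R ->
  measurable_fun setT f -> (forall p, 0 <= f p) ->
  \int[gauss]_p f (rotp w p) = \int[gauss]_p f p.
Proof.
move=> w1 mf f0.
have mpdf : measurable_fun setT (fun p : plane => (gauss_pdf p)%:E).
  by apply/measurable_EFinP; exact: measurable_gauss_pdf.
rewrite !integral_gauss//; last first.
  by apply: measurableT_comp => //; exact: measurable_rotp.
rewrite -(integral_rotp w1 (f := fun p => f p * (gauss_pdf p)%:E)); last 2 first.
- exact: emeasurable_funM.
- by move=> p; rewrite mule_ge0// lee_fin gauss_pdf_ge0.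
apply: eq_integral => p _; congr (_ * _); congr (_%:E).
by rewrite /gauss_pdf /rotp ofCK normcM w1 mul1r.
Qed.

Lemma measurable_normc : measurable_fun setT (fun p : plane => normc (toC p)).
Proof.
have e : (fun p : plane => normc (toC p)) = (fun p : plane => (p.1 ^+ 2 + p.2 ^+ 2) `^ 2^-1)%R.
  by apply/funext => p; rewrite powR12_sqrt// addr_ge0 ?sqr_ge0.
rewrite e; apply: (measurableT_comp (measurable_powR 2^-1)).
by apply: measurable_funD; apply: measurable_funX.
Qed.

Lemma power_expR_le k (t : R) : (0 <= t)%R ->
  (t ^+ k * expR (- t) <= (2 * k%:R) ^+ k * expR (- t / 2))%R.
Proof.
case: k => [|k] t0; first by rewrite !expr0 !mul1r ler_expR; lra.
have k0 : (0 < 2 * k.+1%:R :> R)%R by rewrite mulr_gt0 ?ltr0n.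
have le : (t ^+ k.+1 <= (2 * k.+1%:R) ^+ k.+1 * expR (t / 2))%R.
  have -> : expR (t / 2) = (expR (t / (2 * k.+1%:R)) ^+ k.+1)%R.
    by rewrite -expRM_natl; congr expR; field.
  rewrite -exprMn lerXn2r ?nnegrE ?mulr_ge0 ?expR_ge0 ?(ltW k0)//.
  rewrite -ler_pdivrMl// mulrC; apply: le_trans (expR_ge1Dx _).
  by rewrite lerDr.
apply: (@le_trans _ _ ((2 * k.+1%:R) ^+ k.+1 * expR (t / 2) * expR (- t))%R).
  by rewrite ler_wpM2r// expR_ge0.
rewrite -mulrA -expRD le_eqVlt; apply/orP; left; apply/eqP; congr (_ * expR _)%R.
by field.
Qed.

(** The integrand times the Gaussian weight is dominated by a multiple of a product of
    two normal densities on the line. *)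
Lemma gauss_moment_fin k :
  \int[gauss]_p (normc (toC p : C) ^+ k.*2)%:E < +oo.
Proof.
have mk : measurable_fun setT (fun p : plane => (normc (toC p : C) ^+ k.*2)%:E).
  by apply/measurable_EFinP; apply: measurable_funX; exact: measurable_normc.
have mpdf : measurable_fun setT (fun p : plane => (gauss_pdf p)%:E).
  by apply/measurable_EFinP; exact: measurable_gauss_pdf.
rewrite integral_gauss//; last by move=> p; rewrite lee_fin exprn_ge0// normc_ge0.
pose c : R := (pi^-1 * (2 * k%:R) ^+ k)%R.
have c0 : (0 <= c)%R by rewrite mulr_ge0 ?invr_ge0 ?pi_ge0// exprn_ge0// mulr_ge0.
pose n1 : R -> R := normal_fun 0%R 1%R.
have mn1 : measurable_fun setT n1 by exact: measurable_normal_fun.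
have n10 x : (0 <= n1 x)%R by exact: expR_ge0.
have n1E x : n1 x = expR (- x ^+ 2 / 2)%R by rewrite /n1 /normal_fun subr0 expr1n mulr2n.
have mG : measurable_fun setT (fun p : plane => (c * (n1 p.1 * n1 p.2))%:E).
  apply/measurable_EFinP; apply: measurable_funM => //; apply: measurable_funM;
  exact: measurableT_comp.
apply: (@le_lt_trans _ _ (\int[leb2]_p (c * (n1 p.1 * n1 p.2))%:E)).
  apply: ge0_le_integral => //.
  - by move=> p _; rewrite mule_ge0// lee_fin ?gauss_pdf_ge0// exprn_ge0// normc_ge0.
  - exact: emeasurable_funM.
  - move=> p _; rewrite -EFinM lee_fin /gauss_pdf mulrCA /c -[leRHS]mulrA.
    rewrite ler_wpM2l ?invr_ge0 ?pi_ge0// -mul2n exprM.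
    apply: le_trans (power_expR_le k (sqr_ge0 _)) _.
    rewrite !n1E -expRD ler_wpM2l ?exprn_ge0 ?mulr_ge0// ler_expR normc_sq /=.
    by rewrite le_eqVlt; apply/orP; left; apply/eqP; field.
rewrite fubini_tonelli1//; last first.
  by move=> p; rewrite lee_fin mulr_ge0// mulr_ge0.
rewrite /fubini_F /=.
have In : \int[mu]_x (n1 x)%:E < +oo.
  pose P : R := normal_peak 1.
  have P0 : (0 < P)%R by exact: normal_peak_gt0.
  have e x : (n1 x)%:E = (P^-1)%:E * (normal_pdf 0%R 1%R x)%:E.
    rewrite -EFinM normal_pdfE ?oner_neq0//; congr EFin.
    by rewrite -[X in _ = (_ * X)%R]/(P * n1 x)%R mulKf// gt_eqF.
  under eq_integral do rewrite e.
  rewrite ge0_integralZl// ?integral_normal_pdf ?mule1 ?ltry//.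
  - by apply/measurable_EFinP; exact: measurable_normal_pdf.
  - by move=> x _; rewrite lee_fin normal_pdf_ge0.
  - by rewrite lee_fin invr_ge0 ltW.
have In0 : 0 <= \int[mu]_x (n1 x)%:E by apply: integral_ge0 => x _; rewrite lee_fin.
have /fineK Inf : \int[mu]_x (n1 x)%:E \is a fin_num by rewrite ge0_fin_numE.
under eq_integral => x _.
  have -> : \int[mu]_y (c * (n1 x * n1 y))%:E = (c * n1 x)%:E * \int[mu]_y (n1 y)%:E.
    rewrite -ge0_integralZl//; last 3 first.
    - by apply/measurable_EFinP.
    - by move=> y _; rewrite lee_fin.
    - by rewrite lee_fin mulr_ge0.
    by apply: eq_integral => y _; rewrite -EFinM mulrA.
  rewrite -Inf -EFinM mulrAC EFinM.
  over.
rewrite ge0_integralZl//; last 3 first.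
- by apply/measurable_EFinP.
- by move=> x _; rewrite lee_fin.
- by rewrite lee_fin mulr_ge0// fine_ge0.
by rewrite -Inf -EFinM ltry.
Qed.

End GaussianMeasure.

(** * Orthogonal expansions into homogeneous components *)

Section SquareNorm.
Context {R : realType}.
Local Notation C := R[i].
Local Notation plane := (measurableTypeR R * measurableTypeR R)%type.
Implicit Types (f : C -> C) (g : nat -> C -> C).

Definition cmeas f := measurable_fun setT (rePart f : plane -> R) /\
  measurable_fun setT (imPart f : plane -> R).

(** With values in the extended reals the squared norm needs no integrability. *)
Definition sqnorm f : \bar R := (\int[@gauss R]_p (normc (f (toC p)) ^+ 2)%:E)%E.

Lemma cmeas_lin c (f h : C -> C) : cmeas f -> cmeas h -> cmeas (c *: f + h).
Proof.
move=> [f1 f2] [h1 h2]; split.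
  rewrite rePart_lin; apply: measurable_funD => //.
  by apply: measurable_funB => //; apply: measurable_funM.
rewrite imPart_lin; apply: measurable_funD => //.
by apply: measurable_funD => //; apply: measurable_funM.
Qed.

Lemma cmeas0 : cmeas (0 : C -> C).
Proof. by split; exact: measurable_cst. Qed.

Lemma cmeas_sum n g : (forall k, cmeas (g k)) -> cmeas (fun z => \sum_(k < n) g k z).
Proof.
move=> mg; elim: n => [|n IH].
  by under eq_fun do rewrite big_ord0; exact: cmeas0.
under eq_fun do rewrite big_ord_recr /=.
have := cmeas_lin 1 IH (mg n); rewrite scale1r; congr cmeas.
Qed.

Lemma cmeas_rot (w : C) f : cmeas f -> cmeas (fun z => f (w * z)).
Proof.
move=> [f1 f2].
have e1 : rePart (fun z => f (w * z)) = rePart f \o rotp w.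
  by apply/funext => p; rewrite /rePart /rotp /= ofCK.
have e2 : imPart (fun z => f (w * z)) = imPart f \o rotp w.
  by apply/funext => p; rewrite /imPart /rotp /= ofCK.
by split; rewrite ?e1 ?e2; apply: measurableT_comp => //; exact: measurable_rotp.
Qed.

Lemma cmeasZ c f : cmeas f -> cmeas (fun z => c * f z).
Proof.
move=> mf; have := cmeas_lin c mf cmeas0; rewrite addr0; congr cmeas.
Qed.

Lemma measurable_normc_sq f : cmeas f ->
  measurable_fun setT (fun p : plane => normc (f (toC p)) ^+ 2).
Proof.
by move=> [f1 f2]; apply: measurable_funX; exact: measurable_absPart.
Qed.

Lemma sqnorm_ge0 f : (0 <= sqnorm f)%E.
Proof. by apply: integral_ge0 => p _; rewrite lee_fin sqr_ge0. Qed.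

Lemma sqnorm_rot (w : C) f : normc w = 1 -> cmeas f ->
  sqnorm (fun z => f (w * z)) = sqnorm f.
Proof.
move=> w1 mf; rewrite /sqnorm.
rewrite -(integral_gauss_rotp w1 (f := fun p : plane => (normc (f (toC p)) ^+ 2)%:E)).
- by apply: eq_integral => p _; rewrite /rotp ofCK.
- by apply/measurable_EFinP; exact: measurable_normc_sq.
- by move=> p; rewrite lee_fin sqr_ge0.
Qed.

Lemma sqnormZ c f : cmeas f -> sqnorm (c *: f) = ((normc c ^+ 2)%:E * sqnorm f)%E.
Proof.
move=> mf; rewrite /sqnorm -ge0_integralZl//.
- by apply: eq_integral => p _; rewrite -EFinM -exprMn -normcM.
- by apply/measurable_EFinP; exact: measurable_normc_sq.
- by move=> p _; rewrite lee_fin sqr_ge0.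
- by rewrite lee_fin sqr_ge0.
Qed.

Lemma sume_const_ord N (x : \bar R) : (\sum_(l < N) x = N%:R%:E * x)%E.
Proof.
elim: N => [|N IH]; first by rewrite big_ord0 mul0e.
by rewrite big_ord_recr/= IH -natr1 EFinD ge0_muleDl// mul1e.
Qed.

(** Inside the integral on the left stands the average over an orbit of the finite
    rotation group, to which [dft_parseval] applies pointwise. *)
Lemma sqnorm_average N f : (0 < N)%N -> cmeas f ->
  (\int[@gauss R]_p (N%:R^-1 * \sum_(l < N) normc (f (root1 N ^+ l * toC p)) ^+ 2)%:E)%E
  = sqnorm f.
Proof.
move=> N0 mf; have N0' : 0 < N%:R :> R by rewrite ltr0n.
have m l : measurable_fun setT (fun p : plane => (normc (f (root1 N ^+ l * toC p)) ^+ 2)%:E).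
  apply/measurable_EFinP; apply: (measurable_normc_sq (f := fun z => f (root1 N ^+ l * z))).
  exact: cmeas_rot.
under eq_integral do rewrite EFinM -sumEFin.
rewrite ge0_integralZl//; last 2 first.
- by apply: emeasurable_sum => l.
- by move=> p _; apply: sume_ge0 => l _; rewrite lee_fin sqr_ge0.
rewrite ge0_integral_sum//; last by move=> l p _; rewrite lee_fin sqr_ge0.
rewrite (eq_bigr (fun=> sqnorm f)); last first.
  by move=> l _; rewrite -(sqnorm_rot (root1_norm N l) mf).
have -> : (\sum_(l < N) sqnorm f = N%:R%:E * sqnorm f)%E.
  by rewrite sume_const_ord.
by rewrite muleA -EFinM mulVf ?mul1e// gt_eqF.
Qed.

Lemma fatou_real (h : nat -> plane -> R) (h' : plane -> R) (B : \bar R) :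
  (forall N, measurable_fun setT (h N)) -> (forall N p, 0 <= h N p) ->
  (forall p, h ^~ p @ \oo --> h' p) ->
  (forall N, (\int[@gauss R]_p (h N p)%:E <= B)%E) ->
  (\int[@gauss R]_p (h' p)%:E <= B)%E.
Proof.
move=> mh h0 hh' hB.
have -> : (\int[@gauss R]_p (h' p)%:E =
    \int[@gauss R]_p limn_einf (fun N => (h N p)%:E))%E.
  apply: eq_integral => p _; apply/esym.
  have c : (fun N => (h N p)%:E) @ \oo --> (h' p)%:E.
    by apply: cvg_EFin => //; [exact: nearW|exact: hh'].
  by rewrite is_cvg_limn_einfE ?(cvg_lim _ c)//; apply/cvg_ex; eexists; exact: c.
have mh' N : measurable_fun setT (fun p : plane => (h N p)%:E) by apply/measurable_EFinP.
have h0' N (p : plane) : setT p -> (0 <= (h N p)%:E)%E by rewrite lee_fin.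
apply: (le_trans (fatou (@gauss R) measurableT mh' h0')).
rewrite limn_einf_lim; apply: lime_le; first exact: is_cvg_einfs.
apply: nearW => n; apply: ge_ereal_inf; exists (\int[@gauss R]_p (h n p)%:E)%E => //.
by exists n => //=.
Qed.

Lemma cvg_of_geometric (u : nat -> R) (l M : R) (k : nat) :
  (forall N, (k < N)%N -> `|u N - l| <= M / 2 ^+ N) -> u @ \oo --> l.
Proof.
move=> H; apply/(@cvgrPdist_le _ R^o) => e e0.
have c : (fun N => M / 2 ^+ N) @ \oo --> (0 : R).
  rewrite -[0](mulr0 M); apply: cvgM; first exact: cvg_cst.
  have := @cvg_expr R 2^-1; rewrite ger0_norm ?invr_ge0//.
  by under [in X in _ -> X]eq_fun do rewrite -exprVn; apply; lra.
near=> N; rewrite distrC; apply: (@le_trans _ _ (M / 2 ^+ N)).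
  by apply: H; near: N; exact: nbhs_infty_gt.
apply: le_trans (ler_norm _) _.
by near: N; move/cvgr0_norm_le: c; exact.
Unshelve. all: by end_near. Qed.

Lemma ler_dist_normc (z w : C) : `|normc z - normc w| <= normc (z - w).
Proof.
have D (a b : C) : normc a - normc b <= normc (a - b).
  by rewrite lerBlDr -{1}[a](subrK b) normcD.
by rewrite ler_norml lerNl opprB D -[normc (z - w)]normc_opp opprB D.
Qed.

Lemma cvg_normc_sq (u : nat -> C) (l : C) (M : R) (k : nat) :
  (forall N, (k < N)%N -> normc (u N - l) <= M / 2 ^+ N) ->
  (fun N => normc (u N) ^+ 2) @ \oo --> normc l ^+ 2.
Proof.
move=> H; have c : (fun N => normc (u N)) @ \oo --> normc l.
  apply: (@cvg_of_geometric _ _ M k) => N kN.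
  exact: le_trans (ler_dist_normc _ _) (H N kN).
by rewrite expr2; under eq_fun do rewrite expr2; exact: cvgM.
Qed.

End SquareNorm.

Section Expansion.
Context {R : realType}.
Local Notation C := R[i].
Local Notation plane := (measurableTypeR R * measurableTypeR R)%type.
Variable m : nat.
Implicit Types (f : C -> C) (g : nat -> C -> C).

(** Homogeneity of degree [k - m] under rotations, since [w^*] is the inverse of
    [w].  The shift by [m] makes natural numbers of the degrees that occur below. *)
Definition homog (k : nat) f := forall w z : C, normc w = 1 ->
  f (w * z) = w ^+ k * (w^*)%C ^+ m * f z.

(** The Fourier expansion of [f] with respect to rotations. *)
Definition expands f g :=
  [/\ geom_sum g f, forall k, homog k (g k) & forall k, cmeas (g k)].

Lemma expands_cmeas f g : expands f g -> cmeas f.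
Proof.
move=> [G _ mg].
have mS N := cmeas_sum N mg.
have cv z : exists M, forall N, normc (\sum_(k < N) g k z - f z) <= M / 2 ^+ N.
  have [M HM] := G (normc z); exists M => N.
  by rewrite -normc_opp opprB; exact: HM.
split.
  apply: (@measurable_fun_cvg _ _ _ _ (fun N => rePart (fun z => \sum_(k < N) g k z))).
    by move=> N; have [] := mS N.
  move=> p _; have [M HM] := cv (toC p).
  apply: (@cvg_of_geometric _ _ _ M 0) => N _.
  by rewrite /rePart -ReB; exact: le_trans (ler_norm_Re _) (HM N).
apply: (@measurable_fun_cvg _ _ _ _ (fun N => imPart (fun z => \sum_(k < N) g k z))).
  by move=> N; have [] := mS N.
move=> p _; have [M HM] := cv (toC p).
apply: (@cvg_of_geometric _ _ _ M 0) => N _.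
by rewrite /imPart -ImB; exact: le_trans (ler_norm_Im _) (HM N).
Qed.

(** The component of degree [k] of a function, approximated by an average over the
    rotations by the [N]-th roots of unity. *)
Definition avg N k f z : C :=
  dft N (fun l => (root1 N ^+ l) ^+ m * f (root1 N ^+ l * z)) k.

Lemma conj_unitX (w : C) : normc w = 1 -> w ^+ m * (w^*)%C ^+ m = 1.
Proof. by move=> w1; rewrite -exprMn conj_unit ?expr1n. Qed.

(** The average sees only the degrees congruent to [k] modulo [N], and the tail of the
    expansion from [N] on is geometrically small. *)
Lemma avg_close f g z : expands f g -> exists M, forall k N, (k < N)%N ->
  normc (avg N k f z - g k z) <= M / 2 ^+ N.
Proof.
move=> [G H _]; have [M HM] := G (normc z); exists M => k N kN.
apply: (dft_close (G := fun k => g k z)) => // l; have w1 := @root1_norm R N l.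
set w := root1 N ^+ l in w1 *.
have -> : w ^+ m * f (w * z) - \sum_(i < N) w ^+ i * g i z =
    w ^+ m * (f (w * z) - \sum_(i < N) g i (w * z)).
  rewrite mulrBr mulr_sumr; congr (_ - _); apply: eq_bigr => i _.
  by rewrite H// mulrA mulrCA conj_unitX// mulr1.
by rewrite normcM normcX w1 expr1n mul1r HM// normcM w1 mul1r.
Qed.

(** The averages of [f] converge to the components of any expansion. *)
Lemma expands_uniq f g g' : expands f g -> expands f g' -> g = g'.
Proof.
move=> E E'; apply/funext => k; apply/funext => z.
have [M HM] := avg_close z E; have [M' HM'] := avg_close z E'.
apply/eqP; rewrite -subr_eq0 -normc_eq0 eq_le normc_ge0 andbT.
apply: (@ler_of_geometric _ _ 0 (M + M')) => N; rewrite add0r.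
have kN : (k < N + k.+1)%N by rewrite ltn_addl.
have H := le_trans (normc_dist_le _ _ _) (lerD (HM k _ kN) (HM' k _ kN)).
have MM : 0 <= M + M'.
  have := le_trans (normc_ge0 _) H.
  by rewrite -mulrDl pmulr_lge0// invr_gt0 exprn_gt0.
apply: le_trans H _; rewrite -mulrDl ler_wpM2l// lef_pV2 ?posrE ?exprn_gt0//.
by rewrite ler_weXn2l ?leq_addr//; lra.
Qed.

Lemma expands_eq f f' g : expands f g -> expands f' g -> f = f'.
Proof. by move=> [G _ _] [G' _ _]; exact: geom_sum_uniq G G'. Qed.

(** Orthogonality of the components: Parseval's identity on each orbit of the group of
    roots of unity, integrated. *)
Lemma sqnorm_partial_sum g K : (forall k, homog k (g k)) -> (forall k, cmeas (g k)) ->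
  sqnorm (fun z => \sum_(k < K) g k z) = (\sum_(k < K) sqnorm (g k))%E.
Proof.
move=> H mg; case: K => [|K].
  rewrite big_ord0 /sqnorm; under eq_integral do rewrite big_ord0 normc0 expr0n.
  exact: integral0.
have mS := cmeas_sum K.+1 mg.
rewrite -(sqnorm_average (ltn0Sn K) mS) -ge0_integral_sum//; last first.
- by move=> k p _; rewrite lee_fin sqr_ge0.
- by move=> k; apply/measurable_EFinP; exact: measurable_normc_sq.
apply: eq_integral => p _; rewrite sumEFin; congr EFin.
pose F l := (root1 K.+1 ^+ l) ^+ m * (\sum_(k < K.+1) g k (root1 K.+1 ^+ l * toC p)).
transitivity (K.+1%:R^-1 * \sum_(l < K.+1) normc (F l) ^+ 2).
  congr (_ * _); apply: eq_bigr => l _.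
  by rewrite /F normcM normcX root1_norm expr1n mul1r.
rewrite -dft_parseval//; apply: eq_bigr => k _; congr (normc _ ^+ 2).
apply: (dft_trig (G := fun k => g k (toC p))) => // l; rewrite /F mulr_sumr.
apply: eq_bigr => i _; have w1 := @root1_norm R K.+1 l.
by rewrite H// mulrA mulrCA conj_unitX// mulr1.
Qed.

Lemma cmeas_dft N (F : nat -> C -> C) k : (forall l, cmeas (F l)) ->
  cmeas (fun z => dft N (fun l => F l z) k).
Proof.
move=> mF; rewrite /dft; apply: cmeasZ; apply: (@cmeas_sum _ N
  (fun l z => ((root1 N ^+ l)^*)%C ^+ k * F l z)) => l.
exact: cmeasZ.
Qed.

Lemma cmeas_avg N k f : cmeas f -> cmeas (avg N k f).
Proof.
move=> mf; apply: (@cmeas_dft N (fun l z => (root1 N ^+ l) ^+ m * f (root1 N ^+ l * z)) k).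
by move=> l; apply: cmeasZ; exact: cmeas_rot.
Qed.

Lemma cvg_sum_ord K (u : nat -> nat -> R) (l : nat -> R) :
  (forall k, (k < K)%N -> u k @ \oo --> l k) ->
  (fun N => \sum_(k < K) u k N) @ \oo --> \sum_(k < K) l k.
Proof.
elim: K => [|K IH] H.
  by rewrite big_ord0; under eq_fun do rewrite big_ord0; exact: cvg_cst.
rewrite big_ord_recr; under eq_fun do rewrite big_ord_recr.
apply: cvgD; last exact: H.
by apply: IH => k kK; apply: H; rewrite ltnW.
Qed.

(** Bessel's inequality, by the finite Parseval identity and Fatou's lemma. *)
Lemma bessel f g K : expands f g -> (\sum_(k < K) sqnorm (g k) <= sqnorm f)%E.
Proof.
move=> E; have mf := expands_cmeas E; have [_ _ mg] := E.
rewrite -ge0_integral_sum//; last first.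
- by move=> k p _; rewrite lee_fin sqr_ge0.
- by move=> k; apply/measurable_EFinP; exact: measurable_normc_sq.
under eq_integral do rewrite sumEFin.
pose h N (p : plane) := \sum_(k < K) normc (avg (N + K).+1 k f (toC p)) ^+ 2.
apply: (@fatou_real _ h) => [N|N p|p|N].
- apply: measurable_sum => k; apply: measurable_normc_sq.
  exact: cmeas_avg.
- by apply: sumr_ge0 => k _; rewrite sqr_ge0.
- have [M HM] := avg_close (toC p) E.
  apply: (@cvg_sum_ord K (fun k N => normc (avg (N + K).+1 k f (toC p)) ^+ 2)
    (fun k => normc (g k (toC p)) ^+ 2)) => k _.
  have := @cvg_normc_sq _ (fun N => avg N k f (toC p)) (g k (toC p)) M k (HM k).
  by rewrite -(cvg_shiftn K.+1); under eq_fun do rewrite addnS.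
- rewrite -(sqnorm_average (ltn0Sn (N + K)) mf).
  have N0 : 0 <= (N + K).+1%:R^-1 :> R by rewrite invr_ge0.
  apply: ge0_le_integral => //.
  + by move=> p _; rewrite lee_fin; apply: sumr_ge0 => k _; rewrite sqr_ge0.
  + apply/measurable_EFinP; apply: measurable_sum => k; apply: measurable_normc_sq.
    exact: cmeas_avg.
  + apply/measurable_EFinP; apply: measurable_funM => //; apply: measurable_sum => l.
    apply: (measurable_normc_sq (f := fun z => f (root1 (N + K).+1 ^+ l * z))).
    exact: cmeas_rot.
  move=> p _; rewrite lee_fin.
  pose F l := (root1 (N + K).+1 ^+ l) ^+ m * f (root1 (N + K).+1 ^+ l * toC p).
  have -> : (N + K).+1%:R^-1 * \sum_(l < (N + K).+1) normc (f (root1 (N + K).+1 ^+ l * toC p)) ^+ 2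
    = (N + K).+1%:R^-1 * \sum_(l < (N + K).+1) normc (F l) ^+ 2.
    congr (_ * _); apply: eq_bigr => l _.
    by rewrite /F normcM normcX root1_norm expr1n mul1r.
  rewrite -dft_parseval// /h /avg -/F.
  have KN : (K <= (N + K).+1)%N by rewrite leqW// leq_addl.
  rewrite (big_ord_widen _ (fun k => normc (dft (N + K).+1 F k) ^+ 2) KN).
  by rewrite big_mkcond; apply: ler_sum => k _; case: ifP => // _; rewrite sqr_ge0.
Qed.

(** The inequality converse to [bessel], by Fatou's lemma along the partial sums. *)
Lemma sqnorm_expands_le f g B : expands f g ->
  (forall K, (\sum_(k < K) sqnorm (g k) <= B)%E) -> (sqnorm f <= B)%E.
Proof.
move=> E HB; have [G H mg] := E.
apply: (@fatou_real _ (fun N (p : plane) => normc (\sum_(k < N) g k (toC p)) ^+ 2)).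
- move=> N; apply: (measurable_normc_sq (f := fun z => \sum_(k < N) g k z)).
  exact: cmeas_sum.
- by move=> N p; rewrite sqr_ge0.
- move=> p; have [M HM] := G (normc (toC p)).
  apply: (@cvg_normc_sq _ (fun N => \sum_(k < N) g k (toC p)) _ M 0) => N _.
  by rewrite -normc_opp opprB; exact: HM.
- by move=> N; have := HB N; rewrite -sqnorm_partial_sum.
Qed.

Lemma expands_lin (c : C) f f' g g' : expands f g -> expands f' g' ->
  expands (c *: f + f') (fun k => c *: g k + g' k).
Proof.
move=> [G H mg] [G' H' mg']; split.
- exact: geom_sum_lin.
- move=> k w z w1.
  transitivity (c * g k (w * z) + g' k (w * z)) => //.
  rewrite H// H'//.
  transitivity (w ^+ k * w^*%C ^+ m * (c * g k z + g' k z)); [by ring|by []].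
- by move=> k; exact: cmeas_lin.
Qed.

Lemma expands0 : expands 0 (fun _ => 0).
Proof.
split.
- move=> rho; exists 0 => z _ N; rewrite big1// subrr normc0 mul0r//.
- by move=> k w z _; rewrite mulr0.
- by move=> k; exact: cmeas0.
Qed.

Lemma expands_single k f : homog k f -> cmeas f ->
  (forall rho : R, exists M, forall z, normc z <= rho -> normc (f z) <= M) ->
  expands f (fun j => if j == k then f else 0).
Proof.
move=> H mf bf; split.
- move=> rho; have [M HM] := bf rho; exists (`|M| * 2 ^+ k) => z zr N.
  have [kN|Nk] := ltnP k N.
    rewrite (bigD1 (Ordinal kN))//= eqxx big1 ?addr0 ?subrr ?normc0; last first.
      by move=> i; rewrite -val_eqE /= => /negPf ->.
    by rewrite mulr_ge0 ?invr_ge0 ?exprn_ge0// mulr_ge0// exprn_ge0.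
  rewrite big1 ?subr0; last first.
    by move=> i _; rewrite ltn_eqF// (leq_trans (ltn_ord i)).
  apply: le_trans (HM z zr) _; apply: le_trans (ler_norm _) _.
  by rewrite -mulrA ler_peMr// ler_pdivlMr ?exprn_gt0// mul1r ler_weXn2l//; lra.
- move=> j; case: eqP => [->//|_] w z w1; by rewrite mulr0.
- by move=> j; case: ifP => // _; exact: cmeas0.
Qed.

Lemma expands_drop f g K : expands f g ->
  expands (fun z => f z - \sum_(k < K) g k z) (fun k => if (k < K)%N then 0 else g k).
Proof.
move=> [G H mg]; split.
- move=> rho; have [M HM] := G rho; have [M1 M10 HM1] := geom_sum_term G rho.
  exists (`|M| * 2 ^+ K) => z zr N.
  have [NK|KN] := leqP N K.
    rewrite [X in _ - X]big1 ?subr0; last by move=> i _; have -> : (i < K)%N by rewrite (leq_trans (ltn_ord i)).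
    apply: le_trans (HM z zr K) _.
    have p2 k : 0 < (2 ^+ k)^-1 :> R by rewrite invr_gt0 exprn_gt0.
    apply: (@le_trans _ _ `|M|).
      apply: le_trans (_ : `|M| / 2 ^+ K <= _).
        by rewrite ler_wpM2r ?ler_norm ?ltW.
      by rewrite ler_pdivrMr ?exprn_gt0// ler_peMr// exprn_ege1//; lra.
    by rewrite -mulrA ler_peMr// ler_pdivlMr ?exprn_gt0// mul1r ler_weXn2l//; lra.
  rewrite (_ : f z - _ - _ = f z - \sum_(k < N) g k z).
    apply: le_trans (HM z zr N) _; rewrite ler_wpM2r ?invr_ge0 ?exprn_ge0//.
    by apply: le_trans (ler_norm _) _; rewrite ler_peMr// exprn_ege1//; lra.
  rewrite -addrA -opprD; congr (_ - _).
  rewrite -(big_mkord xpredT (fun k => g k z)) -(big_mkord xpredT (fun k => (if (k < K)%N then 0 else g k) z)).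
  rewrite [X in _ + X](big_cat_nat (n := K)) ?(ltnW KN)//=.
  rewrite [X in _ + (X + _)]big_nat [X in _ + (X + _)]big1 ?add0r; last by move=> i /andP[_ ->].
  rewrite -(big_mkord xpredT (fun k => g k z)) [RHS](big_cat_nat (n := K)) ?(ltnW KN)//=.
  congr (_ + _); rewrite big_nat [RHS]big_nat; apply: eq_bigr => i /andP[Ki _].
  by rewrite ltnNge Ki.
- by move=> k; case: ifP => _; [move=> w z _; rewrite mulr0|exact: H].
- by move=> k; case: ifP => _; [exact: cmeas0|exact: mg].
Qed.

End Expansion.

(** * The diagonal subspaces *)

Lemma submod_comb (K : nzRingType) (V : lmodType K) (X : set V) n (c : 'I_n -> K)
    (f : 'I_n -> V) :
  submod_closed [in X] -> (forall i, X (f i)) -> X (\sum_(i < n) c i *: f i).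
Proof.
move=> [X0 XD] Xf; apply: (big_ind X); first exact: set_mem X0.
  by move=> x y Xx Xy; rewrite -[x]scale1r; apply: set_mem; apply: XD; exact/mem_set.
by move=> i _; rewrite -[_ *: _]addr0; apply: set_mem; apply: XD => //; exact/mem_set.
Qed.

Section NormLink.
Context {R : realType}.
Local Notation C := R[i].
Local Notation plane := (measurableTypeR R * measurableTypeR R)%type.
Implicit Types (f h : C -> C).

Lemma Lnorm_sqnorm f :
  ('N[@gauss R]_2%:E[EFin \o (absPart f : plane -> R)] = sqnorm f `^ 2^-1)%E.
Proof.
rewrite unlock /Lnorm /sqnorm; congr (_ `^ _)%E; apply: eq_integral => p _ /=.
by rewrite ger0_norm ?normc_ge0// powR_mulrn ?normc_ge0.
Qed.

Lemma L2P f : L2 f <-> cmeas f /\ (sqnorm f < +oo)%E.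
Proof.
have e : finite_norm gauss 2%:E (absPart f : plane -> R) <-> (sqnorm f < +oo)%E.
  rewrite /finite_norm Lnorm_sqnorm; have := sqnorm_ge0 f.
  by case: (sqnorm f) => [r| |] // _; rewrite ?poweR_EFin ?poweRyr ?invr_eq0 ?ltry.
by split=> [[m1 m2 /e]|[[m1 m2] /e]].
Qed.

Lemma L2normE f : L2norm f = Num.sqrt (fine (sqnorm f)).
Proof.
rewrite /L2norm Lnorm_sqnorm; have := sqnorm_ge0 f.
case: (sqnorm f) => [r| |] // r0; first by rewrite poweR_EFin /= powR12_sqrt.
by rewrite poweRyr ?invr_eq0//= sqrtr0.
Qed.

Lemma L2norm_ge0 f : 0 <= L2norm f.
Proof. by rewrite L2normE sqrtr_ge0. Qed.

Lemma sqnormE f : L2 f -> sqnorm f = (L2norm f ^+ 2)%:E.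
Proof.
move=> /L2P[mf ff]; rewrite L2normE sqr_sqrtr ?fine_ge0 ?sqnorm_ge0//.
by rewrite fineK// ge0_fin_numE// sqnorm_ge0.
Qed.

Lemma L2normZ c f : L2 f -> L2norm (c *: f) = normc c * L2norm f.
Proof.
move=> /L2P[mf ff]; rewrite !L2normE sqnormZ// fineM//; last first.
  by rewrite ge0_fin_numE// sqnorm_ge0.
by rewrite /= sqrtrM ?sqr_ge0// sqrtr_sqr ger0_norm// normc_ge0.
Qed.

Lemma cmeas_mul f h : cmeas f -> cmeas h -> cmeas (fun z => f z * h z).
Proof.
move=> [f1 f2] [h1 h2]; split.
  rewrite (_ : rePart _ = (fun p => rePart f p * rePart h p - imPart f p * imPart h p)).
    by apply: measurable_funB; apply: measurable_funM.
  by apply/funext => p; rewrite /rePart Re_mul.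
rewrite (_ : imPart _ = (fun p => rePart f p * imPart h p + imPart f p * rePart h p)).
  by apply: measurable_funD; apply: measurable_funM.
by apply/funext => p; rewrite /imPart Im_mul.
Qed.

Lemma cmeas_monom p q : cmeas (@monom R p q).
Proof.
have X (f : C -> C) k : cmeas f -> cmeas (fun z => f z ^+ k).
  move=> mf; elim: k => [|k IH].
    by under eq_fun do rewrite expr0; split; exact: measurable_cst.
  by under eq_fun do rewrite exprS; exact: cmeas_mul.
apply: cmeas_mul; apply: X; split.
- exact: measurable_fst.
- exact: measurable_snd.
- by rewrite (_ : rePart _ = fst); [exact: measurable_fst|apply/funext => -[]].
- rewrite (_ : imPart _ = (fun p => - p.2)); last by apply/funext => -[].
  by apply: measurable_funN; exact: measurable_snd.
Qed.

Lemma normc_monom p q (z : C) : normc (monom p q z) = normc z ^+ (p + q).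
Proof. by rewrite normcM !normcX normc_conj exprD. Qed.

Lemma L2_monom p q : L2 (@monom R p q).
Proof.
apply/L2P; split; first exact: cmeas_monom.
rewrite /sqnorm; under eq_integral do rewrite normc_monom -exprM muln2.
exact: gauss_moment_fin.
Qed.

End NormLink.

Section Components.
Context {R : realType}.
Local Notation C := R[i].
Local Notation plane := (measurableTypeR R * measurableTypeR R)%type.
Variable m : nat.
Implicit Types (f : C -> C) (g : nat -> C -> C).

(** The general element of the truncated diagonal subspace for [d = k - m]. *)
Definition diag (k : nat) (a : nat -> C) : C -> C :=
  fun z => \sum_(j < (minn k m).+1) a j * monom (k - j) (m - j) z.

Definition comp k : set (C -> C) := range (diag k).

Lemma diag_lin c k a b : diag k (fun j => c * a j + b j) = c *: diag k a + diag k b.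
Proof.
apply/funext => z; transitivity (c * diag k a z + diag k b z); last by [].
rewrite /diag mulr_sumr -big_split/=; apply: eq_bigr => j _; by ring.
Qed.

Lemma diag0 k : diag k (fun=> 0) = 0.
Proof. by apply/funext => z; rewrite /diag big1// => j _; rewrite mul0r. Qed.

Lemma diag_delta k j : (j <= minn k m)%N ->
  diag k (fun i => (i == j)%:R) = monom (k - j) (m - j).
Proof.
rewrite -ltnS => jk; apply/funext => z; rewrite /diag (bigD1 (Ordinal jk))//= eqxx mul1r.
by rewrite big1 ?addr0// => i; rewrite -val_eqE /= => /negPf ->; rewrite mul0r.
Qed.

Lemma diag_sum k a : diag k a = \sum_(j < (minn k m).+1) a j *: monom (k - j) (m - j).
Proof. by apply/funext => z; rewrite /diag fct_sumE. Qed.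

Lemma diag_ext k a b : (forall j, (j <= minn k m)%N -> a j = b j) -> diag k a = diag k b.
Proof.
move=> ab; apply/funext => z; apply: eq_bigr => j _; rewrite ab// -ltnS; exact: ltn_ord.
Qed.

Lemma comp0 k : comp k (0 : C -> C).
Proof. by exists (fun=> 0) => //; exact: diag0. Qed.

Lemma comp_lin k c f h : comp k f -> comp k h -> comp k (c *: f + h).
Proof.
by case=> a _ <- [b _ <-]; exists (fun j => c * a j + b j) => //; exact: diag_lin.
Qed.

Lemma comp_submod_closed k : submod_closed [in comp k].
Proof.
split=> [|c f h /set_mem cf /set_mem ch]; apply/mem_set; first exact: comp0.
exact: comp_lin.
Qed.

Lemma comp_cmeas k f : comp k f -> cmeas f.
Proof.
case=> a _ <-; apply: (@cmeas_sum R _ (fun j z => a j * monom (k - j) (m - j) z)) => j.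
by apply: cmeasZ; exact: cmeas_monom.
Qed.

Lemma L2_diag k a : L2 (diag k a).
Proof.
rewrite diag_sum; apply: submod_comb => [|j]; [exact: L2_submod_closed|exact: L2_monom].
Qed.

Lemma comp_L2 k f : comp k f -> L2 f.
Proof. by case=> a _ <-; exact: L2_diag. Qed.

Lemma comp_homog k f : comp k f -> homog m k f.
Proof.
case=> a _ <- w z w1; rewrite /diag mulr_sumr; apply: eq_bigr => j _.
have : (j <= minn k m)%N by rewrite -ltnS.
rewrite leq_min => /andP[jk jm].
have -> : w ^+ k = w ^+ (k - j) * w ^+ j by rewrite -exprD subnK.
have -> : (w^*)%C ^+ m = (w^*)%C ^+ (m - j) * (w^*)%C ^+ j by rewrite -exprD subnK.
rewrite /monom conjM !exprMn.
have := conj_unitX j w1.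
set x := w ^+ j; set y := (w^*)%C ^+ j => xy.
set u := w ^+ (k - j); set v := (w^*)%C ^+ _.
set s := z ^+ _; set t := (z^*)%C ^+ _.
transitivity (a j * (u * s * (v * t)) * (x * y)); last by ring.
by rewrite xy mulr1.
Qed.

Lemma diag_bounded k a (rho : R) : exists M, forall z, normc z <= rho -> normc (diag k a z) <= M.
Proof.
exists (\sum_(j < (minn k m).+1) normc (a j) * rho ^+ (k - j + (m - j))) => z zr.
apply: le_trans (normc_sum _ _ _) _; apply: ler_sum => j _.
rewrite normcM normc_monom ler_wpM2l ?normc_ge0// lerXn2r// nnegrE ?normc_ge0//.
exact: le_trans (normc_ge0 z) zr.
Qed.

Lemma comp_expands k f : comp k f -> expands m f (fun j => if j == k then f else 0).
Proof.
move=> cf; apply: expands_single.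
- exact: comp_homog.
- exact: comp_cmeas cf.
- by case: cf => a _ <-; exact: diag_bounded.
Qed.

Lemma Dset_comp k : Dset (k%:Z - m%:Z) (minn k m).+1 = comp k.
Proof.
apply/seteqP; split=> [f [l [c [g [Hg ->]]]]|f [a _ <-]].
  apply: submod_comb => [|i]; first exact: comp_submod_closed.
  have [p [q [pq d ->]]] := Hg i.
  have jk : (k - p <= minn k m)%N by rewrite leq_min; lia.
  by exists (fun i => (i == k - p)%N%:R) => //; rewrite diag_delta//; congr monom; lia.
rewrite diag_sum; exists (minn k m).+1, (fun j => a j), (fun j => monom (k - j) (m - j)).
split=> // j; have : (j <= minn k m)%N by rewrite -ltnS.
by rewrite leq_min => /andP[jk jm]; exists (k - j)%N, (m - j)%N; split => //; lia.
Qed.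

End Components.

(** * The norm of a component bounds its coefficients *)

Section CoefficientBound.
Context {R : realType}.
Local Notation C := R[i].
Local Notation plane := (measurableTypeR R * measurableTypeR R)%type.

(** Divided differences: dividing out one of the points lowers the degree, and
    the separation of the points keeps the values of the quotient bounded. *)
Lemma poly_coef_bound (L : R) p : 0 <= L -> exists2 K, 0 <= K &
  forall (P : {poly C}) (x : nat -> R) (E : R), (size P <= p.+1)%N ->
    (forall i, (i <= p)%N -> `|x i| <= L) ->
    (forall i j, (i < j)%N -> (j <= p)%N -> 1 <= x j - x i) ->
    (forall i, (i <= p)%N -> normc P.[(x i)%:C%C] <= E) ->
    forall j, normc P`_j <= K * E.
Proof.
move=> L0; elim: p => [|p [K K0 IH]].
  exists 1 => // P x E sP _ _ HE j; rewrite mul1r.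
  have := HE 0%N (leqnn _); rewrite (size1_polyC sP) hornerC coefC => H.
  by case: eqP => // _; rewrite normc0 (le_trans (normc_ge0 _) H).
exists (2 * K * (1 + L) + 1) => [|P x E sP xL sep HE j].
  by rewrite addr_ge0// mulr_ge0 ?addr_ge0 ?mulr_ge0.
pose x0 : C := (x p.+1)%:C%C; pose c := P.[x0].
have E0 : 0 <= E := le_trans (normc_ge0 _) (HE _ (leqnn _)).
have /factor_theorem[Q HQ] : root (P - c%:P) x0.
  by rewrite /root hornerD hornerN hornerC subrr.
have sQ : (size Q <= p.+1)%N.
  have [->|Q0] := eqVneq Q 0; first by rewrite size_poly0.
  have : (size (Q * ('X - x0%:P))%R <= p.+2)%N.
    rewrite -HQ (leq_trans (size_polyD _ _))// geq_max sP size_polyN.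
    by rewrite (leq_trans (size_polyC_leq1 _)).
  by rewrite size_Mmonic ?monicXsubC// size_XsubC addn2.
have PE : P = Q * 'X - Q * x0%:P + c%:P by rewrite -mulrBr -HQ subrK.
have QE i : (i <= p)%N -> normc Q.[(x i)%:C%C] <= 2 * E.
  move=> ip; have e : Q.[(x i)%:C%C] * ((x i - x p.+1)%:C)%C = P.[(x i)%:C%C] - c.
    by rewrite {1}PE !hornerE rmorphB /x0 /=; ring.
  have h : normc (Q.[(x i)%:C%C] * ((x i - x p.+1)%:C)%C) <= 2 * E.
    rewrite e; apply: le_trans (normcB _ _) _.
    by rewrite mulr_natl mulr2n lerD// HE// ltnW.
  apply: le_trans h; rewrite normcM normc_real ler_peMr ?normc_ge0//.
  by rewrite distrC (le_trans (sep i p.+1 _ _)) ?ler_norm.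
have {}IH := IH Q x (2 * E) sQ (fun i h => xL i (leqW h))
   (fun i j h h' => sep i j h (leqW h')) QE.
rewrite PE coefD coefB coefMX coefMC coefC.
have b1 : normc (if j == 0 then 0 else Q`_j.-1) <= K * (2 * E).
  by case: eqP => _; [rewrite normc0 !mulr_ge0|exact: IH].
have b2 : normc (Q`_j * x0) <= K * (2 * E) * L.
  by rewrite normcM normc_real ler_pM ?normc_ge0// xL.
have b3 : normc (if j == 0%N then c else 0) <= E.
  by case: eqP => _; [exact: HE|rewrite normc0].
apply: le_trans (normcD _ _) _; apply: le_trans (lerD (normcB _ _) (lexx _)) _.
apply: le_trans (lerD (lerD b1 b2) b3) _.
by rewrite le_eqVlt; apply/orP; left; apply/eqP; ring.
Qed.

Definition box (a : R) : set plane := `[a, a + 1] `*` `[0, 1].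

(** The density is bounded below on the box, which has area 1. *)
Lemma gauss_box (a : R) : exists2 c : R, 0 < c & (c%:E <= gauss (box a))%E.
Proof.
have mB : measurable (box a) by apply: measurableX; exact: measurable_itv.
pose c : R := pi^-1 * expR (- ((`|a| + 1) ^+ 2 + 1)).
have c0 : 0 < c by rewrite mulr_gt0 ?expR_gt0// invr_gt0 pi_gt0.
exists c => //.
have <- : (\int[lebesgue_measure \x lebesgue_measure]_(p in box a) (c%:E) = c%:E)%E.
  rewrite integral_cst//= product_measure1E; [|exact: measurable_itv..].
  have e (b : R) : lebesgue_measure (`[b, b + 1]%classic : set R) = 1%E.
    by rewrite lebesgue_measure_itv/= lte_fin ltrDl ltr01 -EFinD addrAC subrr add0r.
  transitivity (c%:E * (1 * 1))%E; last by rewrite !mule1.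
  by congr (_ * (_ * _))%E; [exact: e|have := e 0; rewrite add0r].
apply: ge0_le_integral => //.
- by move=> p _; rewrite lee_fin ltW.
- by apply: measurable_funTS; apply/measurable_EFinP; exact: measurable_gauss_pdf.
move=> [x y] [/=]; rewrite !in_itv/= => /andP[ax xa] /andP[y0 y1].
rewrite lee_fin /gauss_pdf ler_wpM2l ?invr_ge0 ?pi_ge0// ler_expR lerN2 normc_sq /=.
rewrite lerD ?expr_le1// -[x ^+ 2]real_normK ?num_real// lerXn2r ?nnegrE ?addr_ge0//.
have h1 := ler_norm a; have h2 := ler_norm (- a); rewrite normrN in h2.
by rewrite ler_norml; apply/andP; split; [apply: le_trans ax|apply: le_trans xa _]; lra.
Qed.

(** Otherwise the integral over the box alone would be at least [s]. *)
Lemma box_point (a : R) : exists2 c : R, 0 < c & forall (f : C -> C) (s : R),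
  cmeas f -> (sqnorm f < s%:E)%E ->
  exists p : R * R, [/\ a <= p.1 <= a + 1, 0 <= p.2 <= 1 & normc (f (toC p)) ^+ 2 <= s / c].
Proof.
have [c c0 Hc] := gauss_box a; exists c => // f s mf fs.
have mB : measurable (box a) by apply: measurableX; exact: measurable_itv.
have s0 : 0 < s by rewrite -lte_fin (le_lt_trans (sqnorm_ge0 f)).
apply: contrapT => H; move: fs; apply/negP; rewrite -leNgt.
apply: (@le_trans _ _ ((s / c)%:E * gauss (box a))%E).
  apply: le_trans (lee_wpmul2l _ Hc); last by rewrite lee_fin divr_ge0// ltW.
  by rewrite -EFinM divfK// gt_eqF.
rewrite -integral_cst//.
apply: (@le_trans _ _ (\int[@gauss R]_(p in box a) (normc (f (toC p)) ^+ 2)%:E)%E).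
  apply: ge0_le_integral => //.
  - by move=> p _; rewrite lee_fin divr_ge0// ltW.
  - by apply: measurable_funTS; apply/measurable_EFinP; exact: measurable_normc_sq.
  move=> [x y] [/=]; rewrite !in_itv/= => xa y01; rewrite lee_fin leNgt; apply/negP => lt.
  by apply: H; exists (x, y); split => //; exact: ltW.
apply: ge0_subset_integral => //.
  by apply/measurable_EFinP; exact: measurable_normc_sq.
by move=> p _; rewrite lee_fin sqr_ge0.
Qed.

(** The gap of 4 between consecutive boxes separates the squared moduli by at
    least 1. *)
Lemma shell_separated (A i l x y x' y' : R) : 1 <= A -> 0 <= i -> i + 1 <= l ->
  A + 4 * i <= x -> x <= A + 4 * i + 1 -> 0 <= y -> y <= 1 -> A + 4 * l <= x' ->
  1 <= x' ^+ 2 + y' ^+ 2 - (x ^+ 2 + y ^+ 2).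
Proof.
move=> A1 i0 il x1 x2 y0 y1 x1'.
have h1 : x ^+ 2 <= (A + 4 * i + 1) ^+ 2 by rewrite lerXn2r ?nnegrE//; lra.
have h2 : y ^+ 2 <= 1 by rewrite expr_le1.
have h3 : (A + 4 * i + 4) ^+ 2 <= x' ^+ 2 by rewrite lerXn2r ?nnegrE//; lra.
have h4 : 0 <= y' ^+ 2 by rewrite sqr_ge0.
by nra.
Qed.

Variable m : nat.

(** Up to a factor of known modulus, an element of a diagonal subspace is a polynomial
    in the square of the modulus. *)
Lemma diag_factor k a (z : C) (p := minn k m) : diag m k a z =
  z ^+ (k - p) * (z^*)%C ^+ (m - p) *
    (\poly_(i < p.+1) a (p - i)%N).[(normc z ^+ 2)%:C%C].
Proof.
rewrite /diag -/p horner_poly (reindex_inj rev_ord_inj)/= mulr_sumr.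
apply: eq_bigr => j _; rewrite subSS.
have jp : (j <= p)%N by rewrite -ltnS.
have [pk pm] : (p <= k)%N /\ (p <= m)%N by rewrite geq_minl geq_minr.
rewrite /monom normc_sqC exprMn.
have -> : (k - (p - j) = k - p + j)%N by lia.
have -> : (m - (p - j) = m - p + j)%N by lia.
by rewrite !exprD; ring.
Qed.

(** Each of [m + 1] separated boxes contains a point where the modulus of
    [diag m k a] is controlled by the norm, and the values at these points determine
    the coefficients.  The gain of [A ^ k] comes from placing the boxes outside the
    disc of radius [A]. *)
Lemma diag_coef_bound (A : R) : 1 <= A -> exists2 K, 0 <= K &
  forall k a (s : R), (sqnorm (diag m k a) < s%:E)%E ->
    forall j, (j <= minn k m)%N -> normc (a j) * A ^+ k <= K * Num.sqrt s.
Proof.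
move=> A1; have A0 : 0 <= A by lra.
pose L := (A + 4 * m%:R + 1) ^+ 2 + 1.
have L0 : 0 <= L by rewrite addr_ge0// sqr_ge0.
have /choice[Kp HKp] p : exists K, 0 <= K /\
  forall (P : {poly C}) (x : nat -> R) (E : R), (size P <= p.+1)%N ->
    (forall i, (i <= p)%N -> `|x i| <= L) ->
    (forall i j, (i < j)%N -> (j <= p)%N -> 1 <= x j - x i) ->
    (forall i, (i <= p)%N -> normc P.[(x i)%:C%C] <= E) ->
    forall j, normc P`_j <= K * E.
  by have [K] := poly_coef_bound p L0; exists K.
have /choice[c Hc] i : exists c : R, 0 < c /\ forall (f : C -> C) (s : R),
  cmeas f -> (sqnorm f < s%:E)%E -> exists p : R * R,
   [/\ A + 4 * i%:R <= p.1 <= A + 4 * i%:R + 1, 0 <= p.2 <= 1 & normc (f (toC p)) ^+ 2 <= s / c].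
  by have [c] := box_point (A + 4 * i%:R); exists c.
have ci0 i : 0 <= (c i)^-1 by rewrite invr_ge0 ltW; case: (Hc i).
pose K1 := \sum_(p < m.+1) Kp p; pose K2 := \sum_(i < m.+1) (c i)^-1.
have K10 : 0 <= K1 by apply: sumr_ge0 => p _; case: (HKp p).
have K20 : 0 <= K2 by apply: sumr_ge0.
exists (K1 * (A ^+ m * Num.sqrt K2)).
  by rewrite !mulr_ge0 ?exprn_ge0 ?sqrtr_ge0.
move=> k a s fs j jk; set p := minn k m in jk *.
have s0 : 0 <= s by rewrite -lee_fin (le_trans (sqnorm_ge0 _) (ltW fs)).
have mf : cmeas (diag m k a) by apply: (@comp_cmeas R m k); exists a.
have /choice[q Hq] i := (Hc i).2 _ _ mf fs.
have pm : (p <= m)%N by rewrite geq_minr.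
pose E := A ^+ m * Num.sqrt (s * K2).
pose P := \poly_(i < p.+1) a (p - i)%N.
pose r i := normc (toC (q i)).
have rE i : r i ^+ 2 = (q i).1 ^+ 2 + (q i).2 ^+ 2 by rewrite /r normc_sq.
have rA i : A <= r i.
  have [/andP[q1 _] _ _] := Hq i; have i0 : 0 <= i%:R :> R by [].
  rewrite -ler_sqr ?nnegrE ?normc_ge0// rE.
  by apply: (@le_trans _ _ ((q i).1 ^+ 2)); rewrite ?lerDl ?sqr_ge0// lerXn2r ?nnegrE//; lra.
have PE i : (i <= p)%N -> normc ((A ^+ k)%:C%C *: P).[(r i ^+ 2)%:C%C] <= E.
  move=> ip; rewrite hornerZ normcM normc_real ger0_norm ?exprn_ge0//.
  have [_ _ q3] := Hq i.
  have : normc (diag m k a (toC (q i))) <= Num.sqrt (s * K2).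
    rewrite -ler_sqr ?nnegrE ?normc_ge0 ?sqrtr_ge0// sqr_sqrtr ?mulr_ge0//.
    apply: le_trans q3 _; rewrite ler_wpM2l//.
    have im : (i < m.+1)%N by rewrite ltnS (leq_trans ip).
    by rewrite /K2 (bigD1 (Ordinal im))//= lerDl sumr_ge0.
  rewrite diag_factor -/p -/P normcM normcM !normcX normc_conj -/(r i) => h.
  apply: (@le_trans _ _ (A ^+ m * (r i ^+ (k - p) * r i ^+ (m - p) *
     normc P.[(r i ^+ 2)%:C%C]))); last by rewrite ler_wpM2l ?exprn_ge0.
  rewrite mulrA ler_wpM2r ?normc_ge0//.
  have -> : A ^+ k = A ^+ p * A ^+ (k - p) by rewrite -exprD subnKC// geq_minl.
  rewrite ler_pM ?exprn_ge0//; first exact: ler_weXn2l.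
  rewrite -[leLHS]mulr1 ler_pM ?exprn_ge0//; first by rewrite lerXn2r ?nnegrE ?normc_ge0.
  by rewrite exprn_ege1// (le_trans A1).
have -> : normc (a j) * A ^+ k = normc ((A ^+ k)%:C%C *: P)`_(p - j).
  rewrite coefZ normcM normc_real ger0_norm ?exprn_ge0// coef_poly.
  by rewrite ltnS leq_subr subKn// mulrC.
apply: le_trans (_ : Kp p * E <= _).
  apply: ((HKp p).2 _ (fun i => r i ^+ 2)) => //.
  - by rewrite (leq_trans (size_scale_leq _ _))// size_poly.
  - move=> i ip; have [/andP[q1 q2] /andP[q3 q4] _] := Hq i.
    rewrite ger0_norm ?sqr_ge0// rE /L; have i0 : 0 <= i%:R :> R by [].
    have im : i%:R <= m%:R :> R by rewrite ler_nat (leq_trans ip).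
    by rewrite lerD ?expr_le1// lerXn2r ?nnegrE//; lra.
  - move=> i l il lp; have [/andP[q1 q2] /andP[q3 q4] _] := Hq i.
    have [/andP[q1' q2'] /andP[q3' q4'] _] := Hq l.
    have i0 : 0 <= i%:R :> R by [].
    have il' : i%:R + 1 <= l%:R :> R by rewrite natr1 ler_nat.
    by rewrite !rE; apply: (@shell_separated A i%:R l%:R).
have Kp1 : Kp p <= K1.
  rewrite /K1 (bigD1 (Ordinal (pm : (p < m.+1)%N)))//= lerDl sumr_ge0// => i _.
  by case: (HKp i).
have E0 : 0 <= E by rewrite mulr_ge0 ?exprn_ge0 ?sqrtr_ge0.
apply: le_trans (ler_wpM2r E0 Kp1) _.
by rewrite /E sqrtrM// le_eqVlt; apply/orP; left; apply/eqP; ring.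
Qed.

(** [diag_coef_bound] for all positive bounds on the norm, which makes the Gram matrix
    definite. *)
Lemma diag_eq0 k (a : nat -> C) : sqnorm (diag m k a) = 0%E -> forall j, (j <= minn k m)%N -> a j = 0.
Proof.
move=> f0 j jk; apply/eqP; rewrite -normc_eq0 eq_le normc_ge0 andbT.
have [K K0 HK] := diag_coef_bound (lexx 1).
apply: (@ler_of_geometric _ _ 0 K) => N; rewrite add0r.
have := HK k a ((2 ^+ N)^-1 ^+ 2) _ j jk.
rewrite f0 lte_fin expr1n mulr1 sqrtr_sqr ger0_norm ?invr_ge0 ?exprn_ge0//.
by apply; rewrite exprn_gt0// invr_gt0 exprn_gt0.
Qed.

Lemma comp_eq0 k (f : C -> C) : comp m k f -> sqnorm f = 0%E -> f = 0.
Proof.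
by move=> [a _ <-] /diag_eq0 H; rewrite (diag_ext (b := fun=> 0) H) diag0.
Qed.

End CoefficientBound.

(** * Expansion and synthesis of polyanalytic functions *)

Section Synthesis.
Context {R : realType}.
Local Notation C := R[i].
Implicit Types (f : C -> C) (g : nat -> C -> C).

(** Multiplication by a monomial of degree [j] shifts the index of a series by [j]. *)
Lemma geom_sum_shift g f (c : C -> C) j : geom_sum g f ->
  (forall rho : R, exists M, forall z, normc z <= rho -> normc (c z) <= M) ->
  geom_sum (fun k z => if (j <= k)%N then c z * g (k - j)%N z else 0) (fun z => c z * f z).
Proof.
move=> G bc rho; have [M HM] := G rho; have [B HB] := bc rho.
exists (B * (`|M| * 2 ^+ j)) => z zr N.
have -> : \sum_(k < N) (if (j <= k)%N then c z * g (k - j)%N z else 0) =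
    c z * \sum_(i < N - j) g i z.
  elim: N => [|N IH]; first by rewrite sub0n !big_ord0 mulr0.
  rewrite big_ord_recr/= {}IH; case: leqP => jN.
    by rewrite subSn// big_ord_recr mulrDr.
  by rewrite (eqP (ltnW jN)) addr0 (eqP jN) big_ord0.
rewrite -mulrBr normcM -mulrA; apply: ler_pM; rewrite ?normc_ge0 ?HB//.
apply: le_trans (HM z zr _) _; apply: le_trans (ler_wpM2r _ (ler_norm _)) _.
  by rewrite invr_ge0 exprn_ge0.
rewrite -mulrA ler_wpM2l// ler_pdivlMr ?exprn_gt0// mulrC ler_pdivrMr ?exprn_gt0//.
by rewrite -exprD ler_weXn2l ?ler1n//; lia.
Qed.

Lemma geom_sum_sum n (g : nat -> nat -> C -> C) (f : nat -> C -> C) :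
  (forall j, (j < n)%N -> geom_sum (g j) (f j)) ->
  geom_sum (fun k z => \sum_(j < n) g j k z) (fun z => \sum_(j < n) f j z).
Proof.
elim: n => [|n IH] H.
  move=> rho; exists 0 => z _ N; rewrite big_ord0 sub0r normc_opp mul0r.
  by rewrite big1 ?normc0// => k _; rewrite big_ord0.
have := geom_sum_lin 1 (IH (fun j h => H j (ltnW h))) (H n (ltnSn n)).
congr geom_sum; last first.
  by rewrite scale1r; apply/funext => z; rewrite big_ord_recr.
by apply/funext => k; rewrite scale1r; apply/funext => z; rewrite big_ord_recr.
Qed.

Variable m : nat.

Lemma diag_mkcond k (a : nat -> C) z :
  diag m k a z = \sum_(j < m.+1) (if (j <= k)%N then a j * monom (k - j) (m - j) z else 0).
Proof.
have km : ((minn k m).+1 <= m.+1)%N by rewrite ltnS geq_minr.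
rewrite /diag (big_ord_widen _ (fun j => a j * monom (k - j) (m - j) z) km) big_mkcond.
by apply: eq_bigr => j _; rewrite ltnS leq_min -(ltnS j m) ltn_ord andbT.
Qed.

(** The double power series, summed along the diagonals of constant difference of the
    exponents. *)
Lemma polyentire_expands (b : nat -> nat -> C) (h : nat -> C -> C) :
  (forall q, entire (b q) (h q)) ->
  expands m (fun z => \sum_(q < m.+1) (z^*)%C ^+ q * h q z)
    (fun k => diag m k (fun j => b (m - j)%N (k - j)%N)).
Proof.
move=> E; split; last 2 first.
- by move=> k; apply: comp_homog; eexists.
- by move=> k; apply: (@comp_cmeas _ m k); eexists.
pose g j k z : C := if (j <= k)%N then (z^*)%C ^+ (m - j) * (b (m - j)%N (k - j)%N * z ^+ (k - j)) else 0.
pose f j z := (z^*)%C ^+ (m - j) * h (m - j)%N z.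
have H j : (j < m.+1)%N -> geom_sum (g j) (f j).
  move=> _; apply: (geom_sum_shift (g := fun i z => b (m - j)%N i * z ^+ i)); first exact: E.
  move=> rho; exists (rho ^+ (m - j)) => z zr; rewrite normcX normc_conj.
  by rewrite lerXn2r ?nnegrE ?normc_ge0// (le_trans (normc_ge0 z)).
have := geom_sum_sum H; congr geom_sum.
  apply/funext => k; apply/funext => z; rewrite diag_mkcond; apply: eq_bigr => j _.
  by rewrite /g; case: leqP => // _; rewrite /monom; ring.
apply/funext => z; rewrite [RHS](reindex_inj rev_ord_inj)/=.
by apply: eq_bigr => j _; rewrite subSS.
Qed.

(** A bound on the norms of the terms is enough for their sum to exist, because
    the coefficients are then those of entire functions. *)
Lemma diag_synth (a : nat -> nat -> C) (B : R) :
  (forall k, (sqnorm (diag m k (a k)) <= B%:E)%E) ->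
  exists f, polyentire m.+1 f /\ expands m f (fun k => diag m k (a k)).
Proof.
move=> HB; pose b q i := a (i + (m - q))%N (m - q)%N.
have /choice[h Hh] q : exists h, entire (b q) h.
  apply: entire_ex => rho r1; have [K K0 HK] := diag_coef_bound m r1.
  exists (K * Num.sqrt (B + 1)) => i.
  have lt : (sqnorm (diag m (i + (m - q)) (a (i + (m - q))%N)) < (B + 1)%:E)%E.
    by apply: le_lt_trans (HB _) _; rewrite lte_fin; lra.
  have le : (m - q <= minn (i + (m - q)) m)%N by rewrite leq_min leq_addl leq_subr.
  apply: le_trans (HK _ _ _ lt _ le); by rewrite ler_wpM2l ?normc_ge0// ler_weXn2l// leq_addr.
exists (fun z => \sum_(q < m.+1) (z^*)%C ^+ q * h q z); split; first by exists b, h.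
have := polyentire_expands Hh; congr (expands m _ _); apply/funext => k.
apply: diag_ext => j; rewrite leq_min => /andP[jk jm].
by rewrite /b subKn// subnK.
Qed.

Lemma Fset_expands f : Fset m.+1 f -> exists2 g, expands m f g & forall k, comp m k (g k).
Proof.
move=> [_ /nanalytic_polyentire[b [h [E ->]]]].
exists (fun k => diag m k (fun j => b (m - j)%N (k - j)%N)); first exact: polyentire_expands.
by move=> k; eexists.
Qed.

(** The sum exists by [diag_synth] and is square integrable by Fatou's lemma. *)
Lemma Fset_synth g (B : R) : (forall k, comp m k (g k)) ->
  (forall K, (\sum_(k < K) sqnorm (g k) <= B%:E)%E) ->
  exists f, [/\ Fset m.+1 f, expands m f g & (sqnorm f <= B%:E)%E].
Proof.
move=> cg HB; have /choice[a Ha] k : exists a, diag m k a = g k by case: (cg k) => a _; exists a.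
have [k|f [pf ef]] := @diag_synth a B.
  rewrite Ha; apply: le_trans (HB k.+1); rewrite big_ord_recr/= leeDr// sume_ge0// => i _.
  exact: sqnorm_ge0.
have {}ef : expands m f g by move: ef; congr expands; apply/funext.
have sf := sqnorm_expands_le ef HB.
exists f; split => //; split; last exact: polyentire_nanalytic.
by apply/L2P; split; [exact: expands_cmeas ef|exact: le_lt_trans sf (ltry _)].
Qed.

Lemma comp_Fset k f : comp m k f -> Fset m.+1 f.
Proof.
move=> cf; have ef := comp_expands cf; have Lf := comp_L2 cf.
have [|K|f' [Ff ef' _]] := @Fset_synth (fun j => if j == k then f else 0) (L2norm f ^+ 2).
- move=> j; case: eqP => [->//|_]; exact: comp0.
- by have := bessel K ef; rewrite (sqnormE Lf).
by rewrite (expands_eq ef ef').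
Qed.

End Synthesis.

(** * Operator norms, direct sums and matrix algebras *)

Section OperatorNorm.
Context {R : realType}.
Local Notation C := R[i].
Variables (V : lmodType C) (nrm : V -> R).
Hypotheses (nrm_ge0 : forall v, 0 <= nrm v)
  (nrmZ : forall c v, nrm (c *: v) = normc c * nrm v).
Implicit Type S : V -> V.

Let nrm0 : nrm 0 = 0.
Proof. by rewrite -(scale0r 0) nrmZ normc0 mul0r. Qed.

Lemma opnorm_le S (c : R) : 0 <= c -> (forall v, nrm (S v) <= c * nrm v) ->
  opnorm nrm S <= c.
Proof.
move=> c0 H; apply: ge_sup; first by exists (nrm (S 0)), 0 => //=; rewrite nrm0.
by move=> _ [v /= v1 <-]; apply: le_trans (H v) _; rewrite ler_piMr.
Qed.

(** For a vector of norm 0 the inequality comes from boundedness, not from scaling. *)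
Lemma opnorm_bound S : (forall c v, S (c *: v) = c *: S v) ->
  (exists M : R, forall v, nrm (S v) <= M * nrm v) ->
  forall v, nrm (S v) <= opnorm nrm S * nrm v.
Proof.
move=> SZ [M HM] v; have [v0|v0] := eqVneq (nrm v) 0.
  by have := HM v; rewrite v0 !mulr0.
have vp : 0 < nrm v by rewrite lt_neqAle eq_sym v0 nrm_ge0.
rewrite -ler_pdivrMr//; apply: ub_le_sup.
  exists `|M| => _ [u /= u1 <-]; apply: le_trans (HM u) _.
  by apply: le_trans (ler_wpM2r (nrm_ge0 u) (ler_norm M)) _; rewrite ler_piMr.
have vi : 0 <= (nrm v)^-1 by rewrite invr_ge0 ltW.
exists (((nrm v)^-1)%:C%C *: v) => /=; last by rewrite SZ nrmZ normc_real ger0_norm// mulrC.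
by rewrite nrmZ normc_real ger0_norm// mulVf.
Qed.

Lemma opnorm_ge0 S : (exists M : R, forall v, nrm (S v) <= M * nrm v) ->
  0 <= opnorm nrm S.
Proof.
move=> [M HM]; apply: (@le_trans _ _ (nrm (S 0))) => //; apply: ub_le_sup.
  exists `|M| => _ [u /= u1 <-]; apply: le_trans (HM u) _.
  by apply: le_trans (ler_wpM2r (nrm_ge0 u) (ler_norm M)) _; rewrite ler_piMr.
by exists 0 => //=; rewrite nrm0.
Qed.

End OperatorNorm.

Lemma opnorm_intertwine (R : realType) (V W : Type) (nV : V -> R) (nW : W -> R)
    (U : V -> W) (T : V -> V) (S : W -> W) :
  (forall w, exists v, U v = w) -> (forall v, nW (U v) = nV v) ->
  (forall v, U (T v) = S (U v)) -> opnorm nV T = opnorm nW S.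
Proof.
move=> sU iU TS; congr sup; apply/seteqP; split=> [_ [v /= v1 <-]|_ [w /= w1 <-]].
  by exists (U v); rewrite /= ?iU// -TS iU.
by have [v e] := sU w; exists v; rewrite /= -iU ?e// TS e.
Qed.

Lemma lin_comb (K : nzRingType) (V W : lmodType K) (T : V -> W) n (c : 'I_n -> K)
    (x : 'I_n -> V) :
  linear T -> T (\sum_(i < n) c i *: x i) = \sum_(i < n) c i *: T (x i).
Proof.
move=> LT; have T0 : T 0 = 0.
  by have := LT (-1) 0 0; rewrite scaler0 addr0 scaleN1r addNr.
by apply: (big_rec2 (fun a b => T a = b)) => // i y z _ e; rewrite LT e.
Qed.

Lemma dsum_alg_iso (R : realType) (I : Type) (A B : I -> @normed_alg R) :
  (forall i, isometrically_isomorphic (A i) (B i)) ->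
  isometrically_isomorphic (dsum_alg A) (dsum_alg B).
Proof.
move=> H.
have [phi Hphi] : exists phi : forall i, alg_ambient (A i) -> alg_ambient (B i),
  forall i, [/\ set_bij (@alg_set _ (A i)) (@alg_set _ (B i)) (phi i),
        forall x y, alg_set x -> alg_set y ->
          phi i (alg_add x y) = alg_add (phi i x) (phi i y),
        forall c x, alg_set x -> phi i (alg_scale c x) = alg_scale c (phi i x),
        forall x y, alg_set x -> alg_set y ->
          phi i (alg_mul x y) = alg_mul (phi i x) (phi i y) &
        forall x, alg_set x -> alg_norm (phi i x) = alg_norm x].
  by exists (fun i => proj1_sig (cid (H i))) => i; exact: proj2_sig (cid (H i)).
have rng x : (forall i, alg_set (x i)) ->
  range (fun i => alg_norm (phi i (x i))) = range (fun i => alg_norm (x i)).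
  move=> Ax; congr (_ @` _); apply/funext => i.
  by have [_ _ _ _ ->] := Hphi i.
exists (fun x i => phi i (x i)); split => /=.
- split.
  + move=> x [Ax ub]; split => [i|]; last by rewrite rng.
    by have [[f _ _] _ _ _ _] := Hphi i; exact: f.
  + move=> x y /set_mem[Ax _] /set_mem[Ay _] e; apply: functional_extensionality_dep => i.
    have [[_ inj _] _ _ _ _] := Hphi i.
    apply: inj; [exact/mem_set|exact/mem_set|].
    exact: (f_equal (fun h => h i) e).
  + move=> y [By ub].
    have X i : exists x, alg_set x /\ phi i x = y i.
      by have [[_ _ s] _ _ _ _] := Hphi i; have [x Ax <-] := s _ (By i); exists x.
    pose x i := proj1_sig (cid (X i)).
    have Hx i : alg_set (x i) /\ phi i (x i) = y i by exact: proj2_sig (cid (X i)).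
    have e : (fun i => phi i (x i)) = y.
      by apply: functional_extensionality_dep => i; case: (Hx i).
    exists x => //; split => [i|]; first by case: (Hx i).
    rewrite -rng; last by move=> i; case: (Hx i).
    by move: ub; rewrite -e.
- move=> x y [Ax _] [Ay _]; apply: functional_extensionality_dep => i.
  by have [_ h _ _ _] := Hphi i; exact: h.
- move=> c x [Ax _]; apply: functional_extensionality_dep => i.
  by have [_ _ h _ _] := Hphi i; exact: h.
- move=> x y [Ax _] [Ay _]; apply: functional_extensionality_dep => i.
  by have [_ _ _ h _] := Hphi i; exact: h.
- by move=> x [Ax _]; rewrite rng.
Qed.

Section MatrixAlgebra.
Context {R : realType}.
Local Notation C := R[i].
Implicit Types k : nat.

Lemma cvnorm_sq k (v : 'cV[C]_k) : cvnorm v ^+ 2 = \sum_(i < k) normc (v i 0) ^+ 2.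
Proof. by rewrite sqr_sqrtr// sumr_ge0// => i _; rewrite sqr_ge0. Qed.

Lemma cvnorm_ge0 k (v : 'cV[C]_k) : 0 <= cvnorm v.
Proof. exact: sqrtr_ge0. Qed.

Lemma cvnorm_eq0 k (v : 'cV[C]_k) : cvnorm v = 0 -> v = 0.
Proof.
move=> v0; apply/colP => i; rewrite mxE; apply/eqP; rewrite -normc_eq0 -sqrf_eq0.
have /eqP := cvnorm_sq v; rewrite v0 expr0n /= eq_sym psumr_eq0; last first.
  by move=> j _; rewrite sqr_ge0.
by move/allP => /(_ i); rewrite mem_index_enum; exact.
Qed.

Lemma cvnorm0 k : cvnorm (0 : 'cV[C]_k) = 0.
Proof.
apply/eqP; rewrite -sqrf_eq0 cvnorm_sq; apply/eqP/big1 => i _.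
by rewrite mxE normc0 expr0n.
Qed.

Lemma normc_le_cvnorm k (v : 'cV[C]_k) i : normc (v i 0) <= cvnorm v.
Proof.
rewrite -ler_sqr ?nnegrE ?normc_ge0 ?cvnorm_ge0// cvnorm_sq (bigD1 i)//= lerDl.
by apply: sumr_ge0 => j _; rewrite sqr_ge0.
Qed.

Lemma mulmx_cvnorm_bounded k (A : 'M[C]_k) : exists M : R,
  forall v, cvnorm (A *m v) <= M * cvnorm v.
Proof.
pose M := Num.sqrt (\sum_(i < k) (\sum_(j < k) normc (A i j)) ^+ 2).
exists M => v; rewrite -ler_sqr ?nnegrE ?mulr_ge0 ?cvnorm_ge0 ?sqrtr_ge0//.
rewrite exprMn cvnorm_sq sqr_sqrtr; last by apply: sumr_ge0 => i _; rewrite sqr_ge0.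
rewrite mulr_suml; apply: ler_sum => i _; rewrite -exprMn lerXn2r ?nnegrE ?normc_ge0//.
  by rewrite mulr_ge0 ?cvnorm_ge0// sumr_ge0// => j _; rewrite normc_ge0.
rewrite mxE; apply: le_trans (normc_sum _ _ _) _; rewrite mulr_suml; apply: ler_sum => j _.
by rewrite normcM ler_wpM2l ?normc_ge0// normc_le_cvnorm.
Qed.

Lemma eq_mulmx k (A B : 'M[C]_k) : (forall v : 'cV_k, A *m v = B *m v) -> A = B.
Proof. by move=> H; apply/trmx_inj/row_matrixP => i; rewrite -!tr_col !colE H. Qed.

(** A unitary identification of a space with [C ^ k] turns its operators into
    matrices. *)
Lemma bounded_alg_mx_iso (H : Defs.subspace R) k (U : 'cV[C]_k -> vec H) :
  linear U -> (forall f, exists v, U v = f) ->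
  (forall v, L2norm (U v) = cvnorm v) ->
  isometrically_isomorphic (bounded_alg H) (@mx_alg R k).
Proof.
move=> LU sU iU; have [U' UK'] := choice sU.
have UB v w : U (v - w) = U v - U w.
  by rewrite addrC -scaleN1r LU scaleN1r addrC.
have U0 : U 0 = 0 by rewrite -[0 in LHS](subrr 0) UB subrr.
have injU : injective U.
  move=> v w e; apply/eqP; rewrite -subr_eq0; apply/eqP; apply: cvnorm_eq0.
  by rewrite -iU UB e subrr -U0 iU cvnorm0.
have U'K v : U' (U v) = v by apply: injU; rewrite UK'.
have LU' : linear U' by move=> a f g; apply: injU; rewrite LU !UK'.
pose phi (S : vec H -> vec H) : 'M[C]_k := \matrix_(i, j) U' (S (U (delta_mx j 0))) i 0.
have phiE S : linear S -> forall v, U (phi S *m v) = S (U v).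
  move=> LS v; apply: (can_inj UK'); rewrite U'K.
  pose T w := U' (S (U w)); have LT : linear T by move=> a x y; rewrite /T LU LS LU'.
  have {2}-> : v = \sum_(j < k) v j 0 *: delta_mx j 0.
    by rewrite {1}[v]matrix_sum_delta; apply: eq_bigr => j _; rewrite big_ord1.
  rewrite -/(T _) lin_comb//; apply/colP => i; rewrite mxE summxE.
  by apply: eq_bigr => j _; rewrite !mxE mulrC.
have phi_uniq S A : linear S -> (forall v, U (A *m v) = S (U v)) -> phi S = A.
  by move=> LS HA; apply: eq_mulmx => v; apply: injU; rewrite phiE.
have bl S : bounded_op S -> linear S by case.
exists phi; split.
- split => //=.
  + move=> S T /set_mem[LS _] /set_mem[LT _] e; apply/funext => f.
    by rewrite -(UK' f) -phiE// -phiE// e.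
  + move=> A _; exists (fun f => U (A *m U' f)); last first.
      apply: phi_uniq => [a f g|v]; last by rewrite U'K.
      by rewrite LU' mulmxDr -scalemxAr LU.
    split=> [a f g|]; first by rewrite LU' mulmxDr -scalemxAr LU.
    have [M HM] := mulmx_cvnorm_bounded A; exists M => f.
    by rewrite iU -[in leRHS](UK' f) iU.
- move=> S T /bl LS /bl LT /=; apply: phi_uniq => [a f g|v].
    by rewrite !fctE LS LT scalerDr addrACA.
  by rewrite mulmxDl -[_ *m v]scale1r LU scale1r !phiE.
- move=> c S /bl LS /=; apply: phi_uniq => [a f g|v].
    by rewrite !fctE LS scalerDr !scalerA mulrC.
  by rewrite -scalemxAl -[_ *: _]addr0 LU U0 addr0 phiE.
- move=> S T /bl LS /bl LT /=; apply: phi_uniq => [a f g|v]; first by rewrite /= LT LS.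
  by rewrite -mulmxA !phiE.
- move=> S /bl LS /=; apply: (opnorm_intertwine sU) => //; exact: phiE.
Qed.

End MatrixAlgebra.

(** * Orthonormal bases of the diagonal subspaces *)

Section Cholesky.
Context {R : realType}.

Definition qform p (G : 'M[R]_p) (x : 'cV[R]_p) : R := (x^T *m G *m x) 0 0.

Lemma qformE p (G : 'M[R]_p) x : qform G x = \sum_i \sum_j x i 0 * x j 0 * G i j.
Proof.
rewrite /qform mxE exchange_big/=; apply: eq_bigr => j _.
rewrite mxE mulr_suml; apply: eq_bigr => i _; rewrite mxE; by ring.
Qed.

Lemma qform_tr_mul p (L : 'M[R]_p) x : qform (L^T *m L) x = \sum_i (L *m x) i 0 ^+ 2.
Proof.
rewrite /qform mulmxA -trmx_mul -mulmxA mxE; apply: eq_bigr => i _.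
by rewrite mxE expr2.
Qed.

(** Elimination of the first variable leaves the Schur complement, which is
    again positive definite. *)
Lemma cholesky p (G : 'M[R]_p) : G^T = G -> (forall x, x != 0 -> 0 < qform G x) ->
  exists L : 'M[R]_p, G = L^T *m L.
Proof.
elim: p G => [|p IH] G symG posG; first by exists 0; apply/matrixP => -[].
change ('M[R]_(1 + p)) in G.
pose g := G 0 0; pose b : 'rV_p := ursubmx G; pose H := drsubmx G.
have GE : G = block_mx g%:M b b^T H.
  rewrite -[LHS]submxK; congr block_mx.
    by rewrite [LHS]mx11_scalar !mxE /g; congr (G _ _)%:M; apply/val_inj.
  by rewrite -{1}symG /b trmx_ursub.
have g0 : 0 < g.
  have := posG (delta_mx 0 0); rewrite /qform trmx_delta -rowE -colE !mxE; apply.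
  by apply/eqP => /matrixP/(_ 0 0)/eqP; rewrite !mxE !eqxx oner_eq0.
have symH : H^T = H by rewrite /H trmx_drsub symG.
pose S := H - g^-1 *: (b^T *m b).
have symS : S^T = S by rewrite /S linearB linearZ/= symH trmx_mul trmxK.
have [x x0|L' EL] := IH S symS.
  pose y : 'cV_(1 + p) := col_mx (- (g^-1 *: (b *m x))) x.
  have y0 : y != 0.
    by apply: contra_neq x0 => y0; rewrite -(col_mxKd (- (g^-1 *: (b *m x))) x) -/y y0 linear0.
  suff -> : qform S x = qform G y by exact: posG.
  rewrite /qform GE /y tr_col_mx mul_row_block mul_row_col.
  have -> : (- (g^-1 *: (b *m x)))^T = - (g^-1 *: (x^T *m b^T)).
    by rewrite raddfN/= [(_ *: _)^T]linearZ/= trmx_mul.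
  rewrite !mulNmx mul_mx_scalar scalerA mulfV ?gt_eqF//.
  rewrite scale1r addNr mul0mx add0r mulmxDl mulNmx.
  by rewrite /S mulmxBr mulmxBl -!scalemxAr -!scalemxAl !mulmxA addrC.
pose s := Num.sqrt g; have s0 : s != 0 by rewrite gt_eqF// sqrtr_gt0.
have ss : s * s = g by rewrite -expr2 sqr_sqrtr// ltW.
pose L : 'M[R]_(1 + p) := block_mx s%:M (s^-1 *: b) 0 L'.
suff e : G = L^T *m L by exists L.
rewrite /L GE tr_block_mx mulmx_block tr_scalar_mx !linearZ/= trmx0 !mul0mx !mulmx0 !addr0.
rewrite -scalar_mxM ss mul_scalar_mx mul_mx_scalar !scalerA mulfV// !scale1r.
by congr block_mx; rewrite ?mulVf ?scale1r// -scalemxAl scalerA -invfM ss -EL /S addrC subrK.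
Qed.

End Cholesky.

Section Gram.
Context {R : realType}.
Local Notation C := R[i].
Local Notation plane := (measurableTypeR R * measurableTypeR R)%type.
Variable m : nat.

Definition moment (s : nat) : R := fine (\int[@gauss R]_p (normc (toC p) ^+ s.*2)%:E).

Lemma integrable_moment s :
  (@gauss R).-integrable setT (fun p : plane => (normc (toC p) ^+ s.*2)%:E).
Proof.
apply/integrableP; split.
  by apply/measurable_EFinP; apply: measurable_funX; exact: measurable_normc.
apply: le_lt_trans (gauss_moment_fin s); rewrite le_eqVlt; apply/orP; left; apply/eqP.
by apply: eq_integral => p _; rewrite gee0_abs// lee_fin exprn_ge0// normc_ge0.
Qed.

Lemma integral_moment s : (\int[@gauss R]_p (normc (toC p) ^+ s.*2)%:E = (moment s)%:E)%E.
Proof. by rewrite fineK// integrable_fin_num//; exact: integrable_moment. Qed.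

Lemma normc_diag_sq k (a : nat -> C) z (p := minn k m) : normc (diag m k a z) ^+ 2 =
  \sum_(i < p.+1) \sum_(j < p.+1)
    (complex.Re (a i) * complex.Re (a j) + complex.Im (a i) * complex.Im (a j)) *
    normc z ^+ (k + m - i - j).*2.
Proof.
have -> : normc (diag m k a z) ^+ 2 = complex.Re (diag m k a z * (diag m k a z)^*%C).
  by rewrite -normc_sqC.
rewrite /diag -/p conj_sum mulr_suml (big_morph _ (@ReD R) (erefl : complex.Re (0 : C) = 0)).
apply: eq_bigr => i _; rewrite mulr_sumr (big_morph _ (@ReD R) (erefl : complex.Re (0 : C) = 0)).
apply: eq_bigr => j _.
have ip : (i <= p)%N := ltn_ord i; have jp : (j <= p)%N := ltn_ord j.
have [pk pm] : (p <= k)%N /\ (p <= m)%N by rewrite geq_minl geq_minr.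
have -> : a i * monom (k - i) (m - i) z * (a j * monom (k - j) (m - j) z)^*%C =
    (a i * (a j)^*%C) * ((normc z ^+ (k + m - i - j).*2)%:C)%C.
  rewrite -muln2 mulnC exprM rmorphXn /= normc_sqC /monom !conjM !conjX conjcK exprMn.
  have e1 : (k + m - i - j = (k - i) + (m - j))%N by lia.
  have e2 : (k + m - i - j = (m - i) + (k - j))%N by lia.
  by rewrite {1}e1 e2 !exprD; ring.
by case: (a i) (a j) => [x y] [x' y'] /=; ring.
Qed.

(** The Gram matrix being real, real and imaginary parts of the coefficients
    contribute separately. *)
Lemma sqnorm_diag k (a : nat -> C) (p := minn k m)
    (G := \matrix_(i < p.+1, j < p.+1) moment (k + m - i - j)) :
  sqnorm (diag m k a) = (qform G (\col_j complex.Re (a j)) + qform G (\col_j complex.Im (a j)))%:E.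
Proof.
pose c i j := complex.Re (a i) * complex.Re (a j) + complex.Im (a i) * complex.Im (a j).
pose f i j (q : plane) := ((c i j)%:E * (normc (toC q) ^+ (k + m - i - j).*2)%:E)%E.
have If i j : (@gauss R).-integrable setT (f i j).
  by apply: integrableZl => //; exact: integrable_moment.
transitivity (\int[@gauss R]_q (\sum_(i < p.+1) \sum_(j < p.+1) f i j q))%E.
  apply: eq_integral => q _; rewrite normc_diag_sq -sumEFin; apply: eq_bigr => i _.
  by rewrite -sumEFin; apply: eq_bigr => j _; rewrite EFinM.
rewrite integral_sum//; last by move=> i; apply: integrable_sum => // j _; exact: If.
rewrite !qformE -big_split/= -sumEFin; apply: eq_bigr => i _.
rewrite integral_sum// -big_split/= -sumEFin; apply: eq_bigr => j _.
rewrite /f integralZl//; last exact: integrable_moment.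
by rewrite integral_moment -EFinM !mxE /c; congr EFin; ring.
Qed.

(** Gram-Schmidt, as the Cholesky factorization of the Gram matrix; that matrix
    is real because the products of the monomials with conjugates of the
    others are powers of the modulus. *)
Lemma diag_orthonormal k (p := minn k m) : exists2 L : 'M[C]_p.+1, L \in unitmx &
  forall a : nat -> C, sqnorm (diag m k a) = (cvnorm (L *m \col_j a j) ^+ 2)%:E.
Proof.
pose G := \matrix_(i < p.+1, j < p.+1) moment (k + m - i - j).
have posG x : x != 0 -> 0 < qform G x.
  move=> x0; pose a j : C := (x (inord j) 0)%:C%C.
  have ex : (\col_(j < p.+1) complex.Re (a j)) = x.
    by apply/colP => j; rewrite mxE /= inord_val.
  have ey : (\col_(j < p.+1) complex.Im (a j)) = 0 by apply/colP => j; rewrite !mxE.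
  have E : sqnorm (diag m k a) = (qform G (\col_j complex.Re (a j)) +
    qform G (\col_j complex.Im (a j)))%:E := sqnorm_diag k a.
  rewrite ex ey [qform G 0]/qform mulmx0 mxE addr0 in E.
  have g0 : 0 <= qform G x by rewrite -lee_fin -E sqnorm_ge0.
  rewrite lt_neqAle g0 andbT eq_sym; apply: contra_neq x0 => q0.
  rewrite q0 in E; have a0 := diag_eq0 E.
  apply/colP => j; rewrite -ex mxE a0 ?mxE//; exact: ltn_ord j.
have symG : G^T = G by apply/matrixP => i j; rewrite !mxE subnAC.
have [L EL] := cholesky symG posG.
exists (map_mx (real_complex R) L) => [|a].
  rewrite map_unitmx -unitmx_tr -row_free_unit; apply: inj_row_free => v vL.
  apply/eqP; apply: contraT => v0.
  have /posG : v^T != 0 by rewrite -(inj_eq trmx_inj) trmxK trmx0.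
  rewrite EL qform_tr_mul big1 ?ltxx// => i _.
  by rewrite -[L]trmxK -trmx_mul vL trmx0 mxE expr0n.
have E : sqnorm (diag m k a) = (qform G (\col_j complex.Re (a j)) +
    qform G (\col_j complex.Im (a j)))%:E := sqnorm_diag k a.
rewrite E EL !qform_tr_mul cvnorm_sq -big_split/=; congr EFin; apply: eq_bigr => i _.
rewrite normc_sq; congr (_ ^+ 2 + _ ^+ 2); rewrite !mxE.
  rewrite (big_morph _ (@ReD R) (erefl : complex.Re (0 : C) = 0)); apply: eq_bigr => j _.
  by rewrite !mxE Re_mul /= mul0r subr0.
rewrite (big_morph _ (@ImD R) (erefl : complex.Im (0 : C) = 0)); apply: eq_bigr => j _.
by rewrite !mxE Im_mul /= mul0r addr0.
Qed.

(** The truncated diagonal subspaces are finite-dimensional Hilbert spaces. *)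
Lemma comp_alg_mx_iso k : isometrically_isomorphic
  (bounded_alg (Dspace R (k%:Z - m%:Z) (minn k m).+1)) (@mx_alg R (minn k m).+1).
Proof.
set H := Dspace _ _ _; set p := minn k m.
have [L uL HL] := @diag_orthonormal k.
pose a (v : 'cV[C]_p.+1) j : C := (invmx L *m v) (inord j) 0.
have memU v : diag m k (a v) \in subspace_pred H.
  by apply/mem_set; rewrite /= Dset_comp; eexists.
have ea v : \col_j a v j = invmx L *m v by apply/colP => j; rewrite mxE /a inord_val.
apply: (@bounded_alg_mx_iso _ H p.+1 (fun v => Vec (memU v))).
- move=> c v w; apply/val_inj; rewrite /= -diag_lin; apply: diag_ext => j _.
  by rewrite /a mulmxDr -scalemxAr !mxE.
- move=> f; have : comp m k f by rewrite -Dset_comp; apply: set_mem; case: f.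
  case=> b _ fb; exists (L *m \col_j b j); apply/val_inj; rewrite /= -fb.
  by apply: diag_ext => j jk; rewrite /a mulKmx// mxE inordK.
move=> v /=; apply/eqP; rewrite -(eqrXn2 (n := 2)) ?cvnorm_ge0 ?L2norm_ge0//.
by apply/eqP/EFin_inj; rewrite -sqnormE ?HL ?ea ?mulKVmx//; exact: L2_diag.
Qed.

End Gram.

(** * Radial operators act on the components *)

(** Total, with value 0 outside the subspace, so that operators can be written without
    membership proofs; locked, to keep unification from unfolding it into the
    pointwise operations. *)
HB.lock
Definition tovec (R : realType) (H : Defs.subspace R) (h : R[i] -> R[i]) : vec H :=
  insubd 0 h.

Section Vectors.
Context {R : realType}.
Local Notation C := R[i].
Implicit Type H : Defs.subspace R.

Lemma vecP H (f : vec H) : (H : set (C -> C)) f.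
Proof. by apply: set_mem; case: f. Qed.

Lemma tovecK H (h : C -> C) : (H : set (C -> C)) h -> (tovec H h : C -> C) = h.
Proof. by move=> Hh; rewrite unlock; apply: insubdK; apply/mem_set. Qed.

Lemma tovec_val H (f : vec H) : tovec H f = f.
Proof. rewrite unlock; exact: valKd. Qed.

Lemma vec_eq H (f g : vec H) : (f : C -> C) = g -> f = g.
Proof. exact: val_inj. Qed.

Lemma linear_sum_vec H (S : vec H -> vec H) n (f : nat -> vec H) : linear S ->
  S (\sum_(i < n) f i) = \sum_(i < n) S (f i).
Proof.
move=> LS; have := lin_comb (fun=> 1) (fun i : 'I_n => f i) LS.
by under eq_bigr do rewrite scale1r; under [RHS]eq_bigr do rewrite scale1r.
Qed.

Lemma linear_scale H (H' : Defs.subspace R) (S : vec H -> vec H') : linear S ->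
  forall c f, S (c *: f) = c *: S f.
Proof.
move=> LS c f; have S0 : S 0 = 0.
  by have := LS (-1) 0 0; rewrite scaler0 addr0 scaleN1r addNr.
by have := LS c f 0; rewrite !addr0 S0 addr0.
Qed.

End Vectors.

Section Decomposition.
Context {R : realType}.
Local Notation C := R[i].
Variable m : nat.
Local Notation F := (Fspace R m.+1).
Implicit Types (f : vec F) (S : vec F -> vec F) (k : nat).

Lemma L2_vec f : L2 f.
Proof. by have [] := vecP f. Qed.

Lemma parts_ex f : exists g, expands m f g /\ forall k, comp m k (g k).
Proof. by have [g] := Fset_expands (vecP f); exists g. Qed.

Definition parts f : nat -> C -> C := proj1_sig (cid (parts_ex f)).

Lemma parts_expands f : expands m f (parts f).
Proof. by have [] := proj2_sig (cid (parts_ex f)). Qed.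

Lemma parts_comp f k : comp m k (parts f k).
Proof. by have [_] := proj2_sig (cid (parts_ex f)). Qed.

Lemma parts_uniq f g : expands m f g -> parts f = g.
Proof. exact/expands_uniq/parts_expands. Qed.

Lemma parts_inj f f' : parts f = parts f' -> f = f'.
Proof.
move=> e; apply: vec_eq; apply: expands_eq (parts_expands f) _.
by rewrite e; exact: parts_expands.
Qed.

Lemma parts_lin (c : C) f f' k : parts (c *: f + f') k = c *: parts f k + parts f' k.
Proof.
by rewrite (@parts_uniq (c *: f + f') _ (expands_lin c (parts_expands f) (parts_expands f'))).
Qed.

Lemma parts_single f k : comp m k f -> parts f = (fun j => if j == k then f : C -> C else 0).
Proof. by move=> cf; apply: parts_uniq; exact: comp_expands. Qed.

Definition part k f : vec F := tovec F (parts f k).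

Lemma partE k f : (part k f : C -> C) = parts f k.
Proof. by apply: tovecK; apply: comp_Fset; exact: parts_comp. Qed.

Lemma sum_parts_le f K : \sum_(k < K) L2norm (parts f k) ^+ 2 <= L2norm f ^+ 2.
Proof.
rewrite -lee_fin -sumEFin -sqnormE; last exact: L2_vec.
apply: le_trans (bessel K (parts_expands f)).
by apply: lee_sum => k _; rewrite -sqnormE//; exact: comp_L2 (parts_comp _ _).
Qed.

Lemma norm_le_parts f g (B : R) : expands m f g -> (forall k, comp m k (g k)) ->
  (forall K, \sum_(k < K) L2norm (g k) ^+ 2 <= B) -> L2norm f ^+ 2 <= B.
Proof.
move=> E cg HB; rewrite -lee_fin -sqnormE; last exact: L2_vec.
apply: (sqnorm_expands_le E) => K; apply: le_trans (_ : ((\sum_(k < K) L2norm (g k) ^+ 2)%:E <= _)%E).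
  by rewrite -sumEFin; apply: lee_sum => k _; rewrite -sqnormE//; exact: comp_L2 (cg k).
by rewrite lee_fin.
Qed.

Definition tail K f : vec F := f - \sum_(k < K) part k f.

Lemma sum_partE K f z : (\sum_(k < K) part k f : vec F) z = \sum_(k < K) parts f k z.
Proof.
elim: K => [|K IH]; first by rewrite !big_ord0.
by rewrite !big_ord_recr /= -IH -partE.
Qed.

(** The remainder of the convergent series of squared norms. *)
Lemma tail_small f (e : R) k : 0 < e -> exists2 K, (k < K)%N & L2norm (tail K f) ^+ 2 <= e.
Proof.
move=> e0; pose s N := \sum_(k < N) L2norm (parts f k) ^+ 2.
have ndec N M : (N <= M)%N -> s N <= s M.
  move=> NM; rewrite /s (big_ord_widen _ (fun k => L2norm (parts f k) ^+ 2) NM) big_mkcond.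
  by apply: ler_sum => i _; case: ifP => // _; rewrite sqr_ge0.
have hs : has_sup (range s).
  by split; [exists (s 0%N), 0%N|exists (L2norm f ^+ 2) => _ [N _ <-]; exact: sum_parts_le].
have [_ [N _ <-] lt] := sup_adherent e0 hs.
exists (maxn N k.+1); first by rewrite leq_max leqnn orbT.
set K := maxn N k.+1.
have le : sup (range s) - e < s K by apply: lt_le_trans lt _; rewrite ndec// leq_maxl.
have E : expands m (tail K f) (fun k => if (k < K)%N then 0 else parts f k).
  have := expands_drop K (parts_expands f); congr (expands m _ _).
  by apply/funext => z; rewrite -sum_partE.
apply: (norm_le_parts E) => [j|K'].
  case: ifP => _; last exact: parts_comp.
  exact: comp0.
apply: (@le_trans _ _ (s (maxn K K') - s K)).
  rewrite lerBrDl /s (big_ord_widen _ (fun k => L2norm (parts f k) ^+ 2) (leq_maxl K K')).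
  rewrite (big_ord_widen _ (fun k => L2norm (if (k < K)%N then 0 else parts f k) ^+ 2) (leq_maxr K K')).
  rewrite [X in X + _]big_mkcond [X in _ + X]big_mkcond -big_split/=.
  apply: ler_sum => i _; case iK: (i < K)%N; last by rewrite add0r; case: ifP; rewrite ?sqr_ge0.
  have n0 : L2norm (0 : C -> C) = 0.
    have L0 : L2 (0 : C -> C) by have [c0 _] := @L2_submod_closed R; exact: set_mem c0.
    by rewrite -[0 in LHS](scale0r 0) L2normZ// normc0 mul0r.
  by rewrite n0 expr0n; case: ifP; rewrite addr0.
have : s (maxn K K') <= sup (range s) by apply: ub_le_sup; [case: hs|exists (maxn K K')].
by move: le; lra.
Qed.

Definition preserves_comps S := forall k f, comp m k f -> comp m k (S f).

(** Continuity reduces the commutation with the projections to the finite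
    partial sums, where it is linearity. *)
Lemma parts_commute S : bounded_op S -> preserves_comps S ->
  forall f k, parts (S f) k = S (part k f).
Proof.
move=> [LS [M HM]] pS f k.
have cp j g : comp m j (S (part j g)) by apply: pS; rewrite partE; exact: parts_comp.
pose D := parts (S f) k - S (part k f).
have cD' : comp m k D.
  rewrite /D addrC -scaleN1r; apply: comp_lin; [exact: cp|exact: parts_comp].
suff D0 : D = 0 by apply/eqP; rewrite -subr_eq0; apply/eqP.
have DE K : (k < K)%N -> D = parts (S (tail K f)) k.
  move=> kK; have -> : S (tail K f) = (-1) *: \sum_(j < K) S (part j f) + S f.
    rewrite /tail addrC -scaleN1r LS; congr (_ *: _ + _).
    exact: (linear_sum_vec K (fun j => part j f)).
  have sumP (h : nat -> vec F) N : parts (\sum_(j < N) h j) k = \sum_(j < N) parts (h j) k.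
    elim: N => [|N IH].
      by rewrite !big_ord0 (@parts_uniq 0 _ (expands0 m)).
    by rewrite !big_ord_recr/= -IH -[X in parts (X + _)]scale1r parts_lin scale1r.
  have e : parts (\sum_(j < K) S (part j f)) k = S (part k f).
    rewrite (sumP (fun j => S (part j f))) (bigD1 (Ordinal kK))//= big1 => [|j jk].
      by rewrite addr0 (parts_single (cp k f)) eqxx.
    by rewrite (parts_single (cp j f)) ifN// eq_sym.
  by rewrite parts_lin e scaleN1r addrC.
apply: (comp_eq0 cD'); rewrite sqnormE; last exact: comp_L2 cD'.
congr EFin; apply/eqP; rewrite eq_le sqr_ge0 andbT.
apply/ler_addgt0Pr => e e0; rewrite add0r.
have M0 : 0 < M ^+ 2 + 1 by rewrite ltr_wpDl ?sqr_ge0.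
have [K kK HK] := @tail_small f (e / (M ^+ 2 + 1)) k (divr_gt0 e0 M0).
rewrite (DE K kK); apply: le_trans (_ : L2norm (S (tail K f)) ^+ 2 <= _).
  apply: le_trans (sum_parts_le _ k.+1); rewrite big_ord_recr/= lerDr.
  by apply: sumr_ge0 => i _; rewrite sqr_ge0.
have MM : L2norm (S (tail K f)) ^+ 2 <= M ^+ 2 * L2norm (tail K f) ^+ 2.
  rewrite -exprMn -[leRHS]real_normK ?num_real// lerXn2r ?nnegrE ?L2norm_ge0//.
  by apply: le_trans (HM _) (ler_norm _).
apply: le_trans MM _; rewrite ler_pdivlMr// in HK; apply: le_trans HK.
by rewrite mulrC ler_wpM2l ?sqr_ge0// lerDl.
Qed.

Lemma expands_rot (tau : C) (f : C -> C) g : normc tau = 1 -> expands m f g ->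
  expands m (Defs.rot tau f) (fun k => Defs.rot tau (g k)).
Proof.
move=> t1 [G H mg]; have ti : normc tau^-1 = 1 by rewrite normcV t1 invr1.
split.
- move=> rho; have [M HM] := G rho; exists M => z zr N; apply: HM.
  by rewrite normcM ti mul1r.
- by move=> k w z w1; rewrite /Defs.rot mulrCA H.
- by move=> k; exact: cmeas_rot.
Qed.

Definition rot_factor (tau : C) k : C := tau^-1 ^+ k * ((tau^-1)^*)%C ^+ m.

Lemma rot_homog (tau : C) (f : C -> C) k : normc tau = 1 -> homog m k f ->
  Defs.rot tau f = rot_factor tau k *: f.
Proof.
by move=> t1 H; apply/funext => z; rewrite /Defs.rot H// normcV t1 invr1.
Qed.

(** [S f] is homogeneous of the same degree as [f], hence its expansion consists of a
    single component, by uniqueness. *)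
Lemma radial_preserves_comps S : @radial R m.+1 S -> preserves_comps S.
Proof.
move=> [[LS _] rS] k f cf.
have hS : homog m k (S f).
  move=> w z w1; have ti : normc w^-1 = 1 by rewrite normcV w1 invr1.
  have e : (rot_factor w^-1 k *: f : vec F) = Defs.rot w^-1 f :> (C -> C).
    by rewrite (rot_homog ti (comp_homog cf)).
  have := rS _ ti f _ e; rewrite linear_scale// => /(congr1 (fun h : C -> C => h z)).
  by rewrite /Defs.rot /rot_factor invrK => <-.
have [G _ _] := parts_expands (S f).
have E : expands m (S f) (fun j => if j == k then S f : C -> C else 0).
  apply: expands_single => //; first by have /L2P[] := L2_vec (S f).
  move=> rho; have [M HM] := G rho; exists M => z /HM/(_ 0%N).
  by rewrite big_ord0 subr0 expr0 divr1.
by have := parts_comp (S f) k; rewrite (parts_uniq E) eqxx.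
Qed.

(** On the components rotations are scalars, so [S] commutes with them there, and
    [S f] is determined by its components [S (part k f)]. *)
Lemma preserves_comps_radial S : bounded_op S -> preserves_comps S -> @radial R m.+1 S.
Proof.
move=> bS pS; split=> // tau t1 f g gf; have [LS _] := bS.
have comm := parts_commute bS pS.
apply: (expands_eq (parts_expands (S g))); have := expands_rot t1 (parts_expands (S f)).
congr (expands m _ _); apply/funext => k; rewrite !comm.
have pg : part k g = rot_factor tau k *: part k f.
  have E : expands m g (fun k => Defs.rot tau (parts f k)) by rewrite gf; exact: expands_rot (parts_expands f).
  apply: vec_eq; rewrite partE (parts_uniq E) (rot_homog t1 (comp_homog (parts_comp f k))).
  by rewrite -partE.
rewrite pg linear_scale// (rot_homog t1 (k := k))//.
by apply: comp_homog; apply: pS; rewrite partE; exact: parts_comp.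
Qed.

End Decomposition.

(** * The algebra of radial operators as a direct sum *)

Section DirectSum.
Context {R : realType}.
Local Notation C := R[i].
Variable m : nat.
Local Notation F := (Fspace R m.+1).
Local Notation D d := (Dspace R (val (d : dindex m.+1)) (ddim m.+1 (val d))).
Implicit Types (d : dindex m.+1) (S T : vec F -> vec F) (k : nat).

Lemma ddimE (e : int) k : e = k%:Z - m%:Z -> ddim m.+1 e = (minn k m).+1.
Proof. by move=> ->; rewrite /ddim; lia. Qed.

(** The number [k] with [d = k - m], a natural number because [d] is at least [-m]. *)
Definition deg (d : dindex m.+1) : nat := absz (val d + m%:Z).

Lemma degE d : val d = (deg d)%:Z - m%:Z.
Proof. by rewrite /deg; have := valP d; lia. Qed.

Lemma DspaceE d : (D d : set (C -> C)) = comp m (deg d).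
Proof. by rewrite /= (ddimE (degE d)) {1}degE Dset_comp. Qed.

Lemma shift_ge k : 1 - m.+1%:Z <= k%:Z - m%:Z.
Proof. lia. Qed.

Definition dind k : dindex m.+1 := exist _ (k%:Z - m%:Z) (shift_ge k).

Lemma dindK k : deg (dind k) = k.
Proof. by rewrite /deg /=; lia. Qed.

Lemma degK d : dind (deg d) = d.
Proof. by apply: val_inj; rewrite /= -degE. Qed.

Lemma preserves_compsP (S : vec F -> vec F) :
  (forall d : int, 1 - m.+1%:Z <= d -> acts_invariantly (Dset d (ddim m.+1 d)) S) <->
  preserves_comps S.
Proof.
split=> [H k f|H e he f].
  have := H _ (shift_ge k) f; rewrite (ddimE (erefl _)) Dset_comp; exact.
have := H (deg (exist _ e he)) f; rewrite -(DspaceE (exist _ e he)); exact.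
Qed.

Lemma L2norm_vec (H : Defs.subspace R) : (forall f, (H : set (C -> C)) f -> L2 f) ->
  (forall f : vec H, 0 <= L2norm f) /\
  (forall c (f : vec H), L2norm (c *: f : vec H) = normc c * L2norm f).
Proof.
move=> HL; split=> [f|c f]; first exact: L2norm_ge0.
by rewrite -L2normZ//; apply: HL; exact: vecP.
Qed.

Lemma L2norm_F : (forall f : vec F, 0 <= L2norm f) /\
  (forall c (f : vec F), L2norm (c *: f : vec F) = normc c * L2norm f).
Proof. by apply: L2norm_vec => f []. Qed.

Lemma L2norm_D d : (forall f : vec (D d), 0 <= L2norm f) /\
  (forall c (f : vec (D d)), L2norm (c *: f : vec (D d)) = normc c * L2norm f).
Proof. by apply: L2norm_vec => f; rewrite DspaceE; exact: comp_L2. Qed.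

Lemma comp_vecD d (v : vec (D d)) : comp m (deg d) v.
Proof. by rewrite -DspaceE; exact: vecP. Qed.

Definition embed d (v : vec (D d)) : vec F := tovec F v.

Lemma embedE d (v : vec (D d)) : (embed v : C -> C) = v.
Proof. by apply: tovecK; apply: comp_Fset; exact: comp_vecD v. Qed.

Lemma embed_lin d c (v w : vec (D d)) : embed (c *: v + w) = c *: embed v + embed w.
Proof. by apply: vec_eq; rewrite /= !embedE. Qed.

Definition compress (S : vec F -> vec F) d (v : vec (D d)) : vec (D d) :=
  tovec (D d) (S (embed v)).

Lemma compressE S d (v : vec (D d)) : preserves_comps S ->
  (compress S v : C -> C) = S (embed v).
Proof.
move=> pS; apply: tovecK; rewrite DspaceE; apply: pS; rewrite embedE; exact: comp_vecD.
Qed.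

Lemma embed_compress S d (v : vec (D d)) : preserves_comps S ->
  embed (compress S v) = S (embed v).
Proof. by move=> pS; apply: vec_eq; rewrite embedE compressE. Qed.

Lemma embed_part k (f : vec F) : embed (tovec (D (dind k)) (parts f k)) = part k f.
Proof.
apply: vec_eq; rewrite embedE partE tovecK// DspaceE dindK; exact: parts_comp.
Qed.

Lemma parts_compress S (f : vec F) k : bounded_op S -> preserves_comps S ->
  parts (S f) k = compress S (tovec (D (dind k)) (parts f k)).
Proof. by move=> bS pS; rewrite parts_commute// compressE// embed_part. Qed.

Lemma compress_bounded S d : bounded_op S -> preserves_comps S ->
  [/\ linear (fun v : vec (D d) => compress S v),
    forall v : vec (D d), L2norm (compress S v) <= opnorm (fun f : vec F => L2norm f) S * L2norm v &
    opnorm (fun v : vec (D d) => L2norm v) (compress S (d := d)) <=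
    opnorm (fun f : vec F => L2norm f) S].
Proof.
move=> [LS bS] pS; have [n0 nZ] := L2norm_F; have [n0' nZ'] := L2norm_D d.
have b (v : vec (D d)) : L2norm (compress S v) <= opnorm (fun f : vec F => L2norm f) S * L2norm v.
  rewrite compressE// -(embedE v); apply: (opnorm_bound n0 nZ) => // c f.
  exact: linear_scale.
split=> //; last by apply: opnorm_le => //; exact: opnorm_ge0.
by move=> c v w; apply: vec_eq; rewrite /= !compressE// embed_lin LS.
Qed.

(** By orthogonality, bounds on the components add up to the same bound on the whole. *)
Lemma opnorm_le_compress S (c : R) : bounded_op S -> preserves_comps S -> 0 <= c ->
  (forall d (v : vec (D d)), L2norm (compress S v) <= c * L2norm v) ->
  opnorm (fun f : vec F => L2norm f) S <= c.
Proof.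
move=> bS pS c0 H; have [n0 nZ] := L2norm_F; apply: opnorm_le => // f.
rewrite -ler_sqr ?nnegrE ?mulr_ge0// exprMn.
apply: (norm_le_parts (parts_expands (S f)) (parts_comp _)) => K.
apply: le_trans (_ : c ^+ 2 * \sum_(k < K) L2norm (parts f k) ^+ 2 <= _); last first.
  by rewrite ler_wpM2l ?sqr_ge0// sum_parts_le.
rewrite mulr_sumr; apply: ler_sum => k _; rewrite -exprMn lerXn2r ?nnegrE ?mulr_ge0 ?L2norm_ge0//.
rewrite parts_compress//; apply: le_trans (H _ _) _.
by rewrite tovecK// DspaceE dindK; exact: parts_comp.
Qed.

(** The value at [f] is the sum of the images of the components of [f]; it exists by
    [Fset_synth] because the bound is common to all degrees. *)
Lemma assemble (y : forall d, vec (D d) -> vec (D d)) (c : R) : 0 <= c ->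
  (forall d, linear (y d)) -> (forall d v, L2norm (y d v) <= c * L2norm v) ->
  exists S : vec F -> vec F,
    [/\ bounded_op S, preserves_comps S & forall d (v : vec (D d)), compress S v = y d v].
Proof.
move=> c0 Ly by_.
pose Y k (h : C -> C) : C -> C := y (dind k) (tovec (D (dind k)) h).
have tv k h : comp m k h -> (tovec (D (dind k)) h : C -> C) = h.
  by move=> ch; apply: tovecK; rewrite DspaceE dindK.
have cY k h : comp m k (Y k h) by have := comp_vecD (y (dind k) (tovec _ h)); rewrite dindK.
have nY k h : comp m k h -> L2norm (Y k h) <= c * L2norm h.
  by move=> ch; apply: le_trans (by_ _ _) _; rewrite tv.
have YD a k h h' : comp m k h -> comp m k h' -> Y k (a *: h + h') = a *: Y k h + Y k h'.
  move=> ch ch'; have e : tovec (D (dind k)) (a *: h + h') =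
      a *: tovec (D (dind k)) h + tovec (D (dind k)) h'.
    by apply: vec_eq; rewrite /= !tv//; exact: comp_lin.
  by rewrite /Y e Ly.
have Yd d (v : vec (D d)) : Y (deg d) v = y d v.
  by rewrite /Y; move: (dind _) (degK d) => d' e; subst d'; rewrite tovec_val.
have sY (f : vec F) K : \sum_(k < K) L2norm (Y k (parts f k)) ^+ 2 <= c ^+ 2 * L2norm f ^+ 2.
  apply: le_trans (_ : c ^+ 2 * \sum_(k < K) L2norm (parts f k) ^+ 2 <= _); last first.
    by rewrite ler_wpM2l ?sqr_ge0// sum_parts_le.
  rewrite mulr_sumr; apply: ler_sum => k _; rewrite -exprMn.
  rewrite lerXn2r ?nnegrE ?mulr_ge0 ?L2norm_ge0// nY//; exact: parts_comp.
have /choice[S ES] (f : vec F) : exists s : vec F, expands m s (fun k => Y k (parts f k)).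
  have [|K|s [Fs es _]] := @Fset_synth R m (fun k => Y k (parts f k)) (c ^+ 2 * L2norm f ^+ 2).
  - by move=> k; exact: cY.
  - have := sY f K; rewrite -lee_fin -sumEFin; apply: le_trans.
    by apply: lee_sum => k _; rewrite -sqnormE//; exact: comp_L2 (cY _ _).
  by exists (tovec F s); rewrite tovecK.
have LS : linear S.
  move=> a f f'; apply: parts_inj; rewrite (parts_uniq (ES _)); apply/funext => k.
  by rewrite !parts_lin !(parts_uniq (ES _)) YD//; exact: parts_comp.
have bS (f : vec F) : L2norm (S f) <= c * L2norm f.
  rewrite -ler_sqr ?nnegrE ?mulr_ge0 ?L2norm_ge0// exprMn.
  by apply: (norm_le_parts (ES f)) => // k; exact: cY.
have Y0 k : Y k 0 = 0.
  have c00 := @comp0 R m k; have := YD (-1) k _ _ c00 c00; by rewrite scaler0 addr0 scaleN1r addNr.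
have SE k (f : vec F) : comp m k f -> (S f : C -> C) = Y k f.
  move=> cf; apply: expands_eq (ES f) _; have := comp_expands (cY k f); congr (expands m _ _).
  by apply/funext => j; rewrite (parts_single cf); case: eqP => [->|].
have pS : preserves_comps S by move=> k f cf; rewrite (SE k f cf).
exists S; split => //; first by split=> //; exists c.
move=> d v; apply: vec_eq; rewrite compressE// (SE (deg d)) ?embedE ?Yd//.
exact: comp_vecD.
Qed.

Lemma radial_preserves S : @radial R m.+1 S -> bounded_op S /\ preserves_comps S.
Proof. by move=> rS; split; [case: rS|exact: radial_preserves_comps]. Qed.

(** The isomorphism restricts an operator to the diagonal subspaces. *)
Lemma radial_alg_iso : isometrically_isomorphic (op_alg (@radial R m.+1))
  (dsum_alg (fun d : dindex m.+1 => bounded_alg (D d))).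
Proof.
have [n0 nZ] := L2norm_F.
have rng0 S : range (fun d => opnorm (fun v : vec (D d) => L2norm v) (compress S (d := d))) !=set0.
  by exists (opnorm (fun v : vec (D (dind 0)) => L2norm v) (compress S (d := dind 0))), (dind 0).
have ub S : bounded_op S -> preserves_comps S -> ubound
    (range (fun d => opnorm (fun v : vec (D d) => L2norm v) (compress S (d := d))))
    (opnorm (fun f : vec F => L2norm f) S).
  by move=> bS pS _ [d _ <-]; have [] := compress_bounded d bS pS.
have bc S d : bounded_op S -> preserves_comps S -> bounded_op (compress S (d := d)).
  by move=> bS pS; have [l b _] := compress_bounded d bS pS; split => //; eexists; exact: b.
exists (fun S d => compress S (d := d)); split => /=.
- split.
  + move=> S /radial_preserves[bS pS]; split=> [d|]; first exact: bc.
    by exists (opnorm (fun f : vec F => L2norm f) S); exact: ub.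
  + move=> S T /set_mem/radial_preserves[bS pS] /set_mem/radial_preserves[bT pT] e.
    apply/funext => f; apply: parts_inj; apply/funext => k; rewrite !parts_compress//.
    by have /(congr1 (fun h => h (dind k))) := e => /= ->.
  + move=> y [By [c Hc]].
    have yc d v : L2norm (y d v) <= c * L2norm v.
      have [m0 mZ] := L2norm_D d; have [Ly by_] := By d.
      apply: le_trans (opnorm_bound m0 mZ (linear_scale Ly) by_ v) _.
      by rewrite ler_wpM2r// Hc//; exists d.
    have c0 : 0 <= c.
      have [m0 mZ] := L2norm_D (dind 0); have [_ by_] := By (dind 0).
      by apply: le_trans (opnorm_ge0 m0 mZ by_) _; apply: Hc; exists (dind 0).
    have [S [bS pS Sy]] := assemble c0 (fun d => (By d).1) yc.
    exists S; first exact: preserves_comps_radial.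
    by apply: functional_extensionality_dep => d; apply/funext => v; exact: Sy.
- move=> S T /radial_preserves[bS pS] /radial_preserves[bT pT].
  have [[LS _] [LT _]] := (bS, bT).
  have pST : preserves_comps (S + T).
    move=> k f cf; have := comp_lin 1 (pS k f cf) (pT k f cf); by rewrite scale1r.
  apply: functional_extensionality_dep => d; apply/funext => v; apply: vec_eq.
  by rewrite compressE//= !compressE.
- move=> c S /radial_preserves[bS pS].
  have pcS : preserves_comps (c *: S).
    move=> k f cf; have := comp_lin c (pS k f cf) (@comp0 R m k); by rewrite addr0.
  apply: functional_extensionality_dep => d; apply/funext => v; apply: vec_eq.
  by rewrite compressE//= compressE.
- move=> S T /radial_preserves[bS pS] /radial_preserves[bT pT].
  have pST : preserves_comps (S \o T) by move=> k f cf; apply: pS; exact: pT.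
  apply: functional_extensionality_dep => d; apply/funext => v; apply: vec_eq.
  by rewrite compressE//= compressE// embed_compress.
- move=> S /radial_preserves[bS pS]; apply/eqP; rewrite eq_le; apply/andP; split.
    exact: ge_sup (rng0 S) (ub S bS pS).
  have hub : has_ubound (range (fun d => opnorm (fun v : vec (D d) => L2norm v) (compress S (d := d)))).
    by eexists; exact: ub bS pS.
  have le d : opnorm (fun v : vec (D d) => L2norm v) (compress S (d := d)) <=
      sup (range (fun d => opnorm (fun v : vec (D d) => L2norm v) (compress S (d := d)))).
    by apply: ub_le_sup => //; exists d.
  apply: opnorm_le_compress => //.
    have [m0 mZ] := L2norm_D (dind 0); have [_ b] := bc S (dind 0) bS pS.
    exact: le_trans (opnorm_ge0 m0 mZ b) (le (dind 0)).
  move=> d v; have [m0 mZ] := L2norm_D d; have [l b] := bc S d bS pS.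
  apply: le_trans (opnorm_bound m0 mZ (linear_scale l) b v) _.
  exact: ler_wpM2r (m0 v) _ _ (le d).
Qed.

End DirectSum.

Theorem theorem1p1 (R : realType) (n : nat) (n_gt0 : (0 < n)%N) :
  [/\ forall S : vec (Fspace R n) -> vec (Fspace R n),
        radial S <->
        bounded_op S /\
        (forall d : int, 1 - n%:Z <= d ->
          acts_invariantly (Dset d (ddim n d)) S),
      isometrically_isomorphic (op_alg (@radial R n))
        (dsum_alg (fun d : dindex n =>
           bounded_alg (Dspace R (val d) (ddim n (val d))))) &
      isometrically_isomorphic
        (dsum_alg (fun d : dindex n =>
           bounded_alg (Dspace R (val d) (ddim n (val d)))))
        (dsum_alg (fun d : dindex n => @mx_alg R (ddim n (val d))))].
Proof.
case: n n_gt0 => // m _; split.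
- move=> S; split=> [/radial_preserves[bS /preserves_compsP pS]//|[bS /preserves_compsP pS]].
  exact: preserves_comps_radial.
- exact: radial_alg_iso.
apply: dsum_alg_iso => d; rewrite (ddimE (degE d)) degE.
exact: comp_alg_mx_iso.
Qed.
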